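(* (1) Let $U,V$ be finite-alphabet random variables with joint distribution $p(x,y,z,v,u)=p(x,y)p(z|x)p(v|y)p(u|x,v)$ (so in particular $V-Y-X-Z$) and $\hat X(U,V,Z)$ a deterministic function such that $D\ge\mathbb E\, d(X,\hat X(U,V,Z))$, and set $R=I(X;U|V,Z)$, $R'=I(Y;V|Z)=I(V;Y)-I(V;Z)$. Then $(R,R_e,R')\in\mathcal R_g^O(D)$ for every $R_e\ge I(V;Y|Z)-I(V;X|Z)=I(V;Y)-I(V;X)$. (2) If $(R,R')\notin\mathcal R_{Y-X-Z}(D)$, then $(R,R_e,R')\notin\mathcal R_g^O(D)$ for every $R_e$.
   Context: Let $\mathcal X,\mathcal Y,\mathcal Z,\hat{\mathcal X}$ be finite alphabets, $d:\mathcal X\times\hat{\mathcal X}\to[0,\infty)$, and $(X_i,Y_i,Z_i)$ i.i.d. $\sim p(x,y)p(z|x)$ (Markov chain $Y-X-Z$). An $(n,M,M_e,M_d,D)$ code with different helper messages consists of helper encoders $f_e:\mathcal Y^n\to\{1,\dots,M_e\}$ (to the source encoder) and $f_d:\mathcal Y^n\to\{1,\dots,M_d\}$ (to the decoder), a source encoder $f:\mathcal X^n\times\{1,\dots,M_e\}\to\{1,\dots,M\}$, and a decoder that, using $f(X^n,f_e(Y^n))$, $f_d(Y^n)$ and the side information $Z^n$, outputs $\hat X^n$, with $\mathbb E[\frac1n\sum_i d(X_i,\hat X_i)]\le D$. $(R,R_e,R_d)$ is achievable if for every $\delta>0$ and large $n$ there exists an $(n,2^{n(R+\delta)},2^{n(R_e+\delta)},2^{n(R_d+\delta)},D+\delta)$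 code; $\mathcal R_g^O(D)$ is the closure of the set of achievable triples. $\mathcal R_{Y-X-Z}(D)$ is the set of pairs $(R,R_1)$ with $R_1\ge I(U;Y|Z)$ and $R\ge I(X;W|U,Z)$ for some finite-alphabet $U,W$ with joint distribution $p(x,y)p(z|x)p(u|y)p(w|x,u)$ and a function $\hat X(U,W,Z)$ with $\mathbb E\, d(X,\hat X(U,W,Z))\le D$ (it is the achievable region when the helper sends a single common message of rate $R_1$ to both encoder and decoder). *)

(* Defs.v *)
From HB Require Import structures.
From mathcomp Require Import all_boot all_order all_algebra.
From mathcomp Require Import all_classical all_reals all_analysis.
Set Implicit Arguments. Unset Strict Implicit. Unset Printing Implicit Defensive.
Import Order.TTheory GRing.Theory Num.Theory.
Local Open Scope ring_scope.

Section InfoTheory.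
Variable R : realType.

(* logarithm in base 2 (ln 0 = 0 in the library, so 0 * log2 0 = 0) *)
Definition log2 (x : R) : R := ln x / ln 2.
Definition pow2 (x : R) : R := expR (x * ln 2).

Definition is_pmf (T : finType) (p : T -> R) : Prop :=
  (forall t, 0 <= p t) /\ \sum_t p t = 1.
Definition is_stoch (A B : finType) (q : A -> B -> R) : Prop :=
  forall a, is_pmf (q a).

(* random variables = functions on a finite sample space Omega with weights P *)
Definition rv_law (Om T : finType) (P : Om -> R) (f : Om -> T) (t : T) : R :=
  \sum_(w | f w == t) P w.
Definition shannon_H (Om T : finType) (P : Om -> R) (f : Om -> T) : R :=
  - \sum_t rv_law P f t * log2 (rv_law P f t).
Definition cmi (Om A B C : finType) (P : Om -> R)
  (fA : Om -> A) (fB : Om -> B) (fC : Om -> C) : R :=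
  shannon_H P (fun w => (fA w, fC w)) + shannon_H P (fun w => (fB w, fC w))
  - shannon_H P (fun w => (fA w, fB w, fC w)) - shannon_H P fC.
Definition rv_expect (Om : finType) (P : Om -> R) (g : Om -> R) : R :=
  \sum_w P w * g w.

(* ---- the source: (X_i,Y_i,Z_i) iid ~ p(x,y) p(z|x), distortion d ---- *)
Variables (X Y Z Xh : finType) (pXY : X -> Y -> R) (pZ : X -> Z -> R)
          (d : X -> Xh -> R).

(* An (n, M, Me, Md) code with different helper messages; messages in 'I_M etc.
   (i.e. {1..M} up to relabelling). *)
Record code (n M Me Md : nat) := Code {
  helper_e : {ffun 'I_n -> Y} -> 'I_Me;
  helper_d : {ffun 'I_n -> Y} -> 'I_Md;
  src_enc  : {ffun 'I_n -> X} -> 'I_Me -> 'I_M;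
  dec      : 'I_M -> 'I_Md -> {ffun 'I_n -> Z} -> {ffun 'I_n -> Xh} }.

Definition exp_distortion n M Me Md (c : code n M Me Md) : R :=
  \sum_(xn : {ffun 'I_n -> X}) \sum_(yn : {ffun 'I_n -> Y})
   \sum_(zn : {ffun 'I_n -> Z})
    (\prod_(i < n) (pXY (xn i) (yn i) * pZ (xn i) (zn i))) *
    (n%:R^-1 * \sum_(i < n)
        d (xn i) (dec c (src_enc c xn (helper_e c yn)) (helper_d c yn) zn i)).

Definition achievable (D Rr Re Rd : R) : Prop :=
  forall delta : R, 0 < delta ->
  exists N : nat, forall n : nat, (N <= n)%N ->
  exists (M Me Md : nat) (c : code n M Me Md),
    [/\ M%:R <= pow2 (n%:R * (Rr + delta)),
        Me%:R <= pow2 (n%:R * (Re + delta)),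
        Md%:R <= pow2 (n%:R * (Rd + delta)) &
        exp_distortion c <= D + delta].

Definition RgO (D Rr Re Rd : R) : Prop :=
  forall e : R, 0 < e -> exists Rr' Re' Rd' : R,
    achievable D Rr' Re' Rd' /\
    [/\ `|Rr - Rr'| < e, `|Re - Re'| < e & `|Rd - Rd'| < e].

Definition RYXZ (D Rr R1 : R) : Prop :=
  exists (U W : finType) (qU : Y -> U -> R) (qW : X -> U -> W -> R)
         (xh : U -> W -> Z -> Xh),
    let P := fun o : X * Y * Z * U * W =>
      let: (x, y, z, u, w) := o in pXY x y * pZ x z * qU y u * qW x u w in
    [/\ is_stoch qU, is_stoch (fun xu : X * U => qW xu.1 xu.2),
        rv_expect P (fun o => let: (x, y, z, u, w) := o in d x (xh u w z)) <= D,
        cmi P (fun o => o.1.2) (fun o => o.1.1.1.2) (fun o => o.1.1.2) <= R1 &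
        cmi P (fun o => o.1.1.1.1) (fun o => o.2) (fun o => (o.1.2, o.1.1.2)) <= Rr].

End InfoTheory.

(* Main.v *)
Require Import Defs.
From HB Require Import structures.
From mathcomp Require Import all_boot all_order all_algebra.
From mathcomp Require Import all_classical all_reals all_analysis.
From mathcomp Require Import ring lra.
Import Order.TTheory GRing.Theory Num.Theory.
Set Implicit Arguments. Unset Strict Implicit. Unset Printing Implicit Defensive.
Local Open Scope ring_scope.

(** Part (1). Draw i.i.d. codewords v(a,b,c), each carrying codewords u(l,k) drawn from p(u|v).
    The helper sends a to the encoder and (a,b) to the decoder; the encoder recovers (b,c) from x
    and sends l; the decoder recovers c and then k from z, all by thresholding likelihood ratios.
    The helper and the encoder pick the index of least expected cost.  By soft covering, uniform
    indices followed by the reverse channels V -> Y and (U,V) -> X induce nearly the source law,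
    so minimising is at least as good, up to a small error, as the ideal system, in which the
    source is generated from uniformly drawn codewords.  No joint typicality or Markov lemma is
    needed: the decoding errors are union bounds under the ideal law, and in the n-fold product
    every error event is controlled by Chebyshev's inequality for an information density.

    Part (2). For a code of length n take U_i = (i, T, Z^{n\i}, (X,Y)^{i-1}), with T the helper's
    message to the decoder, and W = the encoder's message; telescoping entropies gives the two rate
    bounds, whatever the message to the encoder.  All quantities defining the region are linear in
    a reweighting of the letters of U (and, for given U, of W), so Caratheodory's theorem bounds
    the alphabets uniformly in n, and a limit along an ultrafilter shows that the region is
    closed. *)

(** * Finite product measures *)

(** The three indices of v share out the chain I(V;Z) <= I(V;X) <= I(V;Y): all of (a,b,c) must have
    rate just above I(V;Y) to cover Y, (b,c) just below I(V;X) to be readable from x, and c just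
    below I(V;Z) to be readable from z. This leaves a the rate I(V;Y) - I(V;X) and (a,b) the rate
    I(V;Y) - I(V;Z), the two helper rates of the statement. The pair (l,k) splits I(U;X|V) at
    I(U;Z|V) in the same way. Two obstacles shape the converse. The encoder's message depends on Y
    through its own helper message, whereas the region asks for p(w|x,u); but no quantity of the
    region involves Y and W jointly, so W may be redrawn from (X,U) without changing any of them.
    And the region is given by exact inequalities over all finite alphabets, with no closure,
    whereas a code of length n yields rates with slack and a U whose alphabet grows with n; a
    uniform bound on the alphabets is what makes a limit available. *)

Section FiniteProbability.
Variable R : realType.

Lemma sum_indic (T : finType) (t0 : T) (F : T -> R) :
  \sum_t (t == t0)%:R * F t = F t0.
Proof.
rewrite (bigD1 t0) //= eqxx mul1r big1 ?addr0 // => t /negPf ->.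
by rewrite mul0r.
Qed.

Lemma sum_indicr (T : finType) (t0 : T) (F : T -> R) :
  \sum_t F t * (t == t0)%:R = F t0.
Proof. by under eq_bigr do rewrite mulrC; rewrite sum_indic. Qed.

Lemma sum_pair (A B : finType) (G : A * B -> R) : \sum_o G o = \sum_a \sum_b G (a, b).
Proof. by rewrite pair_bigA; apply: eq_bigr => -[a b] _. Qed.

Lemma prod_sum_ffun (I T : finType) (F : I -> T -> R) :
  \sum_(f : {ffun I -> T}) \prod_i F i (f i) = \prod_i \sum_t F i t.
Proof. by rewrite bigA_distr_bigA. Qed.

Section IID.
Variables (I O : finType) (p : O -> R).

Definition iid (o : {ffun I -> O}) : R := \prod_i p (o i).

Definition upd (o : {ffun I -> O}) i s : {ffun I -> O} :=
  [ffun j => if j == i then s else o j].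

Lemma upd_same o i s : upd o i s i = s.
Proof. by rewrite ffunE eqxx. Qed.

Lemma upd_other o i j s : j != i -> upd o i s j = o j.
Proof. by rewrite ffunE => /negPf ->. Qed.

Lemma iid_ge0 o : (forall s, 0 <= p s) -> 0 <= iid o.
Proof. by move=> p0; apply: prodr_ge0. Qed.

Hypothesis pP : is_pmf p.

Lemma iid_sum1 : \sum_o iid o = 1.
Proof.
rewrite /iid (prod_sum_ffun (fun=> p)).
by rewrite big1 // => i _; case: pP.
Qed.

Lemma iid_pmf : is_pmf iid.
Proof. by split; [move=> o; apply: iid_ge0; case: pP | exact: iid_sum1]. Qed.

(* (s, o) |-> (o i, o with s at i) is an involution preserving the weight. *)
Lemma iid_resample i (Phi : {ffun I -> O} -> R) :
  \sum_o iid o * Phi o = \sum_s p s * \sum_o iid o * Phi (upd o i s).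
Proof.
pose sw (so : O * {ffun I -> O}) := (so.2 i, upd so.2 i so.1).
have swK : involutive sw.
  move=> [s o]; rewrite /sw /= upd_same; congr pair; apply/ffunP => j.
  by rewrite !ffunE; case: eqP => // ->.
transitivity (\sum_(so : O * {ffun I -> O}) p so.1 * (iid so.2 * Phi so.2)).
  rewrite -(pair_bigA _ (fun s o => p s * (iid o * Phi o))) /=.
  under [RHS]eq_bigr do rewrite -mulr_sumr.
  by rewrite -mulr_suml; case: pP => _ ->; rewrite mul1r.
rewrite (reindex_inj (inv_inj swK)) /=.
under [RHS]eq_bigr do rewrite mulr_sumr.
rewrite [RHS]pair_bigA /=; apply: eq_bigr => -[s o] _ /=.
rewrite !mulrA; congr (_ * _).
rewrite /iid (bigD1 i) //= upd_same [in RHS](bigD1 i) //= mulrCA; congr (_ * (_ * _)).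
by apply: eq_bigr => j ji; rewrite upd_other.
Qed.

Lemma iid_marg1 i (F : O -> R) : \sum_o iid o * F (o i) = \sum_s p s * F s.
Proof.
rewrite (iid_resample i); apply: eq_bigr => s _; congr (_ * _).
under eq_bigr do rewrite upd_same.
by rewrite -mulr_suml iid_sum1 mul1r.
Qed.

Lemma iid_marg2 i j (F : O -> O -> R) : i != j ->
  \sum_o iid o * F (o i) (o j) = \sum_s p s * \sum_t p t * F s t.
Proof.
move=> ij; rewrite (iid_resample i); apply: eq_bigr => s _; congr (_ * _).
under eq_bigr do rewrite upd_same upd_other 1?eq_sym //.
exact: iid_marg1.
Qed.

(** Distinct coordinates are independent, so each cross term contains the zero mean and only the
    diagonal survives. Both Chebyshev's inequality and the second-moment step of soft covering rest
    on it. *)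
Lemma iid_var0 (g : O -> R) : \sum_s p s * g s = 0 ->
  \sum_o iid o * (\sum_i g (o i)) ^+ 2 = #|I|%:R * \sum_s p s * g s ^+ 2.
Proof.
move=> g0.
transitivity (\sum_i \sum_j \sum_o iid o * (g (o i) * g (o j))).
  under [RHS]eq_bigr do rewrite exchange_big.
  rewrite exchange_big; apply: eq_bigr => o _ /=.
  rewrite expr2 mulr_suml mulr_sumr; apply: eq_bigr => i _.
  by rewrite !mulr_sumr.
rewrite (eq_bigr (fun=> \sum_s p s * g s ^+ 2)) => [|i _].
  by rewrite sumr_const mulr_natl.
rewrite (bigD1 i) //= [X in _ + X]big1 ?addr0 => [|j ji].
  by rewrite (iid_marg1 i (fun s => g s * g s)); apply: eq_bigr => s _; rewrite expr2.
rewrite (iid_marg2 (fun s t => g s * g t)) 1?eq_sym //.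
apply: big1 => s _; under eq_bigr do rewrite mulrCA.
by rewrite -mulr_sumr g0 !mulr0.
Qed.

End IID.

Lemma sum_ffun_pair (I A B : finType) (F : {ffun I -> A} -> {ffun I -> B} -> R) :
  \sum_a \sum_b F a b =
  \sum_(o : {ffun I -> A * B}) F [ffun i => (o i).1] [ffun i => (o i).2].
Proof.
rewrite pair_bigA /=.
pose zip (ab : {ffun I -> A} * {ffun I -> B}) := [ffun i => (ab.1 i, ab.2 i)].
pose unzip (o : {ffun I -> A * B}) := ([ffun i => (o i).1], [ffun i => (o i).2]).
have zK : cancel zip unzip.
  by move=> [a b]; congr pair; apply/ffunP => i; rewrite !ffunE.
have uK : cancel unzip zip.
  by move=> o; apply/ffunP => i; rewrite !ffunE -surjective_pairing.
rewrite (reindex unzip) //=.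
by exists zip => ? _; [exact: uK | exact: zK].
Qed.

Lemma sum_ffun_zip (I A B : finType) (G : {ffun I -> A * B} -> R) :
  \sum_o G o =
  \sum_(a : {ffun I -> A}) \sum_(b : {ffun I -> B}) G [ffun i => (a i, b i)].
Proof.
rewrite sum_ffun_pair; apply: eq_bigr => o _; congr G.
by apply/ffunP => i; rewrite !ffunE -surjective_pairing.
Qed.

(** The gap between the second moment and the squared mean of [|f|] is a variance, hence
    nonnegative. *)
Lemma mean_abs_le_sqrt (Om : finType) (P : Om -> R) (f : Om -> R) (v : R) :
  is_pmf P -> \sum_w P w * f w ^+ 2 <= v -> 
  \sum_w P w * `|f w| <= Num.sqrt v.
Proof.
move=> [P0 P1] hv; set m := \sum_w _.
have m0 : 0 <= m by apply: sumr_ge0 => w _; rewrite mulr_ge0.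
rewrite -(ger0_norm m0) -sqrtr_sqr ler_wsqrtr //; apply: le_trans hv.
rewrite -subr_ge0.
suff -> : \sum_w P w * f w ^+ 2 - m ^+ 2 = \sum_w P w * (`|f w| - m) ^+ 2.
  by apply: sumr_ge0 => w _; rewrite mulr_ge0 // sqr_ge0.
under [RHS]eq_bigr do rewrite sqrrB real_normK ?num_real // mulrDr mulrBr.
rewrite big_split /= sumrB -mulr_suml P1 mul1r.
under [X in _ = _ - X + _]eq_bigr do rewrite -mulrnAr mulrA.
rewrite -!mulr_suml -/m; ring.
Qed.

Lemma pmf_support (Om : finType) (P : Om -> R) : is_pmf P -> exists w, 0 < P w.
Proof.
move=> [P0 P1]; apply: contrapT => hP.
suff : \sum_w P w = 0 by rewrite P1 => /eqP; rewrite oner_eq0.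
apply: big1 => w _; apply/eqP; rewrite eq_le P0 andbT leNgt.
by apply/negP => ?; apply: hP; exists w.
Qed.

(** The probabilistic method: an average over random codebooks yields one fixed codebook. *)
Lemma exists_le_mean (Om : finType) (P : Om -> R) (f : Om -> R) (v : R) :
  is_pmf P -> \sum_w P w * f w <= v -> exists w, f w <= v.
Proof.
move=> PP hv; have [P0 P1] := PP; apply: contrapT => hn.
have h w : v < f w by rewrite ltNge; apply/negP => ?; apply: hn; exists w.
have [w Pw] := pmf_support PP.
suff : v < \sum_w P w * f w by rewrite ltNge hv.
rewrite -[X in X < _](mul1r v) -P1 mulr_suml.
rewrite (bigD1 w) //= [X in _ < X](bigD1 w) //=.
apply: ltr_leD; first by rewrite ltr_pM2l.
by apply: ler_sum => w' _; rewrite ler_wpM2l // ltW.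
Qed.

(** Bayes' rule for unnormalised weights. A row of total mass zero has no conditional law; it
    receives the point mass at [b0], so that the kernel is stochastic everywhere, while both sides
    of the identity vanish there. *)
Lemma reverse_kernel (A B : finType) (f : A -> B -> R) (b0 : B) :
  (forall a b, 0 <= f a b) ->
  exists q : A -> B -> R, is_stoch q /\
    forall a b, f a b = (\sum_b' f a b') * q a b.
Proof.
move=> f0.
exists (fun a b => if \sum_b' f a b' == 0 then (b == b0)%:R else f a b / \sum_b' f a b').
split=> [a|a b].
  case: eqP => [_|/eqP h].
    split=> [b|]; first exact: ler0n.
    by rewrite (eq_bigr (fun b => (b == b0)%:R * 1)) ?sum_indic // => b _; rewrite mulr1.
  split=> [b|]; first by rewrite divr_ge0 // sumr_ge0.
  by rewrite -mulr_suml divff.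
case: eqP => [h|/eqP h]; last by rewrite mulrC divfK.
rewrite h mul0r; move/eqP: h; rewrite psumr_eq0 // => /allP /(_ b).
by rewrite mem_index_enum => /(_ isT) /eqP.
Qed.

End FiniteProbability.

(** * Entropy *)

Section Entropy.
Variable R : realType.
Implicit Types x y : R.

Lemma ln2_gt0 : 0 < ln (2 : R).
Proof. by rewrite ln_gt0 // ltr1n. Qed.

Lemma log2M x y : 0 < x -> 0 < y -> log2 (x * y) = log2 x + log2 y.
Proof. by move=> x0 y0; rewrite /log2 lnM ?posrE // mulrDl. Qed.

Lemma log2_div x y : 0 < x -> 0 < y -> log2 (x / y) = log2 x - log2 y.
Proof. by move=> x0 y0; rewrite /log2 ln_div ?posrE // mulrBl. Qed.

Lemma log2_1 : log2 1 = 0 :> R.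
Proof. by rewrite /log2 ln1 mul0r. Qed.

Lemma le_log2 x y : 0 < x -> x <= y -> log2 x <= log2 y.
Proof.
move=> x0 xy; rewrite /log2 ler_pM2r ?invr_gt0 ?ln2_gt0 //.
by rewrite ler_ln ?posrE //; apply: lt_le_trans xy.
Qed.

Lemma log2_le_sub1 x : 0 < x -> log2 x <= (x - 1) / ln 2.
Proof.
move=> x0; rewrite /log2 ler_pM2r ?invr_gt0 ?ln2_gt0 //.
by rewrite -{1}[x](subrK 1) addrC le_ln1Dx // ltrBrDl subrr.
Qed.

Lemma pow2_gt0 x : 0 < pow2 x.
Proof. exact: expR_gt0. Qed.

Lemma pow2D x y : pow2 (x + y) = pow2 x * pow2 y.
Proof. by rewrite /pow2 mulrDl expRD. Qed.

Lemma pow2N x : pow2 (- x) = (pow2 x)^-1.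
Proof. by rewrite /pow2 mulNr expRN. Qed.

Lemma pow2_0 : pow2 0 = 1 :> R.
Proof. by rewrite /pow2 mul0r expR0. Qed.

Lemma pow2_1 : pow2 1 = 2 :> R.
Proof. by rewrite /pow2 mul1r lnK // posrE. Qed.

Lemma ler_pow2 x y : (pow2 x <= pow2 y) = (x <= y).
Proof. by rewrite /pow2 ler_expR ler_pM2r ?ln2_gt0. Qed.

Lemma log2K x : 0 < x -> pow2 (log2 x) = x.
Proof.
move=> x0; rewrite /pow2 /log2 -mulrA mulVf ?gt_eqF ?ln2_gt0 //.
by rewrite mulr1 lnK // posrE.
Qed.

Lemma pow2K x : log2 (pow2 x) = x.
Proof. by rewrite /pow2 /log2 expRK mulfK // gt_eqF ?ln2_gt0. Qed.

Lemma log2_prod (I : finType) (F : I -> R) : (forall i, 0 < F i) ->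
  log2 (\prod_i F i) = \sum_i log2 (F i).
Proof.
move=> F0.
suff [] : 0 < \prod_i F i /\ log2 (\prod_i F i) = \sum_i log2 (F i) by [].
elim/big_rec2 : _ => [|i s q _ [q0 <-]]; first by rewrite log2_1.
by rewrite mulr_gt0 // log2M.
Qed.

Section Laws.
Variables (Om : finType) (P : Om -> R).
Hypothesis P0 : forall w, 0 <= P w.

Lemma rv_law_ge0 (T : finType) (f : Om -> T) t : 0 <= rv_law P f t.
Proof. exact: sumr_ge0. Qed.

Lemma rv_law_expect (T : finType) (f : Om -> T) (F : T -> R) :
  \sum_w P w * F (f w) = \sum_t rv_law P f t * F t.
Proof.
rewrite (partition_big f predT) //=; apply: eq_bigr => t _.
by rewrite mulr_suml; apply: eq_bigr => w /eqP ->.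
Qed.

Lemma rv_law_sum (T : finType) (f : Om -> T) : \sum_t rv_law P f t = \sum_w P w.
Proof.
rewrite (eq_bigr (fun w => P w * (fun=> 1) (f w))) => [|w _]; last by rewrite mulr1.
by rewrite (rv_law_expect f (fun=> 1)); apply: eq_bigr => t _; rewrite mulr1.
Qed.

Lemma rv_law_ge (T : finType) (f : Om -> T) w : P w <= rv_law P f (f w).
Proof. by rewrite /rv_law (bigD1 w) //= lerDl sumr_ge0. Qed.

Lemma rv_law_gt0 (T : finType) (f : Om -> T) w : 0 < P w -> 0 < rv_law P f (f w).
Proof. by move=> h; apply: lt_le_trans h (rv_law_ge f w). Qed.

Lemma rv_law_suml (A B : finType) (f : Om -> A) (g : Om -> B) b :
  \sum_a rv_law P (fun w => (f w, g w)) (a, b) = rv_law P g b.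
Proof.
rewrite /rv_law [RHS](partition_big f predT) //=; apply: eq_bigr => a _.
by apply: eq_bigl => w; rewrite xpair_eqE andbC.
Qed.

Lemma rv_law_sumr (A B : finType) (f : Om -> A) (g : Om -> B) a :
  \sum_b rv_law P (fun w => (f w, g w)) (a, b) = rv_law P f a.
Proof.
rewrite /rv_law [RHS](partition_big g predT) //=.
Qed.

Lemma shannon_H_expect (T : finType) (f : Om -> T) :
  shannon_H P f = - \sum_w P w * log2 (rv_law P f (f w)).
Proof. by rewrite /shannon_H (rv_law_expect f (fun t => log2 (rv_law P f t))). Qed.

Lemma rv_law_le (A B : finType) (f : Om -> A) (g : Om -> B) w :
  (forall w', g w' = g w -> f w' = f w) -> rv_law P g (g w) <= rv_law P f (f w).
Proof.
move=> h; rewrite /rv_law big_mkcond [leRHS]big_mkcond /=; apply: ler_sum => w' _.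
case: eqP => [/h ->|_]; first by rewrite eqxx.
by case: ifP.
Qed.

(** The hypothesis says that [f] is a function of [g] without naming the function; applied in both
    directions it makes entropy blind to relabelling and to redundant components. *)
Lemma shannon_H_le (A B : finType) (f : Om -> A) (g : Om -> B) :
  (forall w w', g w' = g w -> f w' = f w) -> shannon_H P f <= shannon_H P g.
Proof.
move=> h; rewrite !shannon_H_expect lerN2; apply: ler_sum => w _.
have := P0 w; rewrite le_eqVlt => /orP[/eqP <-|Pw]; first by rewrite !mul0r.
rewrite ler_pM2l // le_log2 ?rv_law_gt0 //.
by apply: rv_law_le => w'; apply: h.
Qed.

Lemma shannon_H_eq (A B : finType) (f : Om -> A) (g : Om -> B) :
  (forall w w', g w' = g w -> f w' = f w) ->
  (forall w w', f w' = f w -> g w' = g w) -> shannon_H P f = shannon_H P g.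
Proof. by move=> fg gf; apply/eqP; rewrite eq_le !shannon_H_le. Qed.

(** Gibbs' inequality: [cmi] is the mean of [- log2 F], where [F] is the ratio of the conditionally
    independent law to the true one; [log2 F] is at most [(F - 1) / ln 2], and the mean of [F] is at
    most the total mass. *)
Lemma cmi_ge0 (A B C : finType) (f : Om -> A) (g : Om -> B) (h : Om -> C) :
  0 <= cmi P f g h.
Proof.
pose Lac := rv_law P (fun w => (f w, h w)).
pose Lbc := rv_law P (fun w => (g w, h w)).
pose Labc := rv_law P (fun w => (f w, g w, h w)).
pose Lc := rv_law P h.
pose F (abc : A * B * C) := Lac (abc.1.1, abc.2) * Lbc (abc.1.2, abc.2) /
                            (Labc abc * Lc abc.2).
have -> : cmi P f g h = - \sum_w P w * log2 (F (f w, g w, h w)).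
  rewrite /cmi !shannon_H_expect.
  have E (a b c d : R) : - a + - b - - c - - d = - (a + b - c - d) by ring.
  rewrite E -big_split /= -!sumrB; congr (- _); apply: eq_bigr => w _.
  have := P0 w; rewrite le_eqVlt => /orP[/eqP <-|Pw].
    by rewrite !mul0r !(subr0, addr0).
  rewrite /F /= log2_div ?mulr_gt0 ?log2M //; last first; try exact: rv_law_gt0.
  rewrite -/Lac -/Lbc -/Labc -/Lc; ring.
suff : \sum_w P w * log2 (F (f w, g w, h w)) <= 0 by rewrite oppr_ge0.
apply: (@le_trans _ _ (\sum_w P w * ((F (f w, g w, h w) - 1) / ln 2))).
  apply: ler_sum => w _; have := P0 w; rewrite le_eqVlt => /orP[/eqP <-|Pw].
    by rewrite !mul0r.
  rewrite ler_pM2l //; apply: log2_le_sub1; rewrite /F /=.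
  by rewrite divr_gt0 // mulr_gt0 //; exact: rv_law_gt0.
under eq_bigr do rewrite mulrA.
rewrite -mulr_suml pmulr_lle0 ?invr_gt0 ?ln2_gt0 //.
under eq_bigr do rewrite mulrBr mulr1.
rewrite sumrB subr_le0 (rv_law_expect (fun w => (f w, g w, h w)) F).
(* The true law cancels only where it is positive; the remaining terms of the larger sum are
   nonnegative. *)
apply: (@le_trans _ _ (\sum_c \sum_a \sum_b Lac (a, c) * Lbc (b, c) / Lc c)).
  rewrite -(pair_bigA _ (fun ab c => rv_law P _ (ab, c) * F (ab, c))) /= exchange_big /=.
  apply: ler_sum => c _; rewrite pair_bigA /=; apply: ler_sum => -[a b] _ /=.
  rewrite -/Labc /F /=.
  have [->|nz] := eqVneq (Labc (a, b, c)) 0.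
    by rewrite mul0r divr_ge0 ?mulr_ge0 //; exact: rv_law_ge0.
  by rewrite invfM mulrCA mulVKf.
rewrite -(rv_law_sum h); apply: ler_sum => c _.
under eq_bigr do rewrite -mulr_suml -mulr_sumr rv_law_suml -mulrA.
rewrite -mulr_suml rv_law_suml -/Lc.
have [->|nz] := eqVneq (Lc c) 0; first by rewrite mul0r.
by rewrite mulfV // mulr1.
Qed.

(** The chain rule, with the conditional entropy expressed through the kernel. It sees [f] only
    through what enters [K], so enlarging [f] by other variables leaves the increment unchanged;
    Markov chains are exploited in this form. *)
Lemma shannon_H_channel (A B : finType) (f : Om -> A) (k : Om -> B) (K : A -> B -> R) :
  (forall a b, 0 <= K a b) ->
  (forall a b, rv_law P (fun w => (f w, k w)) (a, b) = rv_law P f a * K a b) ->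
  shannon_H P (fun w => (f w, k w)) =
  shannon_H P f - \sum_w P w * \sum_b K (f w) b * log2 (K (f w) b).
Proof.
move=> K0 hK; rewrite (rv_law_expect f (fun a => \sum_b K a b * log2 (K a b))).
rewrite /shannon_H -opprD -big_split /=; congr (- _).
rewrite -(pair_bigA _ (fun a b => rv_law P (fun w => (f w, k w)) (a, b) *
   log2 (rv_law P (fun w => (f w, k w)) (a, b)))) /=.
apply: eq_bigr => a _; under eq_bigr do rewrite hK.
transitivity (\sum_b (rv_law P f a * K a b * log2 (rv_law P f a) +
                      rv_law P f a * (K a b * log2 (K a b)))).
  apply: eq_bigr => b _.
  have [->|La] := eqVneq (rv_law P f a) 0; first by rewrite !mul0r addr0.
  have [->|Kb] := eqVneq (K a b) 0; first by rewrite !(mulr0, mul0r) addr0.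
  rewrite log2M ?lt0r ?La ?Kb ?K0 ?rv_law_ge0 //; ring.
rewrite big_split /= -mulr_sumr -mulr_suml; congr (_ * _ + _).
by rewrite -[RHS](rv_law_sumr f k); apply: eq_bigr => b _; rewrite hK.
Qed.

Hypothesis P1 : \sum_w P w = 1.

Lemma shannon_H_cst (A : finType) (a : A) : shannon_H P (fun=> a) = 0.
Proof.
rewrite shannon_H_expect; apply/eqP; rewrite oppr_eq0; apply/eqP.
apply: big1 => w _; rewrite /rv_law eqxx /=.
by rewrite P1 log2_1 mulr0.
Qed.

Lemma shannon_H_subadd (A B : finType) (f : Om -> A) (g : Om -> B) :
  shannon_H P (fun w => (f w, g w)) <= shannon_H P f + shannon_H P g.
Proof.
have := cmi_ge0 f g (fun=> tt); rewrite /cmi shannon_H_cst subr0 subr_ge0.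
rewrite (@shannon_H_eq _ _ (fun w => (f w, g w, tt)) (fun w => (f w, g w))); first last.
- by move=> w w' [-> ->].
- by move=> w w' [-> ->].
move=> h; apply: (le_trans h); apply: lerD; apply: shannon_H_le => w w' e; congr pair; exact: e.
Qed.

(** Gibbs' inequality again, now against the uniform law. *)
Lemma shannon_H_le_card (A : finType) (f : Om -> A) :
  (0 < #|A|)%N -> shannon_H P f <= log2 #|A|%:R.
Proof.
move=> A0; have N0 : 0 < #|A|%:R :> R by rewrite ltr0n.
have -> : log2 #|A|%:R = \sum_a rv_law P f a * log2 #|A|%:R :> R.
  by rewrite -mulr_suml rv_law_sum P1 mul1r.
rewrite -subr_ge0 /shannon_H opprK -big_split /=.
apply: (@le_trans _ _ (\sum_a (rv_law P f a - #|A|%:R^-1) / ln 2)).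
  rewrite -mulr_suml sumrB rv_law_sum P1 sumr_const -[_ *+ _]mulr_natr mulVf ?gt_eqF //.
  by rewrite subrr mul0r.
apply: ler_sum => a _; rewrite -mulrDr.
have := rv_law_ge0 f a; rewrite le_eqVlt => /orP[/eqP <-|La].
  by rewrite sub0r mul0r mulNr oppr_le0 divr_ge0 ?invr_ge0 ?ler0n ?ltW ?ln2_gt0.
have /log2_le_sub1 : 0 < (rv_law P f a * #|A|%:R)^-1 by rewrite invr_gt0 mulr_gt0.
have -> : log2 (rv_law P f a * #|A|%:R)^-1 = - (log2 #|A|%:R + log2 (rv_law P f a)).
  by rewrite -div1r log2_div ?mulr_gt0 // log2_1 log2M // sub0r addrC.
move/(ler_wpM2l (ltW La)).
rewrite mulrN mulrA mulrBr mulr1 invfM mulrA mulfV ?gt_eqF // mul1r.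
by move=> h; rewrite -lerN2 -[leRHS]mulNr opprB.
Qed.

End Laws.

Lemma shannon_H_iid (I O T : finType) (p : O -> R) (f : O -> T) : is_pmf p ->
  shannon_H (@iid R I O p) (fun o => [ffun i => f (o i)] : {ffun I -> T}) =
  #|I|%:R * shannon_H p f.
Proof.
move=> pP; have [p0 p1] := pP.
have law (t : {ffun I -> T}) :
    rv_law (@iid R I O p) (fun o => [ffun i => f (o i)]) t = \prod_i rv_law p f (t i).
  rewrite /rv_law; under eq_bigr do rewrite big_mkcond /=.
  rewrite -(prod_sum_ffun (fun i s => if f s == t i then p s else 0)) [LHS]big_mkcond /=.
  apply: eq_bigr => o _; rewrite /iid; case: eqP => [<-|ne].
    by apply: eq_bigr => i _; rewrite ffunE eqxx.
  apply/esym/eqP/prodf_eq0.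
  have /existsP [i hi] : [exists i, f (o i) != t i].
    apply: contra_notT ne; rewrite negb_exists => /forallP h.
    by apply/ffunP => i; rewrite ffunE; apply/eqP; move: (h i); rewrite negbK.
  by exists i => //; rewrite (negPf hi).
rewrite !shannon_H_expect mulrN; congr (- _).
transitivity (\sum_(i : I) \sum_(o : {ffun I -> O}) iid p o * log2 (rv_law p f (f (o i)))).
  rewrite exchange_big /=; apply: eq_bigr => o _.
  rewrite -mulr_sumr law.
  have [->|nz] := eqVneq (iid p o) 0; first by rewrite !mul0r.
  congr (_ * _); rewrite log2_prod; first by apply: eq_bigr => i _; rewrite ffunE.
  move=> i; rewrite ffunE; apply: rv_law_gt0 => //.
  rewrite lt0r p0 andbT; apply: contraNneq nz => pi0.
  by apply/prodf_eq0; exists i => //; rewrite pi0.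
under eq_bigr do rewrite (iid_marg1 pP _ (fun s => log2 (rv_law p f (f s)))).
by rewrite sumr_const mulr_natl.
Qed.

End Entropy.

(** * Soft covering *)

Section Averages.
Variable R : realType.

Definition avg (J : finType) (F : J -> R) : R := #|J|%:R^-1 * \sum_j F j.

Lemma eq_avg (J : finType) (F G : J -> R) : F =1 G -> avg F = avg G.
Proof. by move=> h; rewrite /avg (eq_bigr G). Qed.

Lemma avgE (J : finType) (F : J -> R) : avg F = \sum_j #|J|%:R^-1 * F j.
Proof. by rewrite /avg mulr_sumr. Qed.

Lemma ler_avg (J : finType) (F G : J -> R) : (forall j, F j <= G j) -> avg F <= avg G.
Proof. by move=> h; rewrite ler_wpM2l ?invr_ge0 // ler_sum. Qed.

Lemma avg_le (J : finType) (F : J -> R) B : (0 < #|J|)%N ->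
  (forall j, F j <= B) -> avg F <= B.
Proof.
move=> J0 h; apply: (@le_trans _ _ (avg (fun _ : J => B))); first exact: ler_avg.
by rewrite /avg sumr_const -[B *+ _]mulr_natl mulKf // pnatr_eq0 -lt0n.
Qed.

Lemma avgD (J : finType) (F G : J -> R) : avg (fun j => F j + G j) = avg F + avg G.
Proof. by rewrite /avg big_split mulrDr. Qed.

Lemma avgZ (J : finType) (F : J -> R) k : avg (fun j => k * F j) = k * avg F.
Proof. by rewrite /avg -mulr_sumr mulrCA. Qed.

Lemma rv_expect_avg (Om J : finType) (P : Om -> R) (F : J -> Om -> R) :
  rv_expect P (fun w => avg (F ^~ w)) = avg (fun j => rv_expect P (F j)).
Proof.
rewrite /rv_expect /avg exchange_big /= mulr_sumr; apply: eq_bigr => w _.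
by rewrite mulrCA mulr_sumr.
Qed.

Lemma rv_expectD (Om : finType) (P f g : Om -> R) :
  rv_expect P (fun w => f w + g w) = rv_expect P f + rv_expect P g.
Proof. by rewrite /rv_expect -big_split; apply: eq_bigr => w _; rewrite mulrDr. Qed.

Lemma rv_expectZ (Om : finType) (P f : Om -> R) k :
  rv_expect P (fun w => k * f w) = k * rv_expect P f.
Proof. by rewrite /rv_expect mulr_sumr; apply: eq_bigr => w _; rewrite mulrCA. Qed.

Lemma ler_rv_expect (Om : finType) (P f g : Om -> R) : (forall w, 0 <= P w) ->
  (forall w, f w <= g w) -> rv_expect P f <= rv_expect P g.
Proof. by move=> P0 h; apply: ler_sum => w _; rewrite ler_wpM2l. Qed.

Lemma rv_expect_sum (Om J : finType) (P : Om -> R) (Q : pred J) (F : J -> Om -> R) :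
  rv_expect P (fun w => \sum_(j | Q j) F j w) = \sum_(j | Q j) rv_expect P (F j).
Proof.
by rewrite /rv_expect exchange_big /=; apply: eq_bigr => w _; rewrite mulr_sumr.
Qed.

(* This replaces the likelihood encoder, which would draw [j] with probability proportional
   to [w j]. *)
Lemma weighted_min (J : finType) (w c : J -> R) (q dm : R) jm :
  (forall j, 0 <= w j) -> (forall j, 0 <= c j <= dm) -> (forall j, c jm <= c j) ->
  q * c jm <= \sum_j w j * c j + dm * `|q - \sum_j w j|.
Proof.
move=> w0 cb cm; rewrite -{1}[q](subrK (\sum_j w j)) mulrDl addrC.
apply: lerD; first by rewrite mulr_suml; apply: ler_sum => j _; rewrite ler_wpM2l.
have /andP[c0 cd] := cb jm.
rewrite mulrC; apply: (le_trans (ler_norm _)); rewrite normrM ger0_norm //.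
by rewrite ler_wpM2r.
Qed.

(** A choice among the passing indices can be wrong only if the true index fails its test or another
    one passes; the default [j0] is covered by the first case. *)
Lemma pick_decoder (J : finType) (j0 j : J) (pass : pred J) :
  (odflt j0 [pick j' | pass j'] != j)%:R <=
  (~~ pass j)%:R + \sum_(j' | j' != j) (pass j')%:R :> R.
Proof.
case: pickP => [j' pj'|np] /=; last first.
  rewrite (np j) /=; apply: (@le_trans _ _ 1); first by case: (_ != _); rewrite ?ler01.
  by rewrite lerDl sumr_ge0.
case: eqVneq => [_|ne] /=; first by rewrite addr_ge0 // sumr_ge0.
by rewrite (bigD1 j') //= pj' addrCA lerDl addr_ge0 // sumr_ge0.
Qed.

(** The channel is truncated at [tau] times the output law. By independence of the codewords, the
    empirical average of the bounded part has small variance; the truncated mass is paid for in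
    L1. *)
Lemma soft_covering (J V Y : finType) (p : V -> R) (W : V -> Y -> R) (q : Y -> R) (tau : R) :
  is_pmf p -> (forall v y, 0 <= W v y) -> (forall y, q y = \sum_v p v * W v y) ->
  \sum_y q y = 1 -> 0 <= tau -> (0 < #|J|)%N ->
  rv_expect (@iid R J V p) (fun cb => \sum_y `|q y - avg (fun j => W (cb j) y)|) <=
  2 * (\sum_v \sum_y p v * W v y * (tau * q y < W v y)%R%:R) +
  Num.sqrt (tau / #|J|%:R).
Proof.
move=> pP W0 qE q1 t0 J0; have [p0 p1] := pP.
have iP := iid_pmf J pP; have [i0 i1] := iP.
pose W1 v y := W v y * (W v y <= tau * q y)%R%:R.
pose W2 v y := W v y * (tau * q y < W v y)%R%:R.
have WE v y : W v y = W1 v y + W2 v y.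
  by rewrite /W1 /W2 -mulrDr ltNge; case: (_ <= _); rewrite ?(addr0, add0r) mulr1.
have W10 v y : 0 <= W1 v y by rewrite mulr_ge0.
have W20 v y : 0 <= W2 v y by rewrite mulr_ge0.
pose m1 y := \sum_v p v * W1 v y; pose m2 y := \sum_v p v * W2 v y.
have qm y : q y = m1 y + m2 y.
  by rewrite qE -big_split; apply: eq_bigr => v _ /=; rewrite WE mulrDr.
have m10 y : 0 <= m1 y by apply: sumr_ge0 => v _; rewrite mulr_ge0.
have m20 y : 0 <= m2 y by apply: sumr_ge0 => v _; rewrite mulr_ge0.
have q0 y : 0 <= q y by rewrite qm addr_ge0.
have N0 : 0 < #|J|%:R :> R by rewrite ltr0n.
suff H y : rv_expect (@iid R J V p) (fun cb => `|q y - avg (fun j => W (cb j) y)|) <=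
    2 * m2 y + q y * Num.sqrt (tau / #|J|%:R).
  rewrite rv_expect_sum; apply: (le_trans (ler_sum _ (fun y _ => H y))).
  rewrite big_split /= -mulr_suml q1 mul1r lerD2r -mulr_sumr ler_wpM2l //.
  rewrite /m2 exchange_big; apply: ler_sum => v _; apply: ler_sum => y' _.
  by rewrite /W2 mulrA.
apply: (@le_trans _ _ (rv_expect (@iid R J V p) (fun cb =>
   `|m1 y - avg (fun j => W1 (cb j) y)| + (m2 y + avg (fun j => W2 (cb j) y))))).
  apply: ler_rv_expect => // cb.
  have -> : q y - avg (fun j => W (cb j) y) =
     (m1 y - avg (fun j => W1 (cb j) y)) + (m2 y - avg (fun j => W2 (cb j) y)).
    under eq_avg do rewrite WE.
    by rewrite avgD qm; ring.
  apply: (le_trans (ler_normD _ _)); rewrite lerD2l.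
  apply: (le_trans (ler_normB _ _)); rewrite !ger0_norm //.
  by rewrite mulr_ge0 ?invr_ge0 // sumr_ge0.
rewrite rv_expectD addrC rv_expectD rv_expect_avg.
apply: lerD.
  (* The truncated mass enters twice, as its mean and as the expected empirical average, which
     coincide; hence the factor 2. *)
  rewrite mulr_natl mulr2n; apply: lerD.
    by rewrite /rv_expect -mulr_suml i1 mul1r.
  apply: avg_le => // j.
  by rewrite /rv_expect (iid_marg1 pP j (fun v => W2 v y)).
rewrite -[X in _ * X](@ger0_norm _ (Num.sqrt _)) ?sqrtr_ge0 // -[q y]ger0_norm //.
rewrite -(sqrtr_sqr (q y)) ger0_norm ?sqrtr_ge0 // -sqrtrM ?sqr_ge0 //.
apply: mean_abs_le_sqrt => //.
pose g v := m1 y - W1 v y.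
have g0 : \sum_v p v * g v = 0.
  under eq_bigr do rewrite mulrBr.
  by rewrite sumrB -mulr_suml p1 mul1r subrr.
have -> : \sum_cb iid p cb * (m1 y - avg (fun j : J => W1 (cb j) y)) ^+ 2 =
    #|J|%:R^-1 * \sum_v p v * g v ^+ 2.
  transitivity (#|J|%:R ^- 2 * \sum_(cb : {ffun J -> V}) iid p cb * (\sum_j g (cb j)) ^+ 2).
    rewrite mulr_sumr; apply: eq_bigr => cb _.
    rewrite [RHS]mulrCA; congr (_ * _); rewrite -exprVn -exprMn; congr (_ ^+ 2).
    rewrite sumrB sumr_const mulrBr -[m1 y *+ _]mulr_natl mulKf // gt_eqF //.
  rewrite (iid_var0 _ pP g0) mulrA; congr (_ * _).
  by rewrite expr2 invfM -mulrA mulVf ?mulr1 // gt_eqF.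
have -> : \sum_v p v * g v ^+ 2 = \sum_v p v * W1 v y ^+ 2 - m1 y ^+ 2.
  rewrite [X in _ - X]expr2 {1}/m1 mulr_suml.
  have -> : \sum_v p v * g v ^+ 2 = \sum_v (p v * g v ^+ 2 + 2 * m1 y * (p v * g v)).
    by rewrite big_split /= -mulr_sumr g0 mulr0 addr0.
  transitivity (\sum_v (p v * m1 y ^+ 2 *+ 3 - p v * W1 v y * m1 y *+ 4 + p v * W1 v y ^+ 2)).
    by apply: eq_bigr => v _; rewrite /g; ring.
  rewrite big_split /= sumrB !sumrMnl -!mulr_suml p1 -/(m1 y); ring.
rewrite mulrC mulrA ler_pM2r ?invr_gt0 //.
apply: (@le_trans _ _ (\sum_v p v * W1 v y ^+ 2)).
  by rewrite gerBl sqr_ge0.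
(* One factor [W1] is at most [tau * q y] by truncation; the other integrates to [m1 y], which is at
   most [q y]. *)
apply: (@le_trans _ _ (\sum_v tau * q y * (p v * W1 v y))).
  apply: ler_sum => v _.
  have -> : p v * W1 v y ^+ 2 = W1 v y * (p v * W1 v y) by ring.
  rewrite ler_wpM2r ?mulr_ge0 //.
  rewrite /W1; case: (leP (W v y) (tau * q y)) => h /=; rewrite ?mulr1 ?mulr0n ?mulr0 ?mulr_ge0 //.
rewrite -mulr_sumr -/(m1 y).
have -> : q y ^+ 2 * tau = tau * q y * q y by ring.
by rewrite ler_wpM2l ?mulr_ge0 // [leRHS]qm lerDl.
Qed.

End Averages.

(** * One-shot coding *)

(* A joint law of (V, U, X, Y, Z), disintegrated along V -> Y -> X, V -> U -> X and X -> Z. *)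
Record test_channel (R : realType) (X Y Z U V : finType) := TestChannel {
  tcXY : X -> Y -> R; tcZ : X -> Z -> R;
  tcV : V -> R; tcVY : V -> Y -> R; tcYX : Y -> X -> R;
  tcVU : V -> U -> R; tcVUX : V -> U -> X -> R;
  tcY_marg : Y -> R; tcX_marg : X -> R; tcZ_marg : Z -> R;
  tcVX : V -> X -> R; tcVZ : V -> Z -> R; tcVUZ : V -> U -> Z -> R;
  tcXYE : forall x y, tcXY x y = tcY_marg y * tcYX y x;
  tcYE : forall y, tcY_marg y = \sum_v tcV v * tcVY v y;
  tcV_pmf : is_pmf tcV; tcVY_stoch : is_stoch tcVY; tcYX_stoch : is_stoch tcYX;
  tcVU_stoch : is_stoch tcVU; tcVUX_stoch : forall v, is_stoch (tcVUX v);
  tcZ_stoch : is_stoch tcZ;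
  tcVXE : forall v x, tcVX v x = \sum_y tcVY v y * tcYX y x;
  tcVXE' : forall v x, tcVX v x = \sum_u tcVU v u * tcVUX v u x;
  tcVZE : forall v z, tcVZ v z = \sum_x tcVX v x * tcZ x z;
  tcVUZE : forall v u z, tcVUZ v u z = \sum_x tcVUX v u x * tcZ x z;
  tcXE : forall x, tcX_marg x = \sum_v tcV v * tcVX v x;
  tcZE : forall z, tcZ_marg z = \sum_v tcV v * tcVZ v z }.

Section OneShot.
Variables (R : realType) (X Y Z U V Xh : finType).
Variable tc : test_channel R X Y Z U V.

Let pXY := tcXY tc. Let pZ := tcZ tc. Let pV := tcV tc. Let pVY := tcVY tc.
Let pYX := tcYX tc. Let pVU := tcVU tc. Let pVUX := tcVUX tc.
Let pY := tcY_marg tc. Let pX := tcX_marg tc. Let pZm := tcZ_marg tc.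
Let pVX := tcVX tc. Let pVZ := tcVZ tc. Let pVUZ := tcVUZ tc.

Let pV_pmf : is_pmf pV := tcV_pmf tc.
Let pV0 v : 0 <= pV v := (tcV_pmf tc).1 v.
Let pVY0 v y : 0 <= pVY v y := (tcVY_stoch tc v).1 y.
Let pYX0 y x : 0 <= pYX y x := (tcYX_stoch tc y).1 x.
Let pVU0 v u : 0 <= pVU v u := (tcVU_stoch tc v).1 u.
Let pVUX0 v u x : 0 <= pVUX v u x := (tcVUX_stoch tc v u).1 x.
Let pZ0 x z : 0 <= pZ x z := (tcZ_stoch tc x).1 z.

Let pVX0 v x : 0 <= pVX v x.
Proof. by rewrite /pVX tcVXE sumr_ge0 // => y _; exact: mulr_ge0. Qed.
Let pVUZ0 v u z : 0 <= pVUZ v u z.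
Proof. by rewrite /pVUZ tcVUZE sumr_ge0 // => y _; exact: mulr_ge0. Qed.
Let pVX1 v : \sum_x pVX v x = 1.
Proof.
rewrite /pVX; under eq_bigr do rewrite tcVXE.
rewrite exchange_big /=; under eq_bigr do rewrite -mulr_sumr (tcYX_stoch tc _).2 mulr1.
exact: (tcVY_stoch tc v).2.
Qed.
Let pY1 : \sum_y pY y = 1.
Proof.
rewrite /pY; under eq_bigr do rewrite tcYE.
rewrite exchange_big /=; under eq_bigr do rewrite -mulr_sumr (tcVY_stoch tc _).2 mulr1.
exact: pV_pmf.2.
Qed.

Variables (A B C M K : finType) (a0 : A) (b0 : B) (c0 : C) (l0 : M) (k0 : K).
Notation I1 := (A * B * C)%type.
Notation I2 := (M * K)%type.
Notation CW := (V * {ffun I2 -> U})%type.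

Let I1_gt0 : (0 < #|{: I1}|)%N. Proof. by apply/card_gt0P; exists (a0, b0, c0). Qed.
Let I2_gt0 : (0 < #|{: I2}|)%N. Proof. by apply/card_gt0P; exists (l0, k0). Qed.

(** Superposition coding: a cloud centre together with all its satellites, independent given the
    centre. A codebook is an i.i.d. family of such clusters. *)
Definition codeword_law (w : CW) : R := pV w.1 * iid (pVU w.1) w.2.

Lemma codeword_sum (F : V -> {ffun I2 -> U} -> R) :
  \sum_w codeword_law w * F w.1 w.2 = \sum_v pV v * \sum_uu iid (pVU v) uu * F v uu.
Proof.
rewrite -(pair_bigA _ (fun v uu => codeword_law (v, uu) * F v uu)) /=.
apply: eq_bigr => v _; rewrite mulr_sumr; apply: eq_bigr => uu _.
by rewrite /codeword_law /= mulrA.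
Qed.

Lemma codeword_margV (F : V -> R) :
  \sum_w codeword_law w * F w.1 = \sum_v pV v * F v.
Proof.
rewrite (codeword_sum (fun v _ => F v)); apply: eq_bigr => v _.
by rewrite -mulr_suml (iid_sum1 _ (tcVU_stoch tc v)) mul1r.
Qed.

Lemma codeword_margVU lk (F : V -> U -> R) :
  \sum_w codeword_law w * F w.1 (w.2 lk) = \sum_v pV v * \sum_u pVU v u * F v u.
Proof.
rewrite (codeword_sum (fun v uu => F v (uu lk))); apply: eq_bigr => v _.
by rewrite (iid_marg1 (tcVU_stoch tc v) lk (F v)).
Qed.

Lemma codeword_margVUU lk lk' (F : V -> U -> U -> R) : lk != lk' ->
  \sum_w codeword_law w * F w.1 (w.2 lk) (w.2 lk') =
  \sum_v pV v * \sum_u pVU v u * \sum_u' pVU v u' * F v u u'.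
Proof.
move=> ne; rewrite (codeword_sum (fun v uu => F v (uu lk) (uu lk'))).
by apply: eq_bigr => v _; rewrite (iid_marg2 (tcVU_stoch tc v) (F v) ne).
Qed.

Lemma codeword_pmf : is_pmf codeword_law.
Proof.
split=> [w|]; first by rewrite mulr_ge0 // iid_ge0.
under eq_bigr do rewrite -[codeword_law _]mulr1.
rewrite (codeword_margV (fun=> 1)).
by under eq_bigr do rewrite mulr1; exact: pV_pmf.2.
Qed.

Variables (c : X -> Xh -> R) (dm : R) (xh : U -> V -> Z -> Xh).
Hypothesis cb01 : forall x x', 0 <= c x x' <= dm.

Variables (pass1 : V -> X -> bool) (pass2 : V -> Z -> bool) (pass3 : V -> U -> Z -> bool).

Section FixedCodebook.
Variable cb : {ffun I1 -> CW}.

Let v m := (cb m).1.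
Let u m lk := (cb m).2 lk.

Definition enc_index (a : A) (x : X) : I1 :=
  let bc := odflt (b0, c0) [pick bc : B * C | pass1 (v (a, bc.1, bc.2)) x] in
  (a, bc.1, bc.2).
Definition dec_index (ab : A * B) (z : Z) : I1 :=
  (ab, odflt c0 [pick c : C | pass2 (v (ab, c)) z]).
Definition dec_sub (m : I1) (l : M) (z : Z) : K :=
  odflt k0 [pick k | pass3 (v m) (u m (l, k)) z].
Definition oneshot_dec (l : M) (ab : A * B) (z : Z) : Xh :=
  let m := dec_index ab z in xh (u m (l, dec_sub m l z)) (v m) z.
(** The encoder does not see z, but given x it has law [pZ x] independently of y, so this average is
    the exact expected cost of sending [l]. Only the part [m.1] of the index reaches the decoder. *)
Definition enc_cost (m : I1) (x : X) (l : M) : R :=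
  \sum_z pZ x z * c x (oneshot_dec l m.1 z).
Definition best_msg (m : I1) (x : X) : M := [arg min_(l < l0) enc_cost m x l]%O.
Definition oneshot_enc (x : X) (a : A) : M := best_msg (enc_index a x) x.
(** The helper foresees the encoder's reply, which is computed from x and [m.1.1] alone and may
    therefore rest on a misread index. *)
Definition helper_cost (y : Y) (m : I1) : R :=
  \sum_x pYX y x * enc_cost m x (oneshot_enc x m.1.1).
Definition oneshot_helper (y : Y) : I1 := [arg min_(m < (a0, b0, c0)) helper_cost y m]%O.

Definition oneshot_cost : R := \sum_x \sum_y \sum_z pXY x y * pZ x z *
  c x (oneshot_dec (oneshot_enc x (oneshot_helper y).1.1) (oneshot_helper y).1 z).

Definition ideal_cost (v : V) (u : U) : R :=
  \sum_x pVUX v u x * \sum_z pZ x z * c x (xh u v z).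

(** The penalties are, in order: covering of p(y), the encoder misreading (b,c), covering of p(x|v),
    the decoder misreading c, the decoder misreading k. All decoding errors are measured under the
    ideal law with uniform indices. *)
Definition oneshot_bound : R :=
  avg (fun m => avg (fun lk => ideal_cost (v m) (u m lk))) +
  dm * (\sum_y `|pY y - avg (fun m => pVY (v m) y)| +
        avg (fun m => \sum_x pVX (v m) x * (enc_index m.1.1 x != m)%:R) +
        avg (fun m => \sum_x `|pVX (v m) x - avg (fun lk => pVUX (v m) (u m lk) x)|) +
        avg (fun m => avg (fun lk => \sum_z pVUZ (v m) (u m lk) z *
                                       (dec_index m.1 z != m)%:R)) +
        avg (fun m => avg (fun lk => \sum_z pVUZ (v m) (u m lk) z *
                                       (dec_sub m lk.1 z != lk.2)%:R))).

Let dm0 : 0 <= dm.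
Proof.
have [x _] := pmf_support (tcVUX_stoch tc (v (a0, b0, c0)) (u (a0, b0, c0) (l0, k0))).
have [z _] := pmf_support (tcZ_stoch tc x).
by have /andP[] := cb01 x (oneshot_dec l0 (a0, b0) z); apply: le_trans.
Qed.

Let enc_cost01 m x l : 0 <= enc_cost m x l <= dm.
Proof.
apply/andP; split.
  by apply: sumr_ge0 => z _; rewrite mulr_ge0 //; case/andP: (cb01 x (oneshot_dec l m.1 z)).
rewrite -[leRHS]mul1r -(tcZ_stoch tc x).2 mulr_suml; apply: ler_sum => z _.
by rewrite ler_wpM2l //; case/andP: (cb01 x (oneshot_dec l m.1 z)).
Qed.

Let helper_cost01 y m : 0 <= helper_cost y m <= dm.
Proof.
apply/andP; split.
  apply: sumr_ge0 => x _; rewrite mulr_ge0 //.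
  by case/andP: (enc_cost01 m x (oneshot_enc x m.1.1)).
rewrite -[leRHS]mul1r -(tcYX_stoch tc y).2 mulr_suml; apply: ler_sum => x _.
by rewrite ler_wpM2l //; case/andP: (enc_cost01 m x (oneshot_enc x m.1.1)).
Qed.

Lemma best_msg_min m x l : enc_cost m x (best_msg m x) <= enc_cost m x l.
Proof. by rewrite /best_msg; case: arg_minP => // l' _; apply. Qed.

Lemma oneshot_helper_min y m : helper_cost y (oneshot_helper y) <= helper_cost y m.
Proof. by rewrite /oneshot_helper; case: arg_minP => // m' _; apply. Qed.

(** First change of measure: the helper's minimum under p(y) is compared with an index drawn
    uniformly and passed through V -> Y. The kernel Y -> X then turns p(y|v) into p(x|v). *)
Lemma oneshot_cost_helper : oneshot_cost <=
  avg (fun m => \sum_x pVX (v m) x * enc_cost m x (oneshot_enc x m.1.1)) +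
  dm * \sum_y `|pY y - avg (fun m => pVY (v m) y)|.
Proof.
have -> : oneshot_cost = \sum_y pY y * helper_cost y (oneshot_helper y).
  rewrite /oneshot_cost exchange_big /=; apply: eq_bigr => y _.
  rewrite /helper_cost mulr_sumr; apply: eq_bigr => x _.
  rewrite /enc_cost !mulr_sumr; apply: eq_bigr => z _.
  by rewrite /pXY tcXYE -/pY -/pYX !mulrA.
have H y : pY y * helper_cost y (oneshot_helper y) <=
    \sum_m #|{: I1}|%:R^-1 * pVY (v m) y * helper_cost y m +
    dm * `|pY y - avg (fun m => pVY (v m) y)|.
  rewrite avgE; apply: weighted_min => [m|m|m].
  - by rewrite mulr_ge0 ?invr_ge0.
  - exact: helper_cost01.
  - exact: oneshot_helper_min.
apply: (le_trans (ler_sum _ (fun y _ => H y))).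
rewrite big_split /= -mulr_sumr lerD2r exchange_big /= avgE.
apply: ler_sum => m _.
under eq_bigr do rewrite -mulrA; rewrite -mulr_sumr ler_wpM2l ?invr_ge0 //.
rewrite le_eqVlt; apply/orP; left; apply/eqP.
under [LHS]eq_bigr do rewrite /helper_cost mulr_sumr.
rewrite [LHS]exchange_big /=; apply: eq_bigr => x _.
by rewrite /pVX tcVXE mulr_suml; apply: eq_bigr => y _; rewrite mulrA.
Qed.

Lemma enc_index_cost m x : pVX (v m) x * enc_cost m x (oneshot_enc x m.1.1) <=
  pVX (v m) x * enc_cost m x (best_msg m x) +
  dm * (pVX (v m) x * (enc_index m.1.1 x != m)%:R).
Proof.
rewrite /oneshot_enc; case: eqP => [->|_] /=.
  by rewrite mulr0 mulr0 addr0.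
rewrite mulr1 [dm * _]mulrC -mulrDr ler_wpM2l //.
have /andP[_ h] := enc_cost01 m x (best_msg (enc_index m.1.1 x) x).
by have /andP[h' _] := enc_cost01 m x (best_msg m x); rewrite (le_trans h) // lerDr.
Qed.

(** Second change of measure, at a fixed index: p(x|v) is replaced by a uniformly drawn satellite
    sent through (U,V) -> X. *)
Lemma best_msg_cost m : \sum_x pVX (v m) x * enc_cost m x (best_msg m x) <=
  avg (fun lk => \sum_x pVUX (v m) (u m lk) x * enc_cost m x lk.1) +
  dm * \sum_x `|pVX (v m) x - avg (fun lk => pVUX (v m) (u m lk) x)|.
Proof.
have H x : pVX (v m) x * enc_cost m x (best_msg m x) <=
    \sum_lk #|{: I2}|%:R^-1 * pVUX (v m) (u m lk) x * enc_cost m x lk.1 +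
    dm * `|pVX (v m) x - avg (fun lk => pVUX (v m) (u m lk) x)|.
  rewrite avgE.
  (* The cost of a pair depends on its first component alone, so any second component, here [k0],
     completes the minimiser. *)
  apply: (@weighted_min _ _ _ (fun lk : I2 => enc_cost m x lk.1) _ _ (best_msg m x, k0))
    => [lk|lk|lk] /=.
  - by rewrite mulr_ge0 ?invr_ge0.
  - exact: enc_cost01.
  - exact: best_msg_min.
apply: (le_trans (ler_sum _ (fun x _ => H x))).
rewrite big_split /= -mulr_sumr lerD2r exchange_big /= avgE.
apply: ler_sum => lk _.
by under eq_bigr do rewrite -mulrA; rewrite -mulr_sumr.
Qed.

(** Once both of its searches succeed the decoder outputs the ideal reconstruction; any failure
    costs at most [dm]. *)
Lemma dec_cost m lk : \sum_x pVUX (v m) (u m lk) x * enc_cost m x lk.1 <=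
  ideal_cost (v m) (u m lk) +
  dm * (\sum_z pVUZ (v m) (u m lk) z * (dec_index m.1 z != m)%:R +
        \sum_z pVUZ (v m) (u m lk) z * (dec_sub m lk.1 z != lk.2)%:R).
Proof.
pose e z : R := (dec_index m.1 z != m)%:R + (dec_sub m lk.1 z != lk.2)%:R.
have -> : \sum_z pVUZ (v m) (u m lk) z * (dec_index m.1 z != m)%:R +
          \sum_z pVUZ (v m) (u m lk) z * (dec_sub m lk.1 z != lk.2)%:R =
          \sum_x pVUX (v m) (u m lk) x * \sum_z pZ x z * e z.
  rewrite -big_split /=; under [RHS]eq_bigr do rewrite mulr_sumr.
  rewrite exchange_big /=; apply: eq_bigr => z _.
  rewrite -mulrDr -/(e z) /pVUZ tcVUZE mulr_suml.
  by apply: eq_bigr => x _; rewrite mulrA.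
rewrite /ideal_cost mulr_sumr -big_split /=; apply: ler_sum => x _.
rewrite mulrCA -mulrDr ler_wpM2l // mulr_sumr -big_split /=; apply: ler_sum => z _.
rewrite mulrCA -mulrDr ler_wpM2l //.
rewrite /oneshot_dec /e.
have /andP[h1 _] := cb01 x (xh (u m lk) (v m) z).
have [->|_] := eqVneq (dec_index m.1 z) m; last first.
  set x' := xh _ _ _; have /andP[_ h2] := cb01 x x'.
  rewrite (le_trans h2) // ler_wpDl // -[leLHS]mulr1 ler_wpM2l // lerDl //.
have [->|_] := eqVneq (dec_sub m lk.1 z) lk.2; last first.
  set x' := xh _ _ _; have /andP[_ h2] := cb01 x x'.
  by rewrite (le_trans h2) // ler_wpDl // add0r mulr1.
by rewrite -surjective_pairing addr0 mulr0 addr0.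
Qed.

Lemma oneshot_cost_le : oneshot_cost <= oneshot_bound.
Proof.
apply: (le_trans oneshot_cost_helper).
have H m : \sum_x pVX (v m) x * enc_cost m x (oneshot_enc x m.1.1) <=
   dm * (\sum_x pVX (v m) x * (enc_index m.1.1 x != m)%:R) +
   (dm * (\sum_x `|pVX (v m) x - avg (fun lk => pVUX (v m) (u m lk) x)|) +
   (avg (fun lk => ideal_cost (v m) (u m lk)) +
    dm * (avg (fun lk => \sum_z pVUZ (v m) (u m lk) z * (dec_index m.1 z != m)%:R) +
     avg (fun lk => \sum_z pVUZ (v m) (u m lk) z * (dec_sub m lk.1 z != lk.2)%:R)))).
  apply: (le_trans (ler_sum _ (fun x _ => enc_index_cost m x))).
  rewrite big_split /= addrC -mulr_sumr lerD2l.
  apply: (le_trans (best_msg_cost m)); rewrite addrC lerD2l.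
  by rewrite -avgD -avgZ -avgD; apply: ler_avg => lk; exact: dec_cost.
apply: (le_trans (lerD (ler_avg H) (lexx _))).
rewrite /oneshot_bound avgD avgZ avgD avgZ avgD avgZ avgD.
by rewrite le_eqVlt; apply/orP; left; apply/eqP; ring.
Qed.

End FixedCodebook.

Let cw_pmf := iid_pmf I1 codeword_pmf.

(** Union bound for a random codebook: distinct indices carry independent codewords, so a wrong one
    meets the observation under the product of the marginals. The embedding [e] lets the search run
    over a slice of the index set, (b,c) for the encoder and c for the decoder. The count [#|D|.-1]
    matters: a search with a single candidate has no competitor, even when the rate left for it is
    negative. *)
Lemma index_error_expect (D T : finType) (d0 d : D) (e : D -> I1)
    (G : CW -> T -> R) (pass : V -> T -> bool) :
  injective e -> (forall w t, 0 <= G w t) ->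
  rv_expect (iid codeword_law) (fun cb : {ffun I1 -> CW} => \sum_t G (cb (e d)) t *
     (odflt d0 [pick d' | pass (cb (e d')).1 t] != d)%:R) <=
  \sum_w codeword_law w * (\sum_t G w t * (~~ pass w.1 t)%:R) +
  #|D|.-1%:R * \sum_t (\sum_w codeword_law w * G w t) * \sum_v pV v * (pass v t)%:R.
Proof.
move=> einj G0.
apply: (@le_trans _ _ (rv_expect (iid codeword_law) (fun cb : {ffun I1 -> CW} =>
    \sum_t G (cb (e d)) t * (~~ pass (cb (e d)).1 t)%:R +
    \sum_(d' | d' != d) \sum_t G (cb (e d)) t * (pass (cb (e d')).1 t)%:R))).
  apply: ler_rv_expect => [|cb]; first exact: cw_pmf.1.
  rewrite exchange_big -big_split /=; apply: ler_sum => t _.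
  rewrite -mulr_sumr -mulrDr ler_wpM2l //.
  exact: (@pick_decoder R _ d0 d (fun d' => pass (cb (e d')).1 t)).
rewrite rv_expectD [X in _ + X]rv_expect_sum; apply: lerD.
  by rewrite /rv_expect /= (iid_marg1 codeword_pmf (e d)
    (fun w => \sum_t G w t * (~~ pass w.1 t)%:R)).
rewrite (eq_bigr (fun=> \sum_t (\sum_w codeword_law w * G w t) *
                          \sum_v pV v * (pass v t)%:R)) => [|d' d'd].
  by rewrite sumr_const cardC1 mulr_natl.
rewrite /rv_expect /= (iid_marg2 codeword_pmf
  (fun w w' => \sum_t G w t * (pass w'.1 t)%:R)); last by rewrite inj_eq // eq_sym.
under [RHS]eq_bigr do rewrite mulr_suml.
rewrite [RHS]exchange_big /=; apply: eq_bigr => w _.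
under [RHS]eq_bigr do rewrite -mulrA.
rewrite -mulr_sumr; congr (_ * _).
under eq_bigr do rewrite mulr_sumr.
rewrite exchange_big /=; apply: eq_bigr => t _.
under eq_bigr do rewrite mulrCA.
by rewrite -mulr_sumr (codeword_margV (fun v => (pass v t)%:R)).
Qed.

Lemma enc_index_expect :
  rv_expect (iid codeword_law) (fun cb =>
    avg (fun m => \sum_x pVX (cb m).1 x * (enc_index cb m.1.1 x != m)%:R)) <=
  \sum_v \sum_x pV v * pVX v x * (~~ pass1 v x)%:R +
  #|{: B * C}|.-1%:R * \sum_x pX x * \sum_v pV v * (pass1 v x)%:R.
Proof.
rewrite rv_expect_avg; apply: avg_le => // -[[a b] c'] /=.
pose e (bc : B * C) : I1 := (a, bc.1, bc.2).
have einj : injective e by move=> [? ?] [? ?] [-> ->].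
have := index_error_expect (b0, c0) (b, c') pass1 einj (fun (w : CW) x => pVX0 w.1 x).
rewrite (codeword_margV (fun v => \sum_t pVX v t * (~~ pass1 v t)%:R)) => h.
apply: (le_trans (le_trans _ h)).
  apply: ler_rv_expect => [|cb]; first exact: cw_pmf.1.
  apply: ler_sum => x _; rewrite ler_wpM2l // /enc_index /e ler_nat.
  case: [pick _ | _] => [[b1 c1]|] /=; rewrite !xpair_eqE eqxx //=.
apply: lerD; first by apply: ler_sum => v _; rewrite mulr_sumr; apply: ler_sum => x _; rewrite mulrA.
rewrite ler_wpM2l //; apply: ler_sum => x _.
by rewrite (codeword_margV (pVX ^~ x)) /pX tcXE.
Qed.

Let pVUZ_marg v z : \sum_u pVU v u * pVUZ v u z = pVZ v z.
Proof.
rewrite /pVZ tcVZE; under eq_bigr do rewrite /pVUZ tcVUZE mulr_sumr.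
rewrite exchange_big /=; apply: eq_bigr => x _.
by rewrite tcVXE' mulr_suml; apply: eq_bigr => u _; rewrite mulrA.
Qed.

Lemma dec_index_expect :
  rv_expect (iid codeword_law) (fun cb => avg (fun m => avg (fun lk =>
     \sum_z pVUZ (cb m).1 ((cb m).2 lk) z * (dec_index cb m.1 z != m)%:R))) <=
  \sum_v \sum_z pV v * pVZ v z * (~~ pass2 v z)%:R +
  #|C|.-1%:R * \sum_z pZm z * \sum_v pV v * (pass2 v z)%:R.
Proof.
rewrite rv_expect_avg; apply: avg_le => // -[ab c'] /=.
rewrite rv_expect_avg; apply: avg_le => // lk.
pose e (c1 : C) : I1 := (ab, c1).
have einj : injective e by move=> ? ? [->].
have := index_error_expect c0 c' pass2 einj (fun (w : CW) z => pVUZ0 w.1 (w.2 lk) z).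
rewrite (codeword_margVU lk (fun v u => \sum_t pVUZ v u t * (~~ pass2 v t)%:R)) => h.
apply: (le_trans (le_trans _ h)).
  apply: ler_rv_expect => [|cb]; first exact: cw_pmf.1.
  apply: ler_sum => x _; rewrite ler_wpM2l // /dec_index /e ler_nat.
  by rewrite xpair_eqE eqxx /=.
apply: lerD.
  apply: ler_sum => v _.
  have -> : \sum_u pVU v u * (\sum_t pVUZ v u t * (~~ pass2 v t)%:R) =
            \sum_t pVZ v t * (~~ pass2 v t)%:R.
    under [LHS]eq_bigr do rewrite mulr_sumr.
    rewrite exchange_big /=; apply: eq_bigr => z _.
    under eq_bigr do rewrite mulrA.
    by rewrite -mulr_suml pVUZ_marg.
  by rewrite mulr_sumr; apply: ler_sum => z _; rewrite mulrA.
rewrite ler_wpM2l //; apply: ler_sum => z _.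
rewrite (codeword_margVU lk (fun v u => pVUZ v u z)) /pZm tcZE.
rewrite le_eqVlt; apply/orP; left; apply/eqP; congr (_ * _).
by apply: eq_bigr => v _; rewrite pVUZ_marg.
Qed.

(** Satellites of one cloud centre are independent only given v, so a wrong k meets z under p(z|v)
    p(u|v). The thresholds here therefore concern informations conditional on V. *)
Lemma dec_sub_expect :
  rv_expect (iid codeword_law) (fun cb => avg (fun m => avg (fun lk =>
     \sum_z pVUZ (cb m).1 ((cb m).2 lk) z * (dec_sub cb m lk.1 z != lk.2)%:R))) <=
  \sum_v \sum_u \sum_z pV v * pVU v u * pVUZ v u z * (~~ pass3 v u z)%:R +
  #|K|.-1%:R * \sum_v pV v * \sum_z pVZ v z * \sum_u pVU v u * (pass3 v u z)%:R.
Proof.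
rewrite rv_expect_avg; apply: avg_le => // m.
rewrite rv_expect_avg; apply: avg_le => // -[l k] /=.
rewrite /rv_expect /= (iid_marg1 codeword_pmf m (fun w => \sum_z pVUZ w.1 (w.2 (l, k)) z *
  (odflt k0 [pick k' | pass3 w.1 (w.2 (l, k')) z] != k)%:R)).
apply: (@le_trans _ _ (rv_expect codeword_law (fun w =>
    \sum_z pVUZ w.1 (w.2 (l, k)) z * (~~ pass3 w.1 (w.2 (l, k)) z)%:R +
    \sum_(k' | k' != k) \sum_z pVUZ w.1 (w.2 (l, k)) z * (pass3 w.1 (w.2 (l, k')) z)%:R))).
  apply: ler_rv_expect => [|w]; first exact: codeword_pmf.1.
  rewrite exchange_big -big_split /=; apply: ler_sum => z _.
  rewrite -mulr_sumr -mulrDr ler_wpM2l //.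
  exact: (@pick_decoder R _ k0 k (fun k' => pass3 w.1 (w.2 (l, k')) z)).
rewrite rv_expectD [X in _ + X]rv_expect_sum; apply: lerD.
  rewrite /rv_expect /= (codeword_margVU (l, k)
    (fun v u => \sum_z pVUZ v u z * (~~ pass3 v u z)%:R)).
  apply: ler_sum => v _; rewrite mulr_sumr; apply: ler_sum => u _.
  by rewrite !mulr_sumr; apply: ler_sum => z _; rewrite !mulrA.
rewrite (eq_bigr (fun=> \sum_v pV v * \sum_z pVZ v z * \sum_u pVU v u * (pass3 v u z)%:R))
   => [|k' k'k]; first by rewrite sumr_const cardC1 mulr_natl.
rewrite /rv_expect /= (@codeword_margVUU (l, k) (l, k')
  (fun v u u' => \sum_z pVUZ v u z * (pass3 v u' z)%:R)); last first.
  by rewrite xpair_eqE eqxx /= eq_sym.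
apply: eq_bigr => v _; congr (_ * _).
under [RHS]eq_bigr do rewrite -pVUZ_marg mulr_suml.
rewrite [RHS]exchange_big /=; apply: eq_bigr => u _.
under [RHS]eq_bigr do rewrite -mulrA.
rewrite -mulr_sumr; congr (_ * _).
under eq_bigr do rewrite mulr_sumr.
rewrite exchange_big /=; apply: eq_bigr => z _.
under eq_bigr do rewrite mulrCA.
by rewrite -mulr_sumr.
Qed.

Lemma helper_cover_expect tau : 0 <= tau ->
  rv_expect (iid codeword_law) (fun cb : {ffun I1 -> CW} =>
    \sum_y `|pY y - avg (fun m => pVY (cb m).1 y)|) <=
  2 * (\sum_v \sum_y pV v * pVY v y * (tau * pY y < pVY v y)%R%:R) +
  Num.sqrt (tau / #|{: I1}|%:R).
Proof.
move=> t0.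
apply: (le_trans (soft_covering codeword_pmf (fun (w : CW) y => pVY0 w.1 y) _ pY1 t0 I1_gt0)).
  by move=> y; rewrite (codeword_margV (pVY ^~ y)) /pY tcYE.
rewrite lerD2r ler_wpM2l //.
under eq_bigr do under eq_bigr do rewrite -mulrA.
under eq_bigr do rewrite -mulr_sumr.
rewrite (codeword_margV (fun v => \sum_y pVY v y * (tau * pY y < pVY v y)%R%:R)).
by apply: ler_sum => v _; rewrite mulr_sumr; apply: ler_sum => y _; rewrite mulrA.
Qed.

Lemma enc_cover_expect tau : 0 <= tau ->
  rv_expect (iid codeword_law) (fun cb : {ffun I1 -> CW} => avg (fun m =>
    \sum_x `|pVX (cb m).1 x - avg (fun lk => pVUX (cb m).1 ((cb m).2 lk) x)|)) <=
  2 * (\sum_v \sum_u \sum_x pV v * pVU v u * pVUX v u x * (tau * pVX v x < pVUX v u x)%R%:R) +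
  Num.sqrt (tau / #|{: I2}|%:R).
Proof.
move=> t0; rewrite rv_expect_avg; apply: avg_le => // m.
rewrite /rv_expect /= (iid_marg1 codeword_pmf m
  (fun w => \sum_x `|pVX w.1 x - avg (fun lk => pVUX w.1 (w.2 lk) x)|)).
rewrite (codeword_sum (fun v uu => \sum_x `|pVX v x - avg (fun lk => pVUX v (uu lk) x)|)).
(* For each fixed v the satellites are i.i.d., and soft covering applies to the channel U -> X
   selected by v. *)
apply: (@le_trans _ _ (\sum_v pV v * (2 * (\sum_u \sum_x pVU v u * pVUX v u x *
    (tau * pVX v x < pVUX v u x)%R%:R) + Num.sqrt (tau / #|{: I2}|%:R)))).
  apply: ler_sum => v _; rewrite ler_wpM2l //.
  apply: soft_covering => //; first exact: (tcVU_stoch tc v).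
  by move=> x; rewrite /pVX tcVXE'.
under [leLHS]eq_bigr do rewrite mulrDr.
rewrite big_split /= -mulr_suml pV_pmf.2 mul1r lerD2r mulr_sumr; apply: ler_sum => v _.
rewrite mulrCA ler_wpM2l // mulr_sumr; apply: ler_sum => u _.
by rewrite mulr_sumr; apply: ler_sum => x _; rewrite !mulrA.
Qed.

Lemma ideal_cost_expect :
  rv_expect (iid codeword_law) (fun cb : {ffun I1 -> CW} =>
     avg (fun m => avg (fun lk => ideal_cost (cb m).1 ((cb m).2 lk)))) <=
  \sum_v pV v * \sum_u pVU v u * ideal_cost v u.
Proof.
rewrite rv_expect_avg; apply: avg_le => // m.
rewrite rv_expect_avg; apply: avg_le => // lk.
rewrite /rv_expect /= (iid_marg1 codeword_pmf m (fun w => ideal_cost w.1 (w.2 lk))).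
by rewrite (codeword_margVU lk ideal_cost).
Qed.

End OneShot.

Section OneShotTheorem.
Variable R : realType.

(** Change of measure: wherever the test passes, [q t] is below [kappa^-1 * W v t], and [W v] has
    total mass 1. *)
Lemma threshold_mass (T V : finType) (p : V -> R) (q : T -> R) (W : V -> T -> R) (kappa : R) :
  is_pmf p -> (forall v, is_pmf (W v)) -> 0 < kappa ->
  \sum_t q t * (\sum_v p v * (kappa * q t < W v t)%R%:R) <= kappa^-1.
Proof.
move=> [p0 p1] WP k0.
apply: (@le_trans _ _ (\sum_t \sum_v p v * (kappa^-1 * W v t))).
  apply: ler_sum => t _; rewrite mulr_sumr; apply: ler_sum => v _.
  rewrite mulrCA ler_wpM2l //.
  case: ltP => h; last by rewrite mulr0 mulr_ge0 ?invr_ge0 ?(ltW k0) //; case: (WP v).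
  by rewrite mulr1 -(ler_pM2l k0) mulVKf ?gt_eqF // ltW.
rewrite exchange_big /=.
under eq_bigr do rewrite -!mulr_sumr (WP _).2 mulr1.
by rewrite -mulr_suml p1 mul1r.
Qed.

Section TC.
Variables (X Y Z U V : finType) (tc : test_channel R X Y Z U V).

Lemma tcVX_pmf v : is_pmf (tcVX tc v).
Proof.
split=> [x|].
  rewrite tcVXE sumr_ge0 // => y _.
  by rewrite mulr_ge0 ?(tcVY_stoch tc v).1 ?(tcYX_stoch tc y).1.
under eq_bigr do rewrite tcVXE.
rewrite exchange_big /=; under eq_bigr do rewrite -mulr_sumr (tcYX_stoch tc _).2 mulr1.
exact: (tcVY_stoch tc v).2.
Qed.

Lemma tcVZ_pmf v : is_pmf (tcVZ tc v).
Proof.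
split=> [z|].
  rewrite tcVZE sumr_ge0 // => x _.
  by rewrite mulr_ge0 ?(tcVX_pmf v).1 ?(tcZ_stoch tc x).1.
under eq_bigr do rewrite tcVZE.
rewrite exchange_big /=; under eq_bigr do rewrite -mulr_sumr (tcZ_stoch tc _).2 mulr1.
exact: (tcVX_pmf v).2.
Qed.

Lemma tcVUZ_pmf v u : is_pmf (tcVUZ tc v u).
Proof.
split=> [z|].
  rewrite tcVUZE sumr_ge0 // => x _.
  by rewrite mulr_ge0 ?(tcVUX_stoch tc v u).1 ?(tcZ_stoch tc x).1.
under eq_bigr do rewrite tcVUZE.
rewrite exchange_big /=; under eq_bigr do rewrite -mulr_sumr (tcZ_stoch tc _).2 mulr1.
exact: (tcVUX_stoch tc v u).2.
Qed.

End TC.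

(** The hypotheses bound in turn five threshold violations under the ideal law, two covering terms,
    and three union bounds over competing indices. Both helper functions are projections of one
    chosen index. *)
Lemma oneshot (X Y Z U V Xh : finType) (tc : test_channel R X Y Z U V)
    (A B C M K : finType) (c : X -> Xh -> R) (dm : R) (xh : U -> V -> Z -> Xh)
    (tau1 tau2 kappa1 kappa2 kappa3 eta : R) :
  (0 < #|A|)%N -> (0 < #|B|)%N -> (0 < #|C|)%N -> (0 < #|M|)%N -> (0 < #|K|)%N ->
  (forall x x', 0 <= c x x' <= dm) -> 0 <= dm ->
  0 <= tau1 -> 0 <= tau2 -> 0 < kappa1 -> 0 < kappa2 -> 0 < kappa3 -> 0 <= eta ->
  \sum_v \sum_y tcV tc v * tcVY tc v y *
     (tau1 * tcY_marg tc y < tcVY tc v y)%R%:R <= eta ->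
  \sum_v \sum_x tcV tc v * tcVX tc v x *
     (~~ (kappa1 * tcX_marg tc x < tcVX tc v x)%R)%:R <= eta ->
  \sum_v \sum_z tcV tc v * tcVZ tc v z *
     (~~ (kappa2 * tcZ_marg tc z < tcVZ tc v z)%R)%:R <= eta ->
  \sum_v \sum_u \sum_x tcV tc v * tcVU tc v u * tcVUX tc v u x *
     (tau2 * tcVX tc v x < tcVUX tc v u x)%R%:R <= eta ->
  \sum_v \sum_u \sum_z tcV tc v * tcVU tc v u * tcVUZ tc v u z *
     (~~ (kappa3 * tcVZ tc v z < tcVUZ tc v u z)%R)%:R <= eta ->
  tau1 / #|{: A * B * C}|%:R <= eta ^+ 2 -> tau2 / #|{: M * K}|%:R <= eta ^+ 2 ->
  #|{: B * C}|.-1%:R / kappa1 <= eta -> #|C|.-1%:R / kappa2 <= eta ->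
  #|K|.-1%:R / kappa3 <= eta ->
  exists (fe : Y -> A) (fd : Y -> A * B) (f : X -> A -> M) (g : M -> A * B -> Z -> Xh),
    \sum_x \sum_y \sum_z tcXY tc x y * tcZ tc x z * c x (g (f x (fe y)) (fd y) z) <=
    \sum_v tcV tc v * \sum_u tcVU tc v u * 
      (\sum_x tcVUX tc v u x * \sum_z tcZ tc x z * c x (xh u v z)) + dm * (12 * eta).
Proof.
move=> /card_gt0P[a0 _] /card_gt0P[b0 _] /card_gt0P[c0 _] /card_gt0P[l0 _] /card_gt0P[k0 _].
move=> cb01 dm0 t10 t20 k10 k20 k30 eta0 P1 P2 P3 P4 P5 S1 S2 N1 N2 N3.
pose pass1 v x := kappa1 * tcX_marg tc x < tcVX tc v x.
pose pass2 v z := kappa2 * tcZ_marg tc z < tcVZ tc v z.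
pose pass3 v u z := kappa3 * tcVZ tc v z < tcVUZ tc v u z.
have sq (s : R) : s <= eta ^+ 2 -> Num.sqrt s <= eta.
  by move=> /ler_wsqrtr /le_trans; apply; rewrite sqrtr_sqr ger0_norm.
have cw := iid_pmf (A * B * C)%type (codeword_pmf tc M K).
have [cb hcb] : exists cb : {ffun A * B * C -> V * {ffun M * K -> U}}, oneshot_bound tc b0 c0 k0 c dm xh pass1 pass2 pass3 cb <=
    \sum_v tcV tc v * \sum_u tcVU tc v u * ideal_cost tc c xh v u + dm * (12 * eta).
  apply: (exists_le_mean cw).
  rewrite -/(rv_expect _ _) /oneshot_bound rv_expectD rv_expectZ.
  apply: lerD; first exact: (ideal_cost_expect tc a0 b0 c0 l0 k0).
  rewrite ler_wpM2l // !rv_expectD.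
  have H1 := helper_cover_expect tc M K a0 b0 c0 t10.
  have H2 := enc_index_expect tc M K a0 b0 c0 pass1.
  have H3 := enc_cover_expect tc a0 b0 c0 l0 k0 t20.
  have H4 := dec_index_expect tc a0 b0 c0 l0 k0 pass2.
  have H5 := dec_sub_expect tc a0 b0 c0 l0 k0 pass3.
  have Q1 : #|{: B * C}|.-1%:R * (\sum_x tcX_marg tc x * \sum_v tcV tc v * (pass1 v x)%:R) <= eta.
    apply: le_trans N1; rewrite ler_wpM2l //.
    exact: threshold_mass (tcV_pmf tc) (tcVX_pmf tc) k10.
  have Q2 : #|C|.-1%:R * (\sum_z tcZ_marg tc z * \sum_v tcV tc v * (pass2 v z)%:R) <= eta.
    apply: le_trans N2; rewrite ler_wpM2l //.
    exact: threshold_mass (tcV_pmf tc) (tcVZ_pmf tc) k20.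
  have Q3 : #|K|.-1%:R * (\sum_v tcV tc v * \sum_z tcVZ tc v z *
               \sum_u tcVU tc v u * (pass3 v u z)%:R) <= eta.
    apply: le_trans N3; rewrite ler_wpM2l //.
    have -> : kappa3^-1 = \sum_v tcV tc v * kappa3^-1.
      by rewrite -mulr_suml (tcV_pmf tc).2 mul1r.
    apply: ler_sum => v _; rewrite ler_wpM2l ?(tcV_pmf tc).1 //.
    exact: (@threshold_mass _ _ _ (tcVZ tc v) (tcVUZ tc v) _ (tcVU_stoch tc v) (tcVUZ_pmf tc v) k30).
  have S1' := sq _ S1; have S2' := sq _ S2.
  apply: (le_trans (lerD (lerD (lerD (lerD H1 H2) H3) H4) H5)).
  (* Each covering term costs [3 * eta], twice a tail plus a square root, and each decoding error
     [2 * eta]: together 3 + 2 + 3 + 2 + 2 = 12. *)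
  have E3 : 2 * (\sum_v \sum_y tcV tc v * tcVY tc v y *
     (tau1 * tcY_marg tc y < tcVY tc v y)%R%:R) + Num.sqrt (tau1 / #|{: A * B * C}|%:R) <= 3 * eta.
    by move: P1 S1'; lra.
  have E3' : 2 * (\sum_v \sum_u \sum_x tcV tc v * tcVU tc v u * tcVUX tc v u x *
     (tau2 * tcVX tc v x < tcVUX tc v u x)%R%:R) + Num.sqrt (tau2 / #|{: M * K}|%:R) <= 3 * eta.
    by move: P4 S2'; lra.
  apply: (le_trans (lerD (lerD (lerD (lerD E3 (lerD P2 Q1)) E3') (lerD P3 Q2)) (lerD P5 Q3))).
  by lra.
pose h := oneshot_helper tc a0 b0 c0 l0 k0 c xh pass1 pass2 pass3 cb.
exists (fun y => (h y).1.1), (fun y => (h y).1),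
  (oneshot_enc tc b0 c0 l0 k0 c xh pass1 pass2 pass3 cb),
  (oneshot_dec c0 k0 xh pass2 pass3 cb).
apply: le_trans hcb.
exact: (oneshot_cost_le tc a0 b0 c0 l0 k0 xh cb01 pass1 pass2 pass3 cb).
Qed.

End OneShotTheorem.

(** * Product channels and information densities *)

Section TensorPower.
Variables (R : realType) (n : nat).

Lemma iid_kernel_stoch (A B : finType) (q : A -> B -> R) (a : {ffun 'I_n -> A}) :
  is_stoch q -> is_pmf (fun b : {ffun 'I_n -> B} => \prod_i q (a i) (b i)).
Proof.
move=> qP; split=> [b|]; first by apply: prodr_ge0 => i _; exact: (qP (a i)).1.
by rewrite (prod_sum_ffun (fun i => q (a i))) big1 // => i _; exact: (qP (a i)).2.
Qed.

Lemma sum_prod_mul (I A : finType) (F G : I -> A -> R) :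
  \sum_(a : {ffun I -> A}) (\prod_i F i (a i)) * (\prod_i G i (a i)) =
  \prod_i \sum_a F i a * G i a.
Proof.
rewrite -(prod_sum_ffun (fun i a => F i a * G i a)).
by apply: eq_bigr => a _; rewrite big_split.
Qed.

Variables (X Y Z U V : finType) (tc : test_channel R X Y Z U V).

(** Marginals and composite kernels are fields of the record, so in the n-fold power they are
    products by construction, which is the form that Chebyshev's inequality requires. *)
Definition tensor : test_channel R {ffun 'I_n -> X} {ffun 'I_n -> Y} {ffun 'I_n -> Z}
    {ffun 'I_n -> U} {ffun 'I_n -> V}.
Proof.
refine (@TestChannel R {ffun 'I_n -> X} {ffun 'I_n -> Y} {ffun 'I_n -> Z} {ffun 'I_n -> U}
   {ffun 'I_n -> V}
  (fun x y => \prod_i tcXY tc (x i) (y i)) (fun x z => \prod_i tcZ tc (x i) (z i))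
  (iid (tcV tc)) (fun v y => \prod_i tcVY tc (v i) (y i))
  (fun y x => \prod_i tcYX tc (y i) (x i)) (fun v u => \prod_i tcVU tc (v i) (u i))
  (fun v u x => \prod_i tcVUX tc (v i) (u i) (x i))
  (iid (tcY_marg tc)) (iid (tcX_marg tc)) (iid (tcZ_marg tc))
  (fun v x => \prod_i tcVX tc (v i) (x i)) (fun v z => \prod_i tcVZ tc (v i) (z i))
  (fun v u z => \prod_i tcVUZ tc (v i) (u i) (z i)) _ _ _ _ _ _ _ _ _ _ _ _ _ _).
- by move=> x y; rewrite -big_split /=; apply: eq_bigr => i _; rewrite tcXYE.
- by move=> y; rewrite (sum_prod_mul (fun=> tcV tc) (fun i v => tcVY tc v (y i)));
    apply: eq_bigr => i _; rewrite tcYE.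
- exact: iid_pmf (tcV_pmf tc).
- by move=> v; apply: iid_kernel_stoch; exact: tcVY_stoch.
- by move=> v; apply: iid_kernel_stoch; exact: tcYX_stoch.
- by move=> v; apply: iid_kernel_stoch; exact: tcVU_stoch.
- move=> v u.
  have := iid_kernel_stoch [ffun i => (v i, u i)] (fun vu : V * U => tcVUX_stoch tc vu.1 vu.2).
  suff -> : (fun b : {ffun 'I_n -> X} => \prod_i tcVUX tc ([ffun i => (v i, u i)] i).1
      ([ffun i => (v i, u i)] i).2 (b i)) = (fun x => \prod_i tcVUX tc (v i) (u i) (x i)) by [].
  by apply/funext => x; apply: eq_bigr => i _; rewrite ffunE.
- by move=> v; apply: iid_kernel_stoch; exact: tcZ_stoch.
- by move=> v x; rewrite (sum_prod_mul (fun i => tcVY tc (v i)) (fun i y => tcYX tc y (x i)));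
    apply: eq_bigr => i _; rewrite tcVXE.
- by move=> v x; rewrite (sum_prod_mul (fun i => tcVU tc (v i)) (fun i u => tcVUX tc (v i) u (x i)));
    apply: eq_bigr => i _; rewrite tcVXE'.
- by move=> v z; rewrite (sum_prod_mul (fun i => tcVX tc (v i)) (fun i x => tcZ tc x (z i)));
    apply: eq_bigr => i _; rewrite tcVZE.
- by move=> v u z; rewrite (sum_prod_mul (fun i => tcVUX tc (v i) (u i)) (fun i x => tcZ tc x (z i)));
    apply: eq_bigr => i _; rewrite tcVUZE.
- by move=> x; rewrite (sum_prod_mul (fun=> tcV tc) (fun i v => tcVX tc v (x i)));
    apply: eq_bigr => i _; rewrite tcXE.
- by move=> z; rewrite (sum_prod_mul (fun=> tcV tc) (fun i v => tcVZ tc v (z i)));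
    apply: eq_bigr => i _; rewrite tcZE.
Defined.

End TensorPower.

Section AEP.
Variable R : realType.

Lemma exists_nat_ge (x : R) : exists N : nat, forall n, (N <= n)%N -> x <= n%:R.
Proof.
exists (Num.bound `|x|) => n hn.
have h : `|x| < (Num.bound `|x|)%:R by apply: archi_boundP.
rewrite (le_trans (ler_norm _)) // (le_trans (ltW h)) // ler_nat //.
Qed.

(* By Chebyshev's inequality for the sum of the log-likelihood ratios. *)
Lemma aep (O : finType) (p f g : O -> R) (eps eta : R) :
  is_pmf p -> (forall o, 0 < p o -> 0 < f o /\ 0 < g o) -> 0 < eps -> 0 < eta ->
  exists N : nat, forall n, (N <= n)%N ->
  \sum_(o : {ffun 'I_n -> O}) iid p o *
    (pow2 (n%:R * (\sum_s p s * (log2 (f s) - log2 (g s)) + eps)) * (\prod_i g (o i))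
      <= \prod_i f (o i))%R%:R <= eta.
Proof.
move=> pP pos e0 eta0; have [p0 p1] := pP.
set I := \sum_s _; pose h s := log2 (f s) - log2 (g s) - I.
have h0 : \sum_s p s * h s = 0.
  by under eq_bigr do rewrite mulrBr; rewrite sumrB -mulr_suml p1 mul1r subrr.
pose var := \sum_s p s * h s ^+ 2.
have var0 : 0 <= var by apply: sumr_ge0 => s _; rewrite mulr_ge0 // sqr_ge0.
(* Chebyshev's bound is [var / (n * eps^2)]; the added 1 keeps [n] positive when the variance is
   0. *)
have [N hN] := exists_nat_ge (var / (eps ^+ 2 * eta) + 1).
exists N => n /hN hn.
have nvar : var / (eps ^+ 2 * eta) <= n%:R by apply: le_trans hn; rewrite lerDl.
have n0 : 0 < n%:R :> R.
  apply: lt_le_trans hn; rewrite (lt_le_trans ltr01) // lerDr divr_ge0 //.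
  by rewrite mulr_ge0 ?sqr_ge0 ?ltW.
have ne0 : 0 < (n%:R * eps) ^+ 2 by rewrite exprn_gt0 // mulr_gt0.
apply: (@le_trans _ _ (\sum_(o : {ffun 'I_n -> O})
    iid p o * (((n%:R * eps) ^+ 2)^-1 * (\sum_i h (o i)) ^+ 2))).
  apply: ler_sum => o _.
  have := iid_ge0 o p0; rewrite le_eqVlt => /orP[/eqP <-|io]; first by rewrite !mul0r.
  rewrite ler_pM2l //; case: (boolP (pow2 _ * _ <= _)) => [hb|_]; last by rewrite mulr_ge0 ?invr_ge0 ?sqr_ge0.
  (* A sequence of positive mass has only letters of positive mass, where both likelihoods are
     positive and the logarithms split. *)
  have po i : 0 < p (o i).
    rewrite lt0r p0 andbT; apply: contraTneq io => pi0.
    by rewrite /iid (bigD1 i) //= pi0 mul0r ltxx.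
  have g0 : 0 < \prod_i g (o i) by apply: prodr_gt0 => i _; case: (pos _ (po i)).
  have := le_log2 (mulr_gt0 (pow2_gt0 _) g0) hb.
  rewrite log2M ?pow2_gt0 // pow2K.
  rewrite !log2_prod => [||]; last first.
  - by move=> i; case: (pos _ (po i)).
  - by move=> i; case: (pos _ (po i)).
  rewrite -lerBrDr -sumrB => hs.
  have {}hs : n%:R * eps <= \sum_i h (o i).
    rewrite /h sumrB sumr_const card_ord -[I *+ n]mulr_natl.
    by rewrite lerBrDr -mulrDr [eps + I]addrC.
  rewrite mulr1n -(ler_pM2l ne0) mulr1 mulVKf ?gt_eqF //.
  have ne1 : 0 <= n%:R * eps by rewrite mulr_ge0 // ltW.
  by rewrite ler_sqr ?nnegrE // (le_trans ne1).
under eq_bigr do rewrite mulrCA.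
rewrite -mulr_sumr (iid_var0 _ pP h0) card_ord -/var.
rewrite ler_pdivrMl // exprMn.
move: nvar; rewrite ler_pdivrMr ?mulr_gt0 ?exprn_gt0 // => nvar.
rewrite expr2 -!mulrA ler_pM2l //; apply: (le_trans nvar); rewrite le_eqVlt; apply/orP; left.
by apply/eqP; ring.
Qed.

Lemma aep2 (A B : finType) (p f g : A -> B -> R) (eps eta : R) :
  is_pmf (fun o : A * B => p o.1 o.2) ->
  (forall a b, 0 < p a b -> 0 < f a b /\ 0 < g a b) -> 0 < eps -> 0 < eta ->
  exists N : nat, forall n, (N <= n)%N ->
  \sum_(a : {ffun 'I_n -> A}) \sum_(b : {ffun 'I_n -> B}) (\prod_i p (a i) (b i)) *
    (pow2 (n%:R * (\sum_a \sum_b p a b * (log2 (f a b) - log2 (g a b)) + eps)) *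
      (\prod_i g (a i) (b i)) <= \prod_i f (a i) (b i))%R%:R <= eta.
Proof.
move=> pP pos e0 eta0.
have [N hN] := @aep _ _ (fun o => f o.1 o.2) (fun o => g o.1 o.2) eps eta pP
   (fun o => pos o.1 o.2) e0 eta0.
exists N => n /hN; rewrite sum_ffun_pair.
rewrite -(pair_bigA _ (fun a b => p a b * (log2 (f a b) - log2 (g a b)))) /= => h.
apply: le_trans h; apply: ler_sum => o _.
have E (q : A -> B -> R) : \prod_i q ([ffun i => (o i).1] i) ([ffun i => (o i).2] i) =
   \prod_i q (o i).1 (o i).2 by apply: eq_bigr => i _; rewrite !ffunE.
by rewrite !E.
Qed.

Lemma aep3 (A B C : finType) (p f g : A -> B -> C -> R) (eps eta : R) :
  is_pmf (fun o : A * B * C => p o.1.1 o.1.2 o.2) ->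
  (forall a b c, 0 < p a b c -> 0 < f a b c /\ 0 < g a b c) -> 0 < eps -> 0 < eta ->
  exists N : nat, forall n, (N <= n)%N ->
  \sum_(a : {ffun 'I_n -> A}) \sum_(b : {ffun 'I_n -> B}) \sum_(c : {ffun 'I_n -> C})
    (\prod_i p (a i) (b i) (c i)) *
    (pow2 (n%:R * (\sum_a \sum_b \sum_c p a b c * (log2 (f a b c) - log2 (g a b c)) + eps)) *
      (\prod_i g (a i) (b i) (c i)) <= \prod_i f (a i) (b i) (c i))%R%:R <= eta.
Proof.
move=> pP pos e0 eta0.
have [N hN] := @aep2 _ _ (fun ab c => p ab.1 ab.2 c) (fun ab c => f ab.1 ab.2 c)
   (fun ab c => g ab.1 ab.2 c) eps eta pP (fun ab => pos ab.1 ab.2) e0 eta0.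
exists N => n /hN.
rewrite -(pair_bigA _ (fun a b => \sum_c p a b c * (log2 (f a b c) - log2 (g a b c)))) /= => h.
rewrite sum_ffun_pair; apply: le_trans h; apply: ler_sum => o _; apply: ler_sum => c _.
have E (q : A -> B -> C -> R) :
   \prod_i q ([ffun i => (o i).1] i) ([ffun i => (o i).2] i) (c i) =
   \prod_i q (o i).1 (o i).2 (c i) by apply: eq_bigr => i _; rewrite !ffunE.
by rewrite !E.
Qed.

Lemma pow2_small (eps theta : R) : 0 < eps -> 0 < theta ->
  exists N : nat, forall n, (N <= n)%N -> pow2 (n%:R * - eps) <= theta.
Proof.
move=> e0 t0; have [N hN] := exists_nat_ge (- log2 theta / eps).
exists N => n /hN; rewrite ler_pdivrMr // => h.
by rewrite -(log2K t0) ler_pow2 mulrN lerNl.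
Qed.

Lemma nat_approx (x : R) : 0 <= x -> exists k : nat, k%:R <= x < k.+1%:R.
Proof. by move=> x0; exists (Num.truncn x); exact: truncn_itv. Qed.

End AEP.

(** * Achievability at the information rates of a test channel *)

Section Achievability.
Variables (R : realType) (X Y Z U V Xh : finType) (tc : test_channel R X Y Z U V).
Variables (d : X -> Xh -> R) (xh : U -> V -> Z -> Xh).
Hypothesis d0 : forall x x', 0 <= d x x'.

Definition tcI_VY := \sum_v \sum_y tcV tc v * tcVY tc v y *
  (log2 (tcVY tc v y) - log2 (tcY_marg tc y)).
Definition tcI_VX := \sum_v \sum_x tcV tc v * tcVX tc v x *
  (log2 (tcVX tc v x) - log2 (tcX_marg tc x)).
Definition tcI_VZ := \sum_v \sum_z tcV tc v * tcVZ tc v z *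
  (log2 (tcVZ tc v z) - log2 (tcZ_marg tc z)).
Definition tcI_UX := \sum_v \sum_u \sum_x tcV tc v * tcVU tc v u * tcVUX tc v u x *
  (log2 (tcVUX tc v u x) - log2 (tcVX tc v x)).
Definition tcI_UZ := \sum_v \sum_u \sum_z tcV tc v * tcVU tc v u * tcVUZ tc v u z *
  (log2 (tcVUZ tc v u z) - log2 (tcVZ tc v z)).

Definition tc_distortion := \sum_v tcV tc v * \sum_u tcVU tc v u *
  (\sum_x tcVUX tc v u x * \sum_z tcZ tc x z * d x (xh u v z)).

Lemma pmf_prod2 (A B : finType) (p : A -> R) (W : A -> B -> R) :
  is_pmf p -> (forall a, is_pmf (W a)) -> is_pmf (fun o : A * B => p o.1 * W o.1 o.2).
Proof.
move=> [p0 p1] WP; split=> [[a b]|]; first by rewrite mulr_ge0 //; case: (WP a).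
rewrite -(pair_bigA _ (fun a b => p a * W a b)) /=.
by under eq_bigr do rewrite -mulr_sumr (WP _).2 mulr1.
Qed.

Let tcVU_pmf := pmf_prod2 (tcV_pmf tc) (tcVU_stoch tc).

Let pos2 (S T : finType) (p : S -> R) (W : S -> T -> R) (q : T -> R) v t :
  (forall v, 0 <= p v) -> (forall v t, 0 <= W v t) ->
  q t = \sum_v p v * W v t -> 0 < p v * W v t -> 0 < W v t /\ 0 < q t.
Proof.
move=> p0 W0 -> h; split.
  by rewrite lt0r W0 andbT; apply: contraTneq h => ->; rewrite mulr0 ltxx.
by rewrite (bigD1 v) //= ltr_pwDl // sumr_ge0 // => v' _; rewrite mulr_ge0.
Qed.

(** The four blocks merge into one i.i.d. sequence of quadruples, every coordinate of which has the
    single-letter distortion. *)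
Lemma tensor_distortion n : (0 < n)%N ->
  \sum_v tcV (tensor n tc) v * (\sum_u tcVU (tensor n tc) v u *
   (\sum_x tcVUX (tensor n tc) v u x * (\sum_z tcZ (tensor n tc) x z *
     (n%:R^-1 * \sum_(i < n) d (x i) ([ffun i => xh (u i) (v i) (z i)] i))))) =
  tc_distortion.
Proof.
move=> n0 /=.
pose p (o : V * U * X * Z) :=
  tcV tc o.1.1.1 * tcVU tc o.1.1.1 o.1.1.2 * tcVUX tc o.1.1.1 o.1.1.2 o.1.2 * tcZ tc o.1.2 o.2.
have pP : is_pmf p.
  apply: (@pmf_prod2 _ _ (fun o : V * U * X => tcV tc o.1.1 * tcVU tc o.1.1 o.1.2 *
      tcVUX tc o.1.1 o.1.2 o.2) (fun o z => tcZ tc o.2 z)) => [|o]; last exact: tcZ_stoch.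
  apply: (@pmf_prod2 _ _ (fun o : V * U => tcV tc o.1 * tcVU tc o.1 o.2)
    (fun o x => tcVUX tc o.1 o.2 x)) => [|o]; [exact: tcVU_pmf|exact: tcVUX_stoch].
pose F (o : V * U * X * Z) := d o.1.2 (xh o.1.1.2 o.1.1.1 o.2).
transitivity (\sum_(o : {ffun 'I_n -> V * U * X * Z}) iid p o * (n%:R^-1 * \sum_i F (o i))).
  rewrite [RHS]sum_ffun_zip [RHS]sum_ffun_zip [RHS]sum_ffun_zip.
  apply: eq_bigr => v _; rewrite mulr_sumr; apply: eq_bigr => u _.
  rewrite mulrA mulr_sumr; apply: eq_bigr => x _.
  rewrite mulrA mulr_sumr; apply: eq_bigr => z _; rewrite mulrA.
  congr (_ * (_ * _)); last by apply: eq_bigr => i _; rewrite !ffunE.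
  by rewrite /iid -!big_split /=; apply: eq_bigr => i _; rewrite !ffunE.
under eq_bigr do rewrite mulrCA.
rewrite -mulr_sumr.
under eq_bigr do rewrite mulr_sumr.
rewrite exchange_big /=.
under eq_bigr do rewrite (iid_marg1 pP _ F).
rewrite sumr_const card_ord -[X in _ * X]mulr_natl mulKf ?pnatr_eq0 -?lt0n //.
rewrite -(pair_bigA _ (fun o z => p (o, z) * F (o, z))) /=.
rewrite -(pair_bigA _ (fun o x => \sum_z p (o, x, z) * F (o, x, z))) /=.
rewrite -(pair_bigA _ (fun v u => \sum_x \sum_z p (v, u, x, z) * F (v, u, x, z))) /=.
apply: eq_bigr => v _; rewrite mulr_sumr; apply: eq_bigr => u _.
rewrite mulrA mulr_sumr; apply: eq_bigr => x _.
by rewrite mulrA mulr_sumr; apply: eq_bigr => z _; rewrite mulrA.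
Qed.

(** The concentration bound is one-sided. Covering uses it directly, with thresholds above the
    information; for the decoding tests numerator and denominator are exchanged, which flips the
    sign of the information and puts the threshold below it. *)
Lemma aep_tensor (eps eta : R) : 0 < eps -> 0 < eta ->
  exists N : nat, forall n, (N <= n)%N -> let tn := tensor n tc in
  [/\ \sum_v \sum_y tcV tn v * tcVY tn v y *
     (pow2 (n%:R * (tcI_VY + eps)) * tcY_marg tn y < tcVY tn v y)%R%:R <= eta,
  \sum_v \sum_x tcV tn v * tcVX tn v x *
     (~~ (pow2 (n%:R * (tcI_VX - eps)) * tcX_marg tn x < tcVX tn v x)%R)%:R <= eta,
  \sum_v \sum_z tcV tn v * tcVZ tn v z *
     (~~ (pow2 (n%:R * (tcI_VZ - eps)) * tcZ_marg tn z < tcVZ tn v z)%R)%:R <= eta,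
  \sum_v \sum_u \sum_x tcV tn v * tcVU tn v u * tcVUX tn v u x *
     (pow2 (n%:R * (tcI_UX + eps)) * tcVX tn v x < tcVUX tn v u x)%R%:R <= eta &
  \sum_v \sum_u \sum_z tcV tn v * tcVU tn v u * tcVUZ tn v u z *
     (~~ (pow2 (n%:R * (tcI_UZ - eps)) * tcVZ tn v z < tcVUZ tn v u z)%R)%:R <= eta].
Proof.
move=> e0 eta0.
have V0 := (tcV_pmf tc).1; have VX0 v := (tcVX_pmf tc v).1.
have VZ0 v := (tcVZ_pmf tc v).1; have VY0 v := (tcVY_stoch tc v).1.
have VU0 v := (tcVU_stoch tc v).1; have VUX0 v u := (tcVUX_stoch tc v u).1.
have VUZ0 v u := (tcVUZ_pmf tc v u).1.
have flip (n : nat) (I a b : R) :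
    (~~ (pow2 (n%:R * (I - eps)) * b < a)) = (pow2 (n%:R * (- I + eps)) * a <= b).
  rewrite -leNgt; have -> : - I + eps = - (I - eps) by ring.
  by rewrite mulrN pow2N ler_pdivrMl ?pow2_gt0.
have negI (T S : finType) (q f g : T -> S -> R) :
    \sum_a \sum_b q a b * (log2 (g a b) - log2 (f a b)) =
    - \sum_a \sum_b q a b * (log2 (f a b) - log2 (g a b)).
  rewrite -sumrN; apply: eq_bigr => a _; rewrite -sumrN; apply: eq_bigr => b _; ring.
have VUZE v z : tcVZ tc v z = \sum_u tcVU tc v u * tcVUZ tc v u z.
  rewrite tcVZE; under [RHS]eq_bigr do rewrite tcVUZE mulr_sumr.
  rewrite exchange_big /=; apply: eq_bigr => x _.
  by rewrite tcVXE' mulr_suml; apply: eq_bigr => u _; rewrite mulrA.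
have [N1 h1] := @aep2 R _ _ (fun v y => tcV tc v * tcVY tc v y) (tcVY tc)
  (fun _ => tcY_marg tc) eps eta (pmf_prod2 (tcV_pmf tc) (tcVY_stoch tc))
  (fun v y => @pos2 _ _ _ _ _ v y V0 VY0 (tcYE tc y)) e0 eta0.
have [N2 h2] := @aep2 R _ _ (fun v x => tcV tc v * tcVX tc v x)
  (fun _ => tcX_marg tc) (tcVX tc) eps eta (pmf_prod2 (tcV_pmf tc) (tcVX_pmf tc))
  (fun v y h => match @pos2 _ _ _ _ _ v y V0 VX0 (tcXE tc y) h with conj a b => conj b a end) e0 eta0.
have [N3 h3] := @aep2 R _ _ (fun v x => tcV tc v * tcVZ tc v x)
  (fun _ => tcZ_marg tc) (tcVZ tc) eps eta (pmf_prod2 (tcV_pmf tc) (tcVZ_pmf tc))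
  (fun v y h => match @pos2 _ _ _ _ _ v y V0 VZ0 (tcZE tc y) h with conj a b => conj b a end) e0 eta0.
have pos3 (T : finType) (W : V -> U -> T -> R) (q : V -> T -> R) v u t :
    (forall v u t, 0 <= W v u t) -> q v t = \sum_u tcVU tc v u * W v u t ->
    0 < tcV tc v * tcVU tc v u * W v u t -> 0 < W v u t /\ 0 < q v t.
  move=> W0 qE; rewrite -mulrA => h.
  apply: (@pos2 _ _ (tcVU tc v) (W v) (q v) u t) => //.
  rewrite lt0r mulr_ge0 // andbT; apply: contraTneq h => ->; by rewrite mulr0 ltxx.
have [N4 h4] := @aep3 R _ _ _ (fun v u x => tcV tc v * tcVU tc v u * tcVUX tc v u x)
  (tcVUX tc) (fun v _ => tcVX tc v) eps eta
  (@pmf_prod2 _ _ (fun o : V * U => tcV tc o.1 * tcVU tc o.1 o.2) (fun o x => tcVUX tc o.1 o.2 x)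
     tcVU_pmf (fun o => tcVUX_stoch tc o.1 o.2))
  (fun v u x => @pos3 _ (tcVUX tc) (tcVX tc) v u x VUX0 (tcVXE' tc v x)) e0 eta0.
have [N5 h5] := @aep3 R _ _ _ (fun v u x => tcV tc v * tcVU tc v u * tcVUZ tc v u x)
  (fun v _ => tcVZ tc v) (tcVUZ tc) eps eta
  (@pmf_prod2 _ _ (fun o : V * U => tcV tc o.1 * tcVU tc o.1 o.2) (fun o x => tcVUZ tc o.1 o.2 x)
     tcVU_pmf (fun o => tcVUZ_pmf tc o.1 o.2))
  (fun v u x h => match @pos3 _ (tcVUZ tc) (tcVZ tc) v u x VUZ0 (VUZE v x) h
                  with conj a b => conj b a end) e0 eta0.
exists (maxn N1 (maxn N2 (maxn N3 (maxn N4 N5)))) => n.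
rewrite !geq_max => /andP[/h1 {}h1 /andP[/h2 {}h2 /andP[/h3 {}h3 /andP[/h4 {}h4 /h5 {}h5]]]] tn.
split.
- apply: le_trans h1; apply: ler_sum => v _; apply: ler_sum => y _.
  rewrite -/tcI_VY /= /iid -big_split /= ler_wpM2l ?prodr_ge0 // => [i _|]; first exact: mulr_ge0.
  by rewrite ler_nat; case: ltP => // /ltW ->.
- apply: le_trans h2; apply: ler_sum => v _; apply: ler_sum => y _.
  rewrite negI -/tcI_VX /= /iid -big_split /= ler_wpM2l ?prodr_ge0 // => [i _|]; first exact: mulr_ge0.
  by rewrite flip.
- apply: le_trans h3; apply: ler_sum => v _; apply: ler_sum => y _.
  rewrite negI -/tcI_VZ /= /iid -big_split /= ler_wpM2l ?prodr_ge0 // => [i _|]; first exact: mulr_ge0.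
  by rewrite flip.
- apply: le_trans h4; apply: ler_sum => v _; apply: ler_sum => u _; apply: ler_sum => y _.
  rewrite -/tcI_UX /= /iid -!big_split /= ler_wpM2l ?prodr_ge0 // => [i _|]; first by rewrite !mulr_ge0.
  by rewrite ler_nat; case: ltP => // /ltW ->.
- apply: le_trans h5; apply: ler_sum => v _; apply: ler_sum => u _; apply: ler_sum => y _.
  have -> : \sum_v0 \sum_u0 \sum_z tcV tc v0 * tcVU tc v0 u0 * tcVUZ tc v0 u0 z *
     (log2 (tcVZ tc v0 z) - log2 (tcVUZ tc v0 u0 z)) = - tcI_UZ.
    by rewrite /tcI_UZ -sumrN; apply: eq_bigr => v0 _; exact: negI.
  rewrite /= /iid -!big_split /= ler_wpM2l ?prodr_ge0 // => [i _|]; first by rewrite !mulr_ge0.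
  by rewrite flip.
Qed.

(** Index sets have [k.+1] elements with [k] a floor. The extra element at most doubles a bound that
    is at least 1, and [1 <= n%:R * eps] pays for the doubling. *)
Lemma succ_le_pow2 (n k : nat) (a b eps : R) : 0 <= a -> a <= b -> 1 <= n%:R * eps ->
  k%:R <= pow2 (n%:R * a) -> k.+1%:R <= pow2 (n%:R * (b + eps)).
Proof.
move=> a0 ab ne hk; rewrite mulrDr pow2D.
have h2 : 2 <= pow2 (n%:R * eps) by rewrite -pow2_1 ler_pow2.
have hb : pow2 (n%:R * a) <= pow2 (n%:R * b) by rewrite ler_pow2 ler_wpM2l.
have h1 : 1 <= pow2 (n%:R * b) by rewrite -[X in X <= _]pow2_0 ler_pow2 mulr_ge0 // (le_trans a0).
rewrite -natr1; nra.
Qed.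

Lemma tc_achievable (delta : R) :
  0 <= tcI_VZ -> tcI_VZ <= tcI_VX -> tcI_VX <= tcI_VY -> tcI_UZ <= tcI_UX -> 0 < delta ->
  exists N : nat, forall n, (N <= n)%N ->
  exists (M Me Md : nat) (c : Defs.code X Y Z Xh n M Me Md),
    [/\ M%:R <= pow2 (n%:R * (tcI_UX - tcI_UZ + delta)),
        Me%:R <= pow2 (n%:R * (tcI_VY - tcI_VX + delta)),
        Md%:R <= pow2 (n%:R * (tcI_VY - tcI_VZ + delta)) &
        exp_distortion (tcXY tc) (tcZ tc) d c <= tc_distortion + delta].
Proof.
move=> J20 J21 J1I1 J3I2 del0.
set I1 := tcI_VY in J1I1 *; set J1 := tcI_VX in J21 J1I1 *; set J2 := tcI_VZ in J20 J21 *.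
set I2 := tcI_UX in J3I2 *; set J3 := tcI_UZ in J3I2 *.
pose dm := \sum_x \sum_x' d x x'.
have dm0 : 0 <= dm by apply: sumr_ge0 => x _; apply: sumr_ge0.
have ddm x x' : d x x' <= dm.
  rewrite /dm (bigD1 x) //= (bigD1 x') //= -addrA lerDl addr_ge0 ?sumr_ge0 //.
  by move=> x1 _; apply: sumr_ge0.
(* The rate of the decoder's helper message will exceed its target by [8 * eps]. The 12 is the
   constant of the one-shot bound, and [dm + 1] avoids a zero denominator. *)
pose eps := delta / 8; pose eta := delta / (12 * (dm + 1)).
have e0 : 0 < eps by rewrite divr_gt0.
have dm1 : 0 < dm + 1 by rewrite ltr_wpDl.
have eta0 : 0 < eta by rewrite divr_gt0 // mulr_gt0.
have dmeta : dm * (12 * eta) <= delta.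
  have -> : dm * (12 * eta) = delta * (dm / (dm + 1)).
    by rewrite /eta invfM; field; rewrite gt_eqF.
  by rewrite -[leRHS]mulr1 ler_wpM2l ?(ltW del0) // ler_pdivrMr // mul1r lerDl ler01.
have [N1 h1] := aep_tensor e0 eta0.
have [N2 h2] := pow2_small e0 (exprn_gt0 2 eta0).
have eta3 : 0 < eta / 3 by rewrite divr_gt0.
have [N3 h3] := pow2_small e0 eta3.
have [N4 h4] := exists_nat_ge (eps^-1 + 1).
exists (maxn N1 (maxn N2 (maxn N3 N4))) => n.
rewrite !geq_max => /andP[/h1 {}h1 /andP[/h2 {}h2 /andP[/h3 {}h3 /h4 {}h4]]].
case: h1 => P1 P2 P3 P4 P5.
have n0 : (0 < n)%N.
  rewrite -(ltr0n R); apply: lt_le_trans h4.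
  by rewrite addr_gt0 // invr_gt0.
have n0R : 0 < n%:R :> R by rewrite ltr0n.
have ne1 : 1 <= n%:R * eps.
  by rewrite -ler_pdivrMr // div1r (le_trans _ h4) // lerDl.
pose E (x : R) : R := pow2 (n%:R * x).
have E0 x : 0 < E x by exact: pow2_gt0.
have ED x y : E x * E y = E (x + y) by rewrite /E mulrDr pow2D.
have Ele x y : x <= y -> E x <= E y by move=> xy; rewrite ler_pow2 ler_wpM2l.
have EV x : (E x)^-1 = E (- x) by rewrite /E mulrN pow2N.
(* The totals exceed the covering rates [I1] and [I2] by [2 * eps], while the searched parts stay
   below [J1], [J2] and [J3] by at least [2 * eps]. An exponent may be negative: the floor is then 0
   and the index set ['I_k.+1] a singleton. *)
have [kA /andP[kA1 kA2]] := nat_approx (ltW (E0 (I1 - J1 + 6 * eps))).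
have [kB /andP[kB1 kB2]] := nat_approx (ltW (E0 (J1 - J2 - 2 * eps))).
have [kC /andP[kC1 kC2]] := nat_approx (ltW (E0 (J2 - 2 * eps))).
have [kM /andP[kM1 kM2]] := nat_approx (ltW (E0 (I2 - J3 + 4 * eps))).
have [kK /andP[kK1 kK2]] := nat_approx (ltW (E0 (J3 - 2 * eps))).
pose c (x : {ffun 'I_n -> X}) (x' : {ffun 'I_n -> Xh}) := n%:R^-1 * \sum_(i < n) d (x i) (x' i).
have c01 x x' : 0 <= c x x' <= dm.
  rewrite /c mulr_ge0 ?invr_ge0 ?sumr_ge0 //= ler_pdivrMl //.
  have -> : n%:R * dm = \sum_(i < n) dm by rewrite sumr_const card_ord mulr_natl.
  exact: ler_sum.
have T1 : E (I1 + eps) / #|{: 'I_kA.+1 * 'I_kB.+1 * 'I_kC.+1}|%:R <= eta ^+ 2.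
  rewrite !card_prod !card_ord !natrM; apply: le_trans h2.
  rewrite ler_pdivrMr ?mulr_gt0 //.
  have -> : E (I1 + eps) = E (- eps) * (E (I1 - J1 + 6 * eps) * E (J1 - J2 - 2 * eps) *
      E (J2 - 2 * eps)) by rewrite !ED; congr E; ring.
  apply: ler_wpM2l; first exact: ltW.
  by apply: ler_pM; [apply: mulr_ge0; exact: ltW|exact: ltW|apply: ler_pM; exact: ltW|exact: ltW].
have T2 : E (I2 + eps) / #|{: 'I_kM.+1 * 'I_kK.+1}|%:R <= eta ^+ 2.
  rewrite !card_prod !card_ord !natrM; apply: le_trans h2.
  rewrite ler_pdivrMr ?mulr_gt0 //.
  have -> : E (I2 + eps) = E (- eps) * (E (I2 - J3 + 4 * eps) * E (J3 - 2 * eps)).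
    by rewrite !ED; congr E; ring.
  by apply: ler_wpM2l; [exact: ltW|apply: ler_pM; exact: ltW].
have Q1 : #|{: 'I_kB.+1 * 'I_kC.+1}|.-1%:R / E (J1 - eps) <= eta.
  rewrite card_prod !card_ord.
  (* Each of the three summands is at most [E (J1 - 2 * eps)], hence the tolerance [eta / 3]
     prepared above. *)
  have -> : (kB.+1 * kC.+1).-1 = (kB * kC + kB + kC)%N.
    by rewrite mulSn mulnS addSn /= addnC [(kB + _)%N]addnC.
  apply: (@le_trans _ _ (3 * E (- eps))).
    rewrite ler_pdivrMr // -mulrA ED.
    have -> : - eps + (J1 - eps) = J1 - 2 * eps by ring.
    rewrite !natrD natrM.
    have b1 : kB%:R * kC%:R <= E (J1 - 2 * eps).
      apply: (@le_trans _ _ (E (J1 - J2 - 2 * eps) * E (J2 - 2 * eps))).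
        by apply: ler_pM.
      by rewrite ED; apply: Ele; move: e0; lra.
    have b2 : kB%:R <= E (J1 - 2 * eps) by apply: (le_trans kB1); apply: Ele; lra.
    have b3 : kC%:R <= E (J1 - 2 * eps) by apply: (le_trans kC1); apply: Ele; lra.
    by move: b1 b2 b3; lra.
  by rewrite mulrC -ler_pdivlMr.
have small1 : E (- eps) <= eta by move: h3 eta0; rewrite /E; lra.
have Q2 : #|'I_kC.+1|.-1%:R / E (J2 - eps) <= eta.
  rewrite card_ord /=; apply: le_trans small1; rewrite ler_pdivrMr // ED.
  by have -> : - eps + (J2 - eps) = J2 - 2 * eps by ring.
have Q3 : #|'I_kK.+1|.-1%:R / E (J3 - eps) <= eta.
  rewrite card_ord /=; apply: le_trans small1; rewrite ler_pdivrMr // ED.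
  by have -> : - eps + (J3 - eps) = J3 - 2 * eps by ring.
have cpos k : (0 < #|'I_k.+1|)%N by rewrite card_ord.
have [fe [fd [f [g hfg]]]] := @oneshot R _ _ _ _ _ {ffun 'I_n -> Xh} (tensor n tc)
   'I_kA.+1 'I_kB.+1 'I_kC.+1 'I_kM.+1 'I_kK.+1 c dm
   (fun u v z => [ffun i => xh (u i) (v i) (z i)])
   (E (I1 + eps)) (E (I2 + eps)) (E (J1 - eps)) (E (J2 - eps)) (E (J3 - eps)) eta
   (cpos _) (cpos _) (cpos _) (cpos _) (cpos _) c01 dm0 (ltW (E0 _)) (ltW (E0 _))
   (E0 _) (E0 _) (E0 _) (ltW eta0) P1 P2 P3 P4 P5 T1 T2 Q1 Q2 Q3.
pose cd : Defs.code X Y Z Xh n kM.+1 kA.+1 #|{: 'I_kA.+1 * 'I_kB.+1}| :=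
  @Defs.Code X Y Z Xh n kM.+1 kA.+1 #|{: 'I_kA.+1 * 'I_kB.+1}| fe
   (fun y => enum_rank (fd y)) f (fun m j z => g m (enum_val j) z).
exists kM.+1, kA.+1, #|{: 'I_kA.+1 * 'I_kB.+1}|, cd.
have d8 : delta = 8 * eps by rewrite /eps; field.
have rA : kA.+1%:R <= E (I1 - J1 + 7 * eps).
  have -> : I1 - J1 + 7 * eps = (I1 - J1 + 6 * eps) + eps by ring.
  by apply: (@succ_le_pow2 n kA (I1 - J1 + 6 * eps)) => //; lra.
split.
- apply: (@le_trans _ _ (E (I2 - J3 + 4 * eps + eps))); last by apply: Ele; lra.
  by apply: (@succ_le_pow2 n kM (I2 - J3 + 4 * eps)) => //; lra.
- by apply: (le_trans rA); apply: Ele; lra.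
- rewrite card_prod !card_ord natrM.
  have -> : pow2 (n%:R * (I1 - J2 + delta)) = E (I1 - J1 + 7 * eps) * E (J1 - J2 + eps).
    by rewrite ED /E d8; congr (pow2 (_ * _)); ring.
  apply: ler_pM => //; apply: (@succ_le_pow2 n kB (J1 - J2)) => //; first lra.
  by apply: (le_trans kB1); apply: Ele; lra.
rewrite -(tensor_distortion n0).
apply: (@le_trans _ _ _ _ _ _ (lerD (lexx _) dmeta)).
apply: le_trans hfg; rewrite le_eqVlt; apply/orP; left; apply/eqP.
rewrite /exp_distortion /=; apply: eq_bigr => x _; apply: eq_bigr => y _; apply: eq_bigr => z _.
by rewrite big_split /= /c enum_rankK.
Qed.

End Achievability.

(** * Information quantities of the test channel *)

Section LawsByExpectation.
Variable R : realType.

Lemma rv_law_indic (Om T : finType) (P : Om -> R) (f : Om -> T) t :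
  rv_law P f t = \sum_w P w * (f w == t)%:R.
Proof.
rewrite /rv_law big_mkcond; apply: eq_bigr => w _.
by case: (_ == _); rewrite ?mulr1 ?mulr0.
Qed.

(** A law is identified by integrating arbitrary test functions, which avoids reindexing fibres. *)
Lemma rv_law_of_expect (Om T : finType) (P : Om -> R) (f : Om -> T) (L : T -> R) :
  (forall F, \sum_w P w * F (f w) = \sum_t L t * F t) -> forall t, rv_law P f t = L t.
Proof.
by move=> h t; rewrite rv_law_indic (h (fun s => (s == t)%:R)) sum_indicr.
Qed.

Lemma shannon_H_channelE (Om A B : finType) (P : Om -> R) (f : Om -> A) (g : Om -> B)
    (W : A -> B -> R) : (forall w, 0 <= P w) -> (forall a b, 0 <= W a b) ->
  (forall a b, rv_law P (fun w => (f w, g w)) (a, b) = rv_law P f a * W a b) ->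
  \sum_a \sum_b rv_law P f a * W a b * log2 (W a b) =
  shannon_H P f - shannon_H P (fun w => (f w, g w)).
Proof.
move=> P0 W0 h; rewrite (shannon_H_channel P0 W0 h) opprB addrC subrK.
rewrite (rv_law_expect P f (fun a => \sum_b W a b * log2 (W a b))).
by apply: eq_bigr => a _; rewrite mulr_sumr; apply: eq_bigr => b _; rewrite mulrA.
Qed.

(** Passes from the mean information density of a channel, the form in which rates come out of the
    coding argument, to entropies of the joint law, the form of [cmi]. *)
Lemma mi_entropy (Om A B : finType) (P : Om -> R) (f : Om -> A) (g : Om -> B)
    (W : A -> B -> R) : (forall w, 0 <= P w) -> (forall a b, 0 <= W a b) ->
  (forall a b, rv_law P (fun w => (f w, g w)) (a, b) = rv_law P f a * W a b) ->
  \sum_a \sum_b rv_law P f a * W a b * (log2 (W a b) - log2 (rv_law P g b)) =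
  shannon_H P f + shannon_H P g - shannon_H P (fun w => (f w, g w)).
Proof.
move=> P0 W0 h.
have -> : shannon_H P g = - \sum_a \sum_b rv_law P f a * W a b * log2 (rv_law P g b).
  rewrite exchange_big /shannon_H; congr (- _); apply: eq_bigr => b _.
  rewrite -mulr_suml; congr (_ * _).
  by rewrite -(rv_law_suml P f g); apply: eq_bigr => a _; rewrite h.
rewrite addrAC -(shannon_H_channelE P0 W0 h) -sumrB; apply: eq_bigr => a _.
by rewrite -sumrB; apply: eq_bigr => b _; rewrite mulrBr.
Qed.

Lemma cmi_entropy (Om V U X : finType) (P : Om -> R) (f : Om -> V) (k : Om -> U) (g : Om -> X)
    (W : V -> U -> X -> R) (W' : V -> X -> R) :
  (forall w, 0 <= P w) -> (forall v u x, 0 <= W v u x) -> (forall v x, 0 <= W' v x) ->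
  (forall v u x, rv_law P (fun w => (f w, k w, g w)) (v, u, x) =
     rv_law P (fun w => (f w, k w)) (v, u) * W v u x) ->
  (forall v x, rv_law P (fun w => (f w, g w)) (v, x) = rv_law P f v * W' v x) ->
  \sum_v \sum_u \sum_x rv_law P (fun w => (f w, k w)) (v, u) * W v u x *
     (log2 (W v u x) - log2 (W' v x)) =
  shannon_H P (fun w => (f w, k w)) - shannon_H P (fun w => (f w, k w, g w)) -
  (shannon_H P f - shannon_H P (fun w => (f w, g w))).
Proof.
move=> P0 W0 W'0 h h'.
rewrite -(shannon_H_channelE P0 W'0 h').
rewrite -(@shannon_H_channelE _ _ _ _ (fun w => (f w, k w)) g (fun vu x => W vu.1 vu.2 x)) //;
  last by move=> [v u] x; rewrite h.
rewrite sum_pair -sumrB; apply: eq_bigr => v _.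
have -> : \sum_x rv_law P f v * W' v x * log2 (W' v x) =
    \sum_u \sum_x rv_law P (fun w => (f w, k w)) (v, u) * W v u x * log2 (W' v x).
  rewrite exchange_big /=; apply: eq_bigr => x _.
  rewrite -mulr_suml; congr (_ * _).
  rewrite -h'; under [RHS]eq_bigr do rewrite -h.
  rewrite !rv_law_indic; under [RHS]eq_bigr do rewrite rv_law_indic.
  rewrite exchange_big /=; apply: eq_bigr => w _.
  rewrite -mulr_sumr; congr (_ * _).
  rewrite (eq_bigr (fun u => (u == k w)%:R * ((f w, g w) == (v, x))%:R)) ?sum_indic // => u _.
  by rewrite -natrM mulnb !xpair_eqE [u == _]eq_sym andbAC andbC.
rewrite -sumrB; apply: eq_bigr => u _; rewrite -sumrB; apply: eq_bigr => x _.
by rewrite mulrBr.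
Qed.

End LawsByExpectation.

Section Informations.
Variables (R : realType) (X Y Z U V : finType).
Variables (pXY : X -> Y -> R) (pZ : X -> Z -> R) (qV : Y -> V -> R) (qU : X -> V -> U -> R).
Hypothesis pXY_pmf : is_pmf (fun xy : X * Y => pXY xy.1 xy.2).
Hypothesis pZ_st : is_stoch pZ.
Hypothesis qV_st : is_stoch qV.
Hypothesis qU_st : is_stoch (fun xv : X * V => qU xv.1 xv.2).

Let P := fun o : X * Y * Z * V * U =>
  let: (x, y, z, v, u) := o in pXY x y * pZ x z * qV y v * qU x v u.
Let rX := fun o : X * Y * Z * V * U => o.1.1.1.1.
Let rY := fun o : X * Y * Z * V * U => o.1.1.1.2.
Let rZ := fun o : X * Y * Z * V * U => o.1.1.2.
Let rV := fun o : X * Y * Z * V * U => o.1.2.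
Let rU := fun o : X * Y * Z * V * U => o.2.

Let pXY0 x y : 0 <= pXY x y := pXY_pmf.1 (x, y).
Let pZ0 x z : 0 <= pZ x z := (pZ_st x).1 z.
Let qV0 y v : 0 <= qV y v := (qV_st y).1 v.
Let qU0 x v u : 0 <= qU x v u := (qU_st (x, v)).1 u.
Let qU1 x v : \sum_u qU x v u = 1 := (qU_st (x, v)).2.

Lemma joint_ge0 o : 0 <= P o.
Proof. by case: o => [[[[x y] z] v] u] /=; rewrite !mulr_ge0. Qed.

Lemma joint_expect (F : X * Y * Z * V * U -> R) : \sum_o P o * F o =
  \sum_x \sum_y pXY x y * \sum_z pZ x z * \sum_v qV y v * \sum_u qU x v u * F (x, y, z, v, u).
Proof.
rewrite !sum_pair.
apply: eq_bigr => x _; apply: eq_bigr => y _.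
rewrite mulr_sumr; apply: eq_bigr => z _.
rewrite mulrA mulr_sumr; apply: eq_bigr => v _.
by rewrite mulrA mulr_sumr; apply: eq_bigr => u _; rewrite mulrA.
Qed.

Lemma joint_sum1 : \sum_o P o = 1.
Proof.
under eq_bigr do rewrite -[P _]mulr1.
rewrite (joint_expect (fun=> 1)).
under eq_bigr do under eq_bigr do
  (under eq_bigr do (under eq_bigr do
    (under eq_bigr do rewrite mulr1; rewrite qU1 mulr1); rewrite (qV_st _).2 mulr1);
   rewrite (pZ_st _).2 mulr1).
by rewrite pair_bigA; exact: pXY_pmf.2.
Qed.

(** [k] reads y off the observation, and the chain V - Y - (X,Z) says that nothing else in it
    affects v. *)
Lemma joint_law_V (T : finType) (f : X -> Y -> Z -> T) (k : T -> Y) t v0 :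
  (forall x y z, k (f x y z) = y) ->
  rv_law P (fun o => (f (rX o) (rY o) (rZ o), rV o)) (t, v0) =
  rv_law P (fun o => f (rX o) (rY o) (rZ o)) t * qV (k t) v0.
Proof.
move=> kf; rewrite !rv_law_indic.
rewrite (joint_expect (fun o => ((f (rX o) (rY o) (rZ o), rV o) == (t, v0))%:R)).
rewrite (joint_expect (fun o => (f (rX o) (rY o) (rZ o) == t)%:R)) /rX /rY /rZ /rV /rU /=.
rewrite mulr_suml; apply: eq_bigr => x _; rewrite mulr_suml; apply: eq_bigr => y _.
rewrite -mulrA; congr (_ * _); rewrite mulr_suml; apply: eq_bigr => z _.
rewrite -mulrA; congr (_ * _).
under [LHS]eq_bigr do (rewrite -mulr_suml qU1 mul1r xpair_eqE -mulnb natrM mulrA).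
under [X in _ = X * _]eq_bigr do rewrite -mulr_suml qU1 mul1r.
rewrite sum_indicr -mulr_suml (qV_st y).2 mul1r mulrC.
by case: eqP => [<-|_]; rewrite ?mul0r // kf.
Qed.

Lemma joint_law_Z (T : finType) (f : X -> Y -> V -> U -> T) (k : T -> X) t z0 :
  (forall x y v u, k (f x y v u) = x) ->
  rv_law P (fun o => (f (rX o) (rY o) (rV o) (rU o), rZ o)) (t, z0) =
  rv_law P (fun o => f (rX o) (rY o) (rV o) (rU o)) t * pZ (k t) z0.
Proof.
move=> kf; rewrite !rv_law_indic.
rewrite (joint_expect (fun o => ((f (rX o) (rY o) (rV o) (rU o), rZ o) == (t, z0))%:R)).
rewrite (joint_expect (fun o => (f (rX o) (rY o) (rV o) (rU o) == t)%:R)) /rX /rY /rZ /rV /rU /=.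
rewrite mulr_suml; apply: eq_bigr => x _; rewrite mulr_suml; apply: eq_bigr => y _.
rewrite -mulrA; congr (_ * _).
rewrite -mulr_suml (pZ_st x).2 mul1r.
transitivity (\sum_z (pZ x z * \sum_v qV y v * \sum_u qU x v u * (f x y v u == t)%:R) *
   (z == z0)%:R).
  apply: eq_bigr => z _; rewrite -mulrA; congr (_ * _).
  rewrite mulr_suml; apply: eq_bigr => v _; rewrite -mulrA; congr (_ * _).
  rewrite mulr_suml; apply: eq_bigr => u _.
  by rewrite xpair_eqE -mulnb natrM mulrA.
rewrite sum_indicr mulrC !mulr_suml; apply: eq_bigr => v _.
rewrite -!mulrA; congr (_ * _); rewrite !mulr_suml; apply: eq_bigr => u _.
rewrite -!mulrA; congr (_ * _).
by case: eqP => [<-|_]; rewrite ?mul0r // kf.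
Qed.

Let H (T : finType) (f : X * Y * Z * V * U -> T) := shannon_H P f.

Let hV := - \sum_o P o * \sum_v qV (rY o) v * log2 (qV (rY o) v).
Let hZ := - \sum_o P o * \sum_z pZ (rX o) z * log2 (pZ (rX o) z).

(** The increment [hV] is H(V|Y), whatever else is observed along with Y; in the differences of
    entropies below it cancels. *)
Lemma entropy_add_V (T : finType) (f : X -> Y -> Z -> T) (k : T -> Y) :
  (forall x y z, k (f x y z) = y) ->
  H (fun o => (f (rX o) (rY o) (rZ o), rV o)) = H (fun o => f (rX o) (rY o) (rZ o)) + hV.
Proof.
move=> kf; rewrite /H (@shannon_H_channel _ _ _ joint_ge0 _ _
  (fun o => f (rX o) (rY o) (rZ o)) rV (fun t => qV (k t))) //; last first.
  by move=> t v; exact: joint_law_V.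
by congr (_ - _); apply: eq_bigr => o _; rewrite kf.
Qed.

Lemma entropy_add_Z (T : finType) (f : X -> Y -> V -> U -> T) (k : T -> X) :
  (forall x y v u, k (f x y v u) = x) ->
  H (fun o => (f (rX o) (rY o) (rV o) (rU o), rZ o)) =
  H (fun o => f (rX o) (rY o) (rV o) (rU o)) + hZ.
Proof.
move=> kf; rewrite /H (@shannon_H_channel _ _ _ joint_ge0 _ _
  (fun o => f (rX o) (rY o) (rV o) (rU o)) rZ (fun t => pZ (k t))) //; last first.
  by move=> t v; exact: joint_law_Z.
by congr (_ - _); apply: eq_bigr => o _; rewrite kf.
Qed.

Let Heq (A B : finType) (f : X * Y * Z * V * U -> A) (g : X * Y * Z * V * U -> B) :
  (forall w w', g w' = g w -> f w' = f w) ->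
  (forall w w', f w' = f w -> g w' = g w) -> H f = H g.
Proof. exact: (shannon_H_eq joint_ge0). Qed.

Lemma cmi_VYZ : cmi P rV rY rZ =
  (H rV + H rY - H (fun o => (rV o, rY o))) - (H rV + H rZ - H (fun o => (rV o, rZ o))).
Proof.
rewrite /cmi -!/(H _).
rewrite (@Heq _ _ (fun o => (rV o, rY o, rZ o)) (fun o => ((rY o, rZ o), rV o)));
  [| by move=> w w' [-> -> ->] | by move=> w w' [-> -> ->]].
rewrite (@Heq _ _ (fun o => (rV o, rY o)) (fun o => (rY o, rV o)));
  [| by move=> w w' [-> ->] | by move=> w w' [-> ->]].
rewrite (@entropy_add_V _ (fun _ y z => (y, z)) fst) //.
rewrite (@entropy_add_V _ (fun _ y _ => y) id) //; ring.
Qed.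

Lemma cmi_YVZ : cmi P rY rV rZ = cmi P rV rY rZ.
Proof.
rewrite /cmi -!/(H _).
rewrite (@Heq _ _ (fun o => (rV o, rY o, rZ o)) (fun o => (rY o, rV o, rZ o)));
  [| by move=> w w' [-> -> ->] | by move=> w w' [-> -> ->]].
ring.
Qed.

Lemma cmi_VXZ : cmi P rV rX rZ =
  (H rV + H rX - H (fun o => (rV o, rX o))) - (H rV + H rZ - H (fun o => (rV o, rZ o))).
Proof.
rewrite /cmi -!/(H _).
rewrite (@entropy_add_Z _ (fun x _ v _ => (v, x)) snd) //.
rewrite (@entropy_add_Z _ (fun x _ _ _ => x) id) //; ring.
Qed.

Lemma cmi_VYX : cmi P rV rY rX =
  (H rV + H rY - H (fun o => (rV o, rY o))) - (H rV + H rX - H (fun o => (rV o, rX o))).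
Proof.
rewrite /cmi -!/(H _).
rewrite (@Heq _ _ (fun o => (rV o, rY o, rX o)) (fun o => ((rY o, rX o), rV o)));
  [| by move=> w w' [-> -> ->] | by move=> w w' [-> -> ->]].
rewrite (@Heq _ _ (fun o => (rV o, rY o)) (fun o => (rY o, rV o)));
  [| by move=> w w' [-> ->] | by move=> w w' [-> ->]].
rewrite (@entropy_add_V _ (fun x y _ => (y, x)) fst) //.
rewrite (@entropy_add_V _ (fun _ y _ => y) id) //; ring.
Qed.

Lemma mi_VZ_ge0 : 0 <= H rV + H rZ - H (fun o => (rV o, rZ o)).
Proof. by rewrite subr_ge0; exact: (shannon_H_subadd joint_ge0 joint_sum1). Qed.

Lemma cmi_XU : cmi P rX rU (fun o => (rV o, rZ o)) =
  (H (fun o => (rV o, rU o)) - H (fun o => (rV o, rU o, rX o)) -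
     (H rV - H (fun o => (rV o, rX o)))) -
  (H (fun o => (rV o, rU o)) - H (fun o => (rV o, rU o, rZ o)) -
     (H rV - H (fun o => (rV o, rZ o)))).
Proof.
rewrite /cmi -!/(H _).
rewrite (@Heq _ _ (fun o => (rX o, (rV o, rZ o))) (fun o => ((rV o, rX o), rZ o)));
  [| by move=> w w' [-> -> ->] | by move=> w w' [-> -> ->]].
rewrite (@Heq _ _ (fun o => (rU o, (rV o, rZ o))) (fun o => ((rV o, rU o), rZ o)));
  [| by move=> w w' [-> -> ->] | by move=> w w' [-> -> ->]].
rewrite (@Heq _ _ (fun o => (rX o, rU o, (rV o, rZ o))) (fun o => ((rV o, rU o, rX o), rZ o)));
  [| by move=> w w' [-> -> -> ->] | by move=> w w' [-> -> -> ->]].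
rewrite (@entropy_add_Z _ (fun x _ v _ => (v, x)) snd) //.
rewrite (@entropy_add_Z _ (fun x _ v u => (v, u, x)) snd) //; ring.
Qed.

End Informations.

(** * Achievability of the triple of part (1) *)

Section PartOne.
Variables (R : realType) (X Y Z Xh U V : finType).
Variables (pXY : X -> Y -> R) (pZ : X -> Z -> R) (d : X -> Xh -> R).
Variables (qV : Y -> V -> R) (qU : X -> V -> U -> R) (xh : U -> V -> Z -> Xh).
Hypothesis pXY_pmf : is_pmf (fun xy : X * Y => pXY xy.1 xy.2).
Hypothesis pZ_st : is_stoch pZ.
Hypothesis qV_st : is_stoch qV.
Hypothesis qU_st : is_stoch (fun xv : X * V => qU xv.1 xv.2).

Let P := fun o : X * Y * Z * V * U =>
  let: (x, y, z, v, u) := o in pXY x y * pZ x z * qV y v * qU x v u.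
Let rX := fun o : X * Y * Z * V * U => o.1.1.1.1.
Let rY := fun o : X * Y * Z * V * U => o.1.1.1.2.
Let rZ := fun o : X * Y * Z * V * U => o.1.1.2.
Let rV := fun o : X * Y * Z * V * U => o.1.2.
Let rU := fun o : X * Y * Z * V * U => o.2.

Let P0 : forall o, 0 <= P o := joint_ge0 pXY_pmf pZ_st qV_st qU_st.
Let PE := joint_expect pXY pZ qV qU.

(** Bayes' rule reverses the given kernels: [r] is Y -> X, [a] is V -> Y and [g] is (V,U) -> X. The
    test functions [F] then identify the laws of (V,Y) and (V,U,X,Z) with the original ones. *)
Lemma test_channel_of_kernels : exists tc : test_channel R X Y Z U V,
  [/\ tcXY tc = pXY, tcZ tc = pZ,
    forall F : V -> Y -> R, \sum_o P o * F (rV o) (rY o) =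
      \sum_v tcV tc v * \sum_y tcVY tc v y * F v y &
    forall F : V -> U -> X -> Z -> R, \sum_o P o * F (rV o) (rU o) (rX o) (rZ o) =
      \sum_v tcV tc v * \sum_u tcVU tc v u * \sum_x tcVUX tc v u x *
        \sum_z tcZ tc x z * F v u x z].
Proof.
have [[x0 y0] _] := pmf_support pXY_pmf.
have pXY0 x y : 0 <= pXY x y := pXY_pmf.1 (x, y).
have qU0 x v u : 0 <= qU x v u := (qU_st (x, v)).1 u.
have qU1 x v : \sum_u qU x v u = 1 := (qU_st (x, v)).2.
pose pY y := \sum_x pXY x y.
have pY0 y : 0 <= pY y by apply: sumr_ge0.
have [r [rst rE]] := @reverse_kernel R Y X (fun y x => pXY x y) x0 (fun y x => pXY0 x y).
have qV0 y v : 0 <= qV y v := (qV_st y).1 v.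
have [a [ast aE]] := @reverse_kernel R V Y (fun v y => pY y * qV y v) y0
  (fun v y => mulr_ge0 (pY0 y) (qV0 y v)).
pose pV v := \sum_y pY y * qV y v.
have pV_pmf : is_pmf pV.
  split=> [v|]; first by apply: sumr_ge0 => y _; rewrite mulr_ge0.
  rewrite /pV exchange_big /=; under eq_bigr do rewrite -mulr_sumr (qV_st _).2 mulr1.
  by rewrite /pY exchange_big /= pair_bigA; exact: pXY_pmf.2.
pose h v x := \sum_y a v y * r y x.
have h0 v x : 0 <= h v x.
  by apply: sumr_ge0 => y _; rewrite mulr_ge0 ?(ast v).1 ?(rst y).1.
have h1 v : \sum_x h v x = 1.
  rewrite /h exchange_big /=; under eq_bigr do rewrite -mulr_sumr (rst _).2 mulr1.
  exact: (ast v).2.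
have [g0 [gst0 gE0]] := @reverse_kernel R (V * U)%type X (fun vu x => h vu.1 x * qU x vu.1 vu.2) x0
  (fun vu x => mulr_ge0 (h0 vu.1 x) (qU0 x vu.1 vu.2)).
pose b v u := \sum_x h v x * qU x v u.
pose g v u x := g0 (v, u) x.
have gE v u x : h v x * qU x v u = b v u * g v u x := gE0 (v, u) x.
have bst : is_stoch b.
  move=> v; split=> [u|]; first by apply: sumr_ge0 => x _; rewrite mulr_ge0.
  by rewrite /b exchange_big /=; under eq_bigr do rewrite -mulr_sumr qU1 mulr1.
(* The composite [h] of [a] and [r] is the true law of X given V because V - Y - X is a Markov
   chain. *)
have pVh v x : pV v * h v x = \sum_y pXY x y * qV y v.
  rewrite mulr_sumr; apply: eq_bigr => y _.
  by rewrite mulrA -aE (rE y x) mulrAC.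
pose tc : test_channel R X Y Z U V := @TestChannel R X Y Z U V pXY pZ pV a r b g pY
  (fun x => \sum_v pV v * h v x) (fun z => \sum_v pV v * \sum_x h v x * pZ x z) h
  (fun v z => \sum_x h v x * pZ x z) (fun v u z => \sum_x g v u x * pZ x z)
  (fun x y => rE y x)
  (fun y => etrans (esym (etrans (eq_bigr _ (fun v _ => esym (aE v y)))
      (etrans (esym (mulr_sumr _ _ _ _)) (etrans (congr1 _ (qV_st y).2) (mulr1 _))))) erefl)
  pV_pmf ast rst bst (fun v u => gst0 (v, u)) pZ_st (fun v x => erefl)
  (fun v x => etrans (esym (etrans (esym (mulr_sumr _ _ _ _)) (etrans (congr1 _ (qU1 x v)) (mulr1 _))))
     (eq_bigr _ (fun u _ => gE v u x)))
  (fun v z => erefl) (fun v u z => erefl) (fun x => erefl) (fun z => erefl).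
exists tc; split=> // F.
  rewrite (PE (fun o => F (rV o) (rY o))) /rX /rY /rZ /rV /rU /=.
  transitivity (\sum_x \sum_y pXY x y * \sum_v qV y v * F v y).
    apply: eq_bigr => x _; apply: eq_bigr => y _; congr (_ * _).
    rewrite -mulr_suml (pZ_st x).2 mul1r; apply: eq_bigr => v _; congr (_ * _).
    by rewrite -mulr_suml qU1 mul1r.
  rewrite exchange_big /=; under [LHS]eq_bigr do rewrite -mulr_suml mulr_sumr.
  rewrite exchange_big /=; apply: eq_bigr => v _; rewrite mulr_sumr; apply: eq_bigr => y _.
  by rewrite mulrA aE mulrA.
rewrite (PE (fun o => F (rV o) (rU o) (rX o) (rZ o))) /rX /rY /rZ /rV /rU /=.
transitivity (\sum_x \sum_v pV v * h v x * \sum_u qU x v u * \sum_z pZ x z * F v u x z).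
  apply: eq_bigr => x _.
  under [RHS]eq_bigr do rewrite pVh mulr_suml.
  rewrite exchange_big /=; apply: eq_bigr => y _.
  under [RHS]eq_bigr do rewrite -mulrA.
  rewrite -mulr_sumr; congr (_ * _).
  under [LHS]eq_bigr do rewrite mulr_sumr.
  rewrite exchange_big /=; apply: eq_bigr => v _.
  under [LHS]eq_bigr do rewrite mulrCA.
  rewrite -mulr_sumr; congr (_ * _).
  under [LHS]eq_bigr do rewrite mulr_sumr.
  rewrite exchange_big /=; apply: eq_bigr => u _.
  under [LHS]eq_bigr do rewrite mulrCA.
  by rewrite -mulr_sumr.
rewrite exchange_big /=; apply: eq_bigr => v _.
under [LHS]eq_bigr do rewrite -mulrA.
rewrite -mulr_sumr; congr (_ * _).
under [LHS]eq_bigr do rewrite mulr_sumr.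
rewrite exchange_big /=; apply: eq_bigr => u _.
rewrite mulr_sumr; apply: eq_bigr => x _.
by rewrite !mulrA gE.
Qed.

Lemma part_one (D Re : R) : (forall x x', 0 <= d x x') ->
  rv_expect P (fun o => d (rX o) (xh (rU o) (rV o) (rZ o))) <= D ->
  cmi P rV rY rZ - cmi P rV rX rZ <= Re ->
  RgO pXY pZ d D (cmi P rX rU (fun o => (rV o, rZ o))) Re (cmi P rY rV rZ).
Proof.
move=> d0 hD hRe.
have [tc [tcXYE' tcZE' EVY EVUXZ]] := test_channel_of_kernels.
have VX_sum v x : tcVX tc v x = \sum_u tcVU tc v u * tcVUX tc v u x := tcVXE' tc v x.
have lawVUX v u x : rv_law P (fun o => (rV o, rU o, rX o)) (v, u, x) =
    tcV tc v * tcVU tc v u * tcVUX tc v u x.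
  apply: (@rv_law_of_expect _ _ _ _ _
    (fun t : V * U * X => tcV tc t.1.1 * tcVU tc t.1.1 t.1.2 * tcVUX tc t.1.1 t.1.2 t.2)) => F.
  rewrite (EVUXZ (fun v u x z => F (v, u, x))) !sum_pair /=.
  apply: eq_bigr => v1 _; rewrite mulr_sumr; apply: eq_bigr => u1 _.
  rewrite mulrA mulr_sumr; apply: eq_bigr => x1 _.
  by rewrite -mulr_suml (tcZ_stoch tc x1).2 mul1r mulrA.
have lawVUZ v u z : rv_law P (fun o => (rV o, rU o, rZ o)) (v, u, z) =
    tcV tc v * tcVU tc v u * tcVUZ tc v u z.
  apply: (@rv_law_of_expect _ _ _ _ _
    (fun t : V * U * Z => tcV tc t.1.1 * tcVU tc t.1.1 t.1.2 * tcVUZ tc t.1.1 t.1.2 t.2)) => F.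
  rewrite (EVUXZ (fun v u x z => F (v, u, z))) !sum_pair /=.
  apply: eq_bigr => v1 _; rewrite mulr_sumr; apply: eq_bigr => u1 _.
  rewrite mulrA; under [RHS]eq_bigr do rewrite -mulrA.
  rewrite -mulr_sumr; congr (_ * _).
  under [LHS]eq_bigr do rewrite mulr_sumr.
  rewrite exchange_big /=; apply: eq_bigr => z1 _.
  rewrite tcVUZE mulr_suml; by apply: eq_bigr => x1 _; rewrite mulrA.
have lawVU v u : rv_law P (fun o => (rV o, rU o)) (v, u) = tcV tc v * tcVU tc v u.
  rewrite -(rv_law_sumr P (fun o => (rV o, rU o)) rX (v, u)).
  under eq_bigr do rewrite lawVUX.
  by rewrite -mulr_sumr (tcVUX_stoch tc v u).2 mulr1.
have lawV v : rv_law P rV v = tcV tc v.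
  rewrite -(rv_law_sumr P rV rU v); under eq_bigr do rewrite lawVU.
  by rewrite -mulr_sumr (tcVU_stoch tc v).2 mulr1.
have lawVY v y : rv_law P (fun o => (rV o, rY o)) (v, y) = tcV tc v * tcVY tc v y.
  apply: (@rv_law_of_expect _ _ _ _ _ (fun t : V * Y => tcV tc t.1 * tcVY tc t.1 t.2)) => F.
  rewrite (EVY (fun v y => F (v, y))) sum_pair /=.
  by apply: eq_bigr => v1 _; rewrite mulr_sumr; apply: eq_bigr => y1 _; rewrite mulrA.
have lawVX v x : rv_law P (fun o => (rV o, rX o)) (v, x) = tcV tc v * tcVX tc v x.
  apply: (@rv_law_of_expect _ _ _ _ _ (fun t : V * X => tcV tc t.1 * tcVX tc t.1 t.2)) => F.
  rewrite (EVUXZ (fun v u x z => F (v, x))) sum_pair /=.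
  apply: eq_bigr => v1 _; under [RHS]eq_bigr do rewrite -mulrA.
  rewrite -mulr_sumr; congr (_ * _).
  under [LHS]eq_bigr do rewrite mulr_sumr.
  rewrite exchange_big /=; apply: eq_bigr => x1 _.
  rewrite tcVXE' mulr_suml; apply: eq_bigr => u1 _.
  by rewrite -mulr_suml (tcZ_stoch tc x1).2 mul1r mulrA.
have lawX x : rv_law P rX x = tcX_marg tc x.
  by rewrite -(rv_law_suml P rV rX x) tcXE; apply: eq_bigr => v _; rewrite lawVX.
have lawY y : rv_law P rY y = tcY_marg tc y.
  by rewrite -(rv_law_suml P rV rY y) tcYE; apply: eq_bigr => v _; rewrite lawVY.
have VUZ_sum v z : tcVZ tc v z = \sum_u tcVU tc v u * tcVUZ tc v u z.
  rewrite tcVZE; under [RHS]eq_bigr do rewrite tcVUZE mulr_sumr.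
  rewrite exchange_big /=; apply: eq_bigr => x _.
  by rewrite tcVXE' mulr_suml; apply: eq_bigr => u _; rewrite mulrA.
have lawVZ v z : rv_law P (fun o => (rV o, rZ o)) (v, z) = tcV tc v * tcVZ tc v z.
  transitivity (\sum_u rv_law P (fun o => (rV o, rU o, rZ o)) (v, u, z)).
    rewrite -(rv_law_sumr P (fun o => (rV o, rZ o)) rU (v, z)); apply: eq_bigr => u _.
    rewrite /rv_law; apply: eq_bigl => o; rewrite !xpair_eqE.
    by rewrite andbAC.
  rewrite VUZ_sum mulr_sumr; apply: eq_bigr => u _; by rewrite lawVUZ mulrA.
have lawZ z : rv_law P rZ z = tcZ_marg tc z.
  by rewrite -(rv_law_suml P rV rZ z) tcZE; apply: eq_bigr => v _; rewrite lawVZ.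
have I1 : tcI_VY tc = shannon_H P rV + shannon_H P rY - shannon_H P (fun o => (rV o, rY o)).
  rewrite -(@mi_entropy _ _ _ _ _ _ _ (tcVY tc) P0 (fun v => (tcVY_stoch tc v).1)) => [|v y].
    by apply: eq_bigr => v _; apply: eq_bigr => y _; rewrite lawV lawY.
  by rewrite lawVY lawV.
have J1 : tcI_VX tc = shannon_H P rV + shannon_H P rX - shannon_H P (fun o => (rV o, rX o)).
  rewrite -(@mi_entropy _ _ _ _ _ _ _ (tcVX tc) P0 (fun v => (tcVX_pmf tc v).1)) => [|v x].
    by apply: eq_bigr => v _; apply: eq_bigr => x _; rewrite lawV lawX.
  by rewrite lawVX lawV.
have J2 : tcI_VZ tc = shannon_H P rV + shannon_H P rZ - shannon_H P (fun o => (rV o, rZ o)).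
  rewrite -(@mi_entropy _ _ _ _ _ _ _ (tcVZ tc) P0 (fun v => (tcVZ_pmf tc v).1)) => [|v z].
    by apply: eq_bigr => v _; apply: eq_bigr => z _; rewrite lawV lawZ.
  by rewrite lawVZ lawV.
have I2 : tcI_UX tc = shannon_H P (fun o => (rV o, rU o)) -
    shannon_H P (fun o => (rV o, rU o, rX o)) -
    (shannon_H P rV - shannon_H P (fun o => (rV o, rX o))).
  rewrite -(@cmi_entropy _ _ _ _ _ _ _ _ _ (tcVUX tc) (tcVX tc) P0
     (fun v u => (tcVUX_stoch tc v u).1) (fun v => (tcVX_pmf tc v).1)) => [|v u t|v t].
  - apply: eq_bigr => v _; apply: eq_bigr => u _; apply: eq_bigr => t _.
    by rewrite lawVU.
  - by rewrite lawVUX lawVU.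
  - by rewrite lawVX lawV.
have J3 : tcI_UZ tc = shannon_H P (fun o => (rV o, rU o)) -
    shannon_H P (fun o => (rV o, rU o, rZ o)) -
    (shannon_H P rV - shannon_H P (fun o => (rV o, rZ o))).
  rewrite -(@cmi_entropy _ _ _ _ _ _ _ _ _ (tcVUZ tc) (tcVZ tc) P0
     (fun v u => (tcVUZ_pmf tc v u).1) (fun v => (tcVZ_pmf tc v).1)) => [|v u t|v t].
  - apply: eq_bigr => v _; apply: eq_bigr => u _; apply: eq_bigr => t _.
    by rewrite lawVU.
  - by rewrite lawVUZ lawVU.
  - by rewrite lawVZ lawV.
have eVYZ : cmi P rV rY rZ = tcI_VY tc - tcI_VZ tc.
  by rewrite I1 J2; exact: cmi_VYZ pXY_pmf pZ_st qV_st qU_st.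
have eVXZ : cmi P rV rX rZ = tcI_VX tc - tcI_VZ tc.
  by rewrite J1 J2; exact: cmi_VXZ pXY_pmf pZ_st qV_st qU_st.
have eVYX : cmi P rV rY rX = tcI_VY tc - tcI_VX tc.
  by rewrite I1 J1; exact: cmi_VYX pXY_pmf pZ_st qV_st qU_st.
have eXU : cmi P rX rU (fun o => (rV o, rZ o)) = tcI_UX tc - tcI_UZ tc.
  by rewrite I2 J3; exact: cmi_XU pXY_pmf pZ_st qV_st qU_st.
have eYVZ : cmi P rY rV rZ = tcI_VY tc - tcI_VZ tc.
  by rewrite -eVYZ; exact: cmi_YVZ pXY_pmf pZ_st qV_st qU_st.
(* Data processing along V - Y - X - Z: each gap between consecutive informations is itself a
   conditional information. *)
have c1 : 0 <= tcI_VZ tc by rewrite J2; exact: mi_VZ_ge0 pXY_pmf pZ_st qV_st qU_st.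
have c2 : tcI_VZ tc <= tcI_VX tc by rewrite -subr_ge0 -eVXZ cmi_ge0.
have c3 : tcI_VX tc <= tcI_VY tc by rewrite -subr_ge0 -eVYX cmi_ge0.
have c4 : tcI_UZ tc <= tcI_UX tc by rewrite -subr_ge0 -eXU cmi_ge0.
have dist : tc_distortion tc d xh <= D.
  rewrite /tc_distortion -(EVUXZ (fun v u x z => d x (xh u v z))); exact: hD.
rewrite eXU eYVZ => e e0.
(* The triple is itself achievable, so it serves as its own approximation; a larger [Re] only
   relaxes one constraint. *)
exists (tcI_UX tc - tcI_UZ tc), Re, (tcI_VY tc - tcI_VZ tc).
split; last by rewrite !subrr normr0.
move=> delta del0.
have [N hN] := tc_achievable xh d0 c1 c2 c3 c4 del0.
exists N => n /hN [M [Me [Md [c [h1 h2 h3 h4]]]]].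
exists M, Me, Md, c; split => //.
  apply: (le_trans h2); rewrite ler_pow2 ler_wpM2l // lerD2r.
  by move: hRe; rewrite eVYZ eVXZ; lra.
by rewrite -tcXYE' -tcZE' (le_trans h4) // lerD2r.
Qed.

End PartOne.

(** * Converse *)

Section EqualLaws.
Variable R : realType.

Lemma eq_shannon_H (Om Om' T : finType) (P : Om -> R) (P' : Om' -> R) (f : Om -> T) (f' : Om' -> T) :
  (forall t, rv_law P f t = rv_law P' f' t) -> shannon_H P f = shannon_H P' f'.
Proof. by move=> h; rewrite /shannon_H; congr (- _); apply: eq_bigr => t _; rewrite h. Qed.

Lemma rv_law_comp (Om T S : finType) (P : Om -> R) (f : Om -> T) (k : T -> S) s :
  rv_law P (fun w => k (f w)) s = rv_law (rv_law P f) k s.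
Proof.
rewrite !rv_law_indic (rv_law_expect P f (fun t => (k t == s)%:R)).
by apply: eq_bigr.
Qed.

Lemma eq_rv_law_comp (Om Om' T S : finType) (P : Om -> R) (P' : Om' -> R)
    (f : Om -> T) (f' : Om' -> T) (k : T -> S) :
  (forall t, rv_law P f t = rv_law P' f' t) ->
  forall s, rv_law P (fun w => k (f w)) s = rv_law P' (fun w => k (f' w)) s.
Proof.
by move=> h s; rewrite (rv_law_comp P f k) (rv_law_comp P' f' k) /rv_law; apply: eq_bigr => t _; exact: h.
Qed.

Lemma eq_cmi (Om Om' A B C : finType) (P : Om -> R) (P' : Om' -> R)
    (fA : Om -> A) (fB : Om -> B) (fC : Om -> C)
    (fA' : Om' -> A) (fB' : Om' -> B) (fC' : Om' -> C) :
  (forall t, rv_law P (fun w => (fA w, fB w, fC w)) t =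
             rv_law P' (fun w => (fA' w, fB' w, fC' w)) t) ->
  cmi P fA fB fC = cmi P' fA' fB' fC'.
Proof.
move=> h; rewrite /cmi; congr (_ + _ - _ - _); apply: eq_shannon_H => //.
- exact: (eq_rv_law_comp (fun t : A * B * C => (t.1.1, t.2)) h).
- exact: (eq_rv_law_comp (fun t : A * B * C => (t.1.2, t.2)) h).
- exact: (eq_rv_law_comp (fun t : A * B * C => t.2) h).
Qed.

Lemma eq_rv_law_expect (Om Om' T : finType) (P : Om -> R) (P' : Om' -> R)
    (f : Om -> T) (f' : Om' -> T) :
  (forall F : T -> R, \sum_w P w * F (f w) = \sum_w P' w * F (f' w)) ->
  forall t, rv_law P f t = rv_law P' f' t.
Proof. by move=> h t; rewrite !rv_law_indic (h (fun s => (s == t)%:R)). Qed.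

End EqualLaws.

(** * Auxiliary variables as functions of the source and of independent randomness *)

Section FunctionalRepresentation.
Variables (R : realType) (X Y Z Xh : finType).
Variables (pXY : X -> Y -> R) (pZ : X -> Z -> R) (d : X -> Xh -> R).
Hypothesis pXY_pmf : is_pmf (fun xy : X * Y => pXY xy.1 xy.2).
Hypothesis pZ_st : is_stoch pZ.

Variables (A U W : finType) (q : A -> R) (u : Y -> A -> U) (w : X -> Y -> A -> W).
Variable xh : U -> W -> Z -> Xh.
Hypothesis q_pmf : is_pmf q.

Definition source_with (o : X * Y * Z * A) : R :=
  let: (x, y, z, a) := o in pXY x y * pZ x z * q a.

Lemma source_with_expect (F : X -> Y -> Z -> A -> R) :
  \sum_o source_with o * F o.1.1.1 o.1.1.2 o.1.2 o.2 =
  \sum_x \sum_y \sum_z pXY x y * pZ x z * \sum_a q a * F x y z a.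
Proof.
rewrite !sum_pair /=; do 3 (apply: eq_bigr => ? _).
by rewrite mulr_sumr; apply: eq_bigr => ? _; rewrite mulrA.
Qed.

(* Averaging the dependence of W on Y out is harmless because Z - X - Y is a Markov chain. *)
Lemma RYXZ_of_functions (D Rr R1 : R) :
  let rU := fun o : X * Y * Z * A => u o.1.1.2 o.2 in
  let rW := fun o : X * Y * Z * A => w o.1.1.1 o.1.1.2 o.2 in
  rv_expect source_with (fun o => d o.1.1.1 (xh (rU o) (rW o) o.1.2)) <= D ->
  cmi source_with rU (fun o => o.1.1.2) (fun o => o.1.2) <= R1 ->
  cmi source_with (fun o => o.1.1.1) rW (fun o => (rU o, o.1.2)) <= Rr ->
  RYXZ pXY pZ d D Rr R1.
Proof.
move=> rU rW hD h1 hr.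
have pXY0 x y : 0 <= pXY x y := pXY_pmf.1 (x, y).
have q0 := q_pmf.1.
have [[x0 y0] _] := pmf_support pXY_pmf; have [a0 _] := pmf_support q_pmf.
pose qU y := rv_law q (u y).
have qU_st : is_stoch qU.
  by move=> y; split=> [u'|]; [exact: rv_law_ge0|rewrite rv_law_sum q_pmf.2].
(* The mass of (X,U,W) in the functional model; its disintegration along W is the kernel [qW], in
   which y is averaged out. *)
pose F x u' w' := \sum_y pXY x y * rv_law q (fun a => (u y a, w x y a)) (u', w').
have F0 x u' w' : 0 <= F x u' w'.
  by apply: sumr_ge0 => y _; rewrite mulr_ge0 // rv_law_ge0.
have [qW0 [qW_st qWE0]] := @reverse_kernel R (X * U)%type W (fun xu w' => F xu.1 xu.2 w')
   (w x0 y0 a0) (fun xu w' => F0 xu.1 xu.2 w').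
pose qW x u' w' := qW0 (x, u') w'.
have qW1 x u' : \sum_w' qW x u' w' = 1 := (qW_st (x, u')).2.
have FE x u' w' : F x u' w' = (\sum_y pXY x y * qU y u') * qW x u' w'.
  rewrite (qWE0 (x, u') w') /=; congr (_ * _).
  rewrite /F exchange_big /=; apply: eq_bigr => y _.
  by rewrite -mulr_sumr rv_law_sumr.
exists U, W, qU, qW, xh; set P := fun o : X * Y * Z * U * W => _.
have PE (G : X * Y * Z * U * W -> R) : \sum_o P o * G o =
    \sum_x \sum_y \sum_z pXY x y * pZ x z * \sum_u' qU y u' *
      \sum_w' qW x u' w' * G (x, y, z, u', w').
  rewrite !sum_pair; do 3 (apply: eq_bigr => ? _).
  rewrite mulr_sumr; apply: eq_bigr => u' _.
  by rewrite mulrA mulr_sumr; apply: eq_bigr => w' _; rewrite mulrA.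
(* The region sees only the laws of (U,Y,Z) and of (X,W,U,Z); these are preserved, although the law
   of (Y,W) may change. *)
have E1 (G : U * Y * Z -> R) : \sum_o P o * G (o.1.2, o.1.1.1.2, o.1.1.2) =
    \sum_o source_with o * G (rU o, o.1.1.2, o.1.2).
  rewrite (PE (fun o => G (o.1.2, o.1.1.1.2, o.1.1.2))) /=.
  rewrite (source_with_expect (fun x y z a => G (u y a, y, z))).
  do 3 (apply: eq_bigr => ? _); congr (_ * _).
  rewrite (rv_law_expect q (u _) (fun u' => G (u', _, _))).
  by apply: eq_bigr => u' _; rewrite -mulr_suml qW1 mul1r.
have E2 (G : X * W * (U * Z) -> R) :
    \sum_o P o * G (o.1.1.1.1, o.2, (o.1.2, o.1.1.2)) =
    \sum_o source_with o * G (o.1.1.1, rW o, (rU o, o.1.2)).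
  rewrite (PE (fun o => G (o.1.1.1.1, o.2, (o.1.2, o.1.1.2)))) /=.
  rewrite (source_with_expect (fun x y z a => G (x, w x y a, (u y a, z)))).
  apply: eq_bigr => x _; rewrite exchange_big [RHS]exchange_big /=.
  apply: eq_bigr => z _.
  transitivity (pZ x z * \sum_u' \sum_w' F x u' w' * G (x, w', (u', z))).
    under [LHS]eq_bigr do rewrite [pXY _ _ * _]mulrC -mulrA mulr_sumr.
    rewrite -mulr_sumr; congr (_ * _); rewrite exchange_big /=; apply: eq_bigr => u' _.
    under [RHS]eq_bigr do rewrite FE -mulrA.
    rewrite -mulr_sumr mulr_suml; apply: eq_bigr => y _; by rewrite mulrA.
  under [RHS]eq_bigr do rewrite [pXY _ _ * _]mulrC -mulrA.
  rewrite -mulr_sumr; congr (_ * _).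
  under [RHS]eq_bigr do rewrite (rv_law_expect q (fun a => (u _ a, w x _ a))
     (fun uw => G (x, uw.2, (uw.1, z)))) sum_pair /= mulr_sumr.
  rewrite [RHS]exchange_big /=; apply: eq_bigr => u' _.
  under [RHS]eq_bigr do rewrite mulr_sumr.
  rewrite [RHS]exchange_big /=; apply: eq_bigr => w' _.
  by rewrite mulr_suml; apply: eq_bigr => y _; rewrite mulrA.
split.
- exact: qU_st.
- by move=> [x u']; exact: qW_st.
- apply: le_trans hD; rewrite le_eqVlt; apply/orP; left; apply/eqP.
  rewrite /rv_expect -(E2 (fun t => d t.1.1 (xh t.2.1 t.1.2 t.2.2))) /=.
  by apply: eq_bigr => -[[[[x y] z] u'] w'] _.
- apply: le_trans h1; rewrite le_eqVlt; apply/orP; left; apply/eqP.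
  by apply: eq_cmi; apply: eq_rv_law_expect => G; exact: E1.
- apply: le_trans hr; rewrite le_eqVlt; apply/orP; left; apply/eqP.
  by apply: eq_cmi; apply: eq_rv_law_expect => G; exact: E2.
Qed.

End FunctionalRepresentation.

(** By the chain rule the difference is the information between [g] and [m] given [f] and [a]. *)
Lemma cmi_le_fun (R : realType) (Om A B C D : finType) (P : Om -> R) (f : Om -> A) (g : Om -> B)
    (m : Om -> C) (a : Om -> D) : (forall w, 0 <= P w) ->
  (forall w w', g w' = g w -> f w' = f w) -> cmi P f m a <= cmi P g m a.
Proof.
move=> P0 fg; have := cmi_ge0 P0 g m (fun w => (f w, a w)); rewrite /cmi.
rewrite (@shannon_H_eq _ _ _ P0 _ _ (fun w => (g w, (f w, a w))) (fun w => (g w, a w)));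
  [| by move=> w w' [e ->]; rewrite e (fg _ _ e) | by move=> w w' [-> _ ->]].
rewrite (@shannon_H_eq _ _ _ P0 _ _ (fun w => (m w, (f w, a w))) (fun w => (f w, m w, a w)));
  [| by move=> w w' [-> -> ->] | by move=> w w' [-> -> ->]].
rewrite (@shannon_H_eq _ _ _ P0 _ _ (fun w => (g w, m w, (f w, a w))) (fun w => (g w, m w, a w)));
  [| by move=> w w' [e -> ->]; rewrite e (fg _ _ e) | by move=> w w' [-> -> _ ->]].
lra.
Qed.

Lemma telescope_bound (R : realType) (a b c1 c2 m l : R) :
  a <= c1 -> c2 <= m + b -> m <= l -> (a - b) - (c1 - c2) <= l.
Proof. lra. Qed.

Lemma addrBB (R : realType) (a b c1 c2 : R) : a + b - c1 - c2 = (a - c2) - (c1 - b).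
Proof. ring. Qed.

Lemma addr_cancel_mix (R : realType) (l a b k1 k2 : R) :
  l + a + k1 - (l + b) - k2 = a - b + (k1 - k2).
Proof. ring. Qed.

Lemma addr_cancel_cmi (R : realType) (a b c1 c2 : R) : a + b - c1 - c2 = b - c1 + (a - c2).
Proof. ring. Qed.

Lemma addr_cancel_avg (R : realType) (l a b c1 c2 : R) :
  l + a + (l + b) - (l + c1) - (l + c2) = a + b - c1 - c2.
Proof. ring. Qed.

Lemma pair_inj (A B : Type) (a a' : A) (b b' : B) : (a, b) = (a', b') -> a = a' /\ b = b'.
Proof. by case. Qed.

(** * Single-letter form of a block code *)

Section Converse.
Variables (R : realType) (X Y Z Xh : finType).
Variables (pXY : X -> Y -> R) (pZ : X -> Z -> R) (d : X -> Xh -> R).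
Hypothesis pXY_pmf : is_pmf (fun xy : X * Y => pXY xy.1 xy.2).
Hypothesis pZ_st : is_stoch pZ.
Variables (n M Me Md : nat) (c : Defs.code X Y Z Xh n M Me Md).
Hypothesis n0 : (0 < n)%N.

Let O := (X * Y * Z)%type.
Let p (o : O) : R := pXY o.1.1 o.1.2 * pZ o.1.1 o.2.
Let Om := {ffun 'I_n -> O}.
Let Pn : Om -> R := iid p.

Let p_pmf : is_pmf p.
Proof.
split=> [s|]; first by rewrite mulr_ge0 ?(pZ_st _).1 // (pXY_pmf.1 s.1).
rewrite sum_pair /p /=; under eq_bigr do rewrite -mulr_sumr (pZ_st _).2 mulr1.
exact: pXY_pmf.2.
Qed.
Let Pn_pmf : is_pmf Pn := iid_pmf _ p_pmf.
Let Pn0 : forall o, 0 <= Pn o := Pn_pmf.1.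

Let H (T : finType) (f : Om -> T) := shannon_H Pn f.
Let Heq (A B : finType) (f : Om -> A) (g : Om -> B) :
  (forall w w', g w' = g w -> f w' = f w) ->
  (forall w w', f w' = f w -> g w' = g w) -> H f = H g.
Proof. exact: (shannon_H_eq Pn0). Qed.
Let Hle (A B : finType) (f : Om -> A) (g : Om -> B) :
  (forall w w', g w' = g w -> f w' = f w) -> H f <= H g.
Proof. exact: (shannon_H_le Pn0). Qed.

Let xs (o : Om) : {ffun 'I_n -> X} := [ffun i => (o i).1.1].
Let ys (o : Om) : {ffun 'I_n -> Y} := [ffun i => (o i).1.2].
Let zs (o : Om) : {ffun 'I_n -> Z} := [ffun i => (o i).2].
Let hd (o : Om) : 'I_Md := helper_d c (ys o).
Let msg (o : Om) : 'I_M := src_enc c (xs o) (helper_e c (ys o)).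
(** Prefixes of every length live in one type, with [None] from position [k] on, so that the
    position can later become a component of a single variable. *)
Let past (k : nat) (o : Om) : {ffun 'I_n -> option (X * Y)} :=
  [ffun j : 'I_n => if (j < k)%N then Some (o j).1 else None].
(** At position [i] this is equivalent to Z_i together with U_i stripped of its time index. *)
Let hist (k : nat) (o : Om) := (zs o, hd o, past k o).

Let pastP k w w' :
  past k w' = past k w <-> (forall j : 'I_n, (j < k)%N -> (w' j).1 = (w j).1).
Proof.
split=> [/ffunP h j jk|h]; first by have := h j; rewrite !ffunE jk => -[].
by apply/ffunP => j; rewrite !ffunE; case: ifP => // /h ->.
Qed.

Let zsE w w' : zs w' = zs w -> forall j, (w' j).2 = (w j).2.
Proof. by move=> /ffunP h j; have := h j; rewrite !ffunE. Qed.

Let coord_entropy (T : finType) (f : O -> T) i : H (fun o => f (o i)) = shannon_H p f.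
Proof.
apply: eq_shannon_H; apply: eq_rv_law_expect => F.
exact: (iid_marg1 p_pmf i (fun s => F (f s))).
Qed.

Let hist_succ (i : 'I_n) : H (fun o => ((o i).1, hist i o)) = H (hist i.+1).
Proof.
apply: Heq => w w'; rewrite /hist.
  move=> [-> -> /pastP h]; rewrite h //.
  by congr (_, (_, _, _)); apply/pastP => j ji; apply: h; rewrite ltnS ltnW.
move=> [e -> -> /pastP h]; congr (_, _, _); apply/pastP => j.
by rewrite ltnS leq_eqVlt => /orP[/eqP/val_inj ->|/h].
Qed.

Let hist_succ_msg (i : 'I_n) :
  H (fun o => ((o i).1, msg o, hist i o)) = H (fun o => (msg o, hist i.+1 o)).
Proof.
apply: Heq => w w'; rewrite /hist.
  move=> [-> -> -> /pastP h]; rewrite h //.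
  by congr (_, _, (_, _, _)); apply/pastP => j ji; apply: h; rewrite ltnS ltnW.
move=> [e -> -> -> /pastP h]; congr (_, (_, _, _)); apply/pastP => j.
by rewrite ltnS leq_eqVlt => /orP[/eqP/val_inj ->|/h].
Qed.

Let telescope (f : nat -> R) : \sum_(i < n) (f i.+1 - f i) = f n - f 0%N.
Proof. by rewrite -(big_mkord predT (fun i => f i.+1 - f i)) telescope_sumr. Qed.

Let M_gt0 : (0 < M)%N.
Proof.
have [[x0 y0] _] := pmf_support pXY_pmf.
by apply: leq_ltn_trans (ltn_ord (src_enc c [ffun=> x0] (helper_e c [ffun=> y0]))).
Qed.
Let Md_gt0 : (0 < Md)%N.
Proof.
have [[x0 y0] _] := pmf_support pXY_pmf.
by apply: leq_ltn_trans (ltn_ord (helper_d c [ffun=> y0])).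
Qed.

(** Replacing X_i by (X_i,Y_i) can only increase the terms and makes each letter complete the next
    history, so the sum telescopes to the information that the message carries about (X,Y)^n given
    Z^n and the helper's message to the decoder. *)
Lemma msg_rate : \sum_(i < n) cmi Pn (fun o => (o i).1.1) msg (hist i) <= log2 M%:R.
Proof.
apply: (@le_trans _ _ (\sum_(i < n) cmi Pn (fun o => (o i).1) msg (hist i))).
  by apply: ler_sum => i _; apply: cmi_le_fun => // w w' ->.
rewrite (eq_bigr (fun i : 'I_n => (H (hist i.+1) - H (hist i)) -
   (H (fun o => (msg o, hist i.+1 o)) - H (fun o => (msg o, hist i o))))); last first.
  move=> i _; rewrite /cmi -!/(H _) (hist_succ i) (hist_succ_msg i).
  exact: addrBB.
rewrite sumrB (telescope (fun i => H (hist i)))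
  (telescope (fun i => H (fun o => (msg o, hist i o)))).
have h1 : H (hist n) <= H (fun o => (msg o, hist n o)) by apply: Hle => w w'; rewrite /hist => -[_ -> -> ->].
have h2 : H (fun o => (msg o, hist 0 o)) <= H msg + H (hist 0).
  exact: (@shannon_H_subadd R _ _ Pn0 Pn_pmf.2 _ _ msg (hist 0)).
have h3 : H msg <= log2 M%:R.
  have := @shannon_H_le_card _ _ _ Pn0 Pn_pmf.2 _ msg; rewrite card_ord.
  by apply.
exact: telescope_bound h1 h2 h3.
Qed.

(** Since the source is memoryless, the entropies of single letters add up to those of blocks. The
    histories telescope from Z^n with the helper's message, of entropy at most n H(Z) + log2 Md, to
    the whole source block. *)
Lemma helper_rate : \sum_(i < n) cmi Pn (fun o => (o i).1.2) (hist i) (fun o => (o i).2) <=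
  log2 Md%:R.
Proof.
apply: (@le_trans _ _ (\sum_(i < n) cmi Pn (fun o => (o i).1) (hist i) (fun o => (o i).2))).
  by apply: ler_sum => i _; apply: cmi_le_fun => // w w' ->.
rewrite (eq_bigr (fun i : 'I_n => (shannon_H p id - shannon_H p snd) -
   (H (hist i.+1) - H (hist i)))); last first.
  move=> i _; rewrite /cmi -!/(H _).
  rewrite (@Heq _ _ (fun o => ((o i).1, (o i).2)) (fun o => o i));
    [| by move=> w w' -> | by move=> w w'; case: (w i) (w' i) => [? ?] [? ?] /= [-> ->]].
  rewrite (coord_entropy id) (coord_entropy snd) -hist_succ.
  rewrite (@Heq _ _ (fun o => (hist i o, (o i).2)) (hist i));
    [| by move=> w w' e; rewrite e; case: e => /zsE -> | by move=> w w'; rewrite /hist => -[-> -> -> _]].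
  rewrite (@Heq _ _ (fun o => ((o i).1, hist i o, (o i).2)) (fun o => ((o i).1, hist i o)));
    [| by move=> w w' [-> e1 e2 e3]; rewrite /hist e1 e2 e3 (zsE e1)
     | by move=> w w'; rewrite /hist => -[-> -> -> -> _]].
  exact: addrBB.
rewrite sumrB (telescope (fun i => H (hist i))) sumr_const card_ord.
have h1 : H id <= H (hist n).
  apply: Hle => w w' [/zsE e1 _ /pastP e2]; apply/ffunP => j /=.
  have := e2 j (ltn_ord j); have := e1 j.
  by case: (w j) (w' j) => [? ?] [? ?] /= -> ->.
have h2 : H (hist 0) <= H hd + H zs.
  apply: le_trans (shannon_H_subadd Pn0 Pn_pmf.2 hd zs).
  apply: Hle => w w'; rewrite /hist => -[-> ->]; congr (_, _); exact/pastP.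
have h3 : H hd <= log2 Md%:R.
  have := @shannon_H_le_card _ _ _ Pn0 Pn_pmf.2 _ hd; rewrite card_ord.
  by apply.
have h4 : H zs = n%:R * shannon_H p snd.
  by rewrite /H (shannon_H_iid _ snd p_pmf) card_ord.
have h5 : H id = n%:R * shannon_H p id.
  have := shannon_H_iid 'I_n id p_pmf; rewrite card_ord => <-; apply: Heq => w w' /=.
    by move=> /ffunP h; apply/ffunP => i; have := h i; rewrite !ffunE.
  by move=> ->.
rewrite h5 in h1; rewrite h4 in h2; rewrite -[(_ - _) *+ n]mulr_natl mulrBr.
exact: telescope_bound h1 h2 h3.
Qed.

(** Z_i is masked because U_i may depend on the letter at position i through Y_i alone; the decoder
    puts it back. *)
Let zmask (i : 'I_n) (o : Om) : {ffun 'I_n -> option Z} :=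
  [ffun j => if j == i then None else Some (o j).2].
Let aux (i : 'I_n) (o : Om) := (hd o, zmask i o, past i o).

Let hist_aux (i : 'I_n) w w' :
  (aux i w' = aux i w /\ (w' i).2 = (w i).2) <-> hist i w' = hist i w.
Proof.
rewrite /aux /hist; split=> [[[-> /ffunP e ->] ez]|[/zsE ez -> ->]].
  congr (_, _, _); apply/ffunP => j; rewrite !ffunE.
  by case: (eqVneq j i) => [->//|ji]; have := e j; rewrite !ffunE (negPf ji) => -[].
split; last exact: ez.
by congr (_, _, _); apply/ffunP => j; rewrite !ffunE ez.
Qed.

(** The auxiliary randomness: a uniform time and an independent copy of the whole source block. *)
Let q (io : 'I_n * Om) : R := n%:R^-1 * Pn io.2.
Let q_pmf : is_pmf q.
Proof.
split=> [io|]; first by rewrite mulr_ge0 ?invr_ge0.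
rewrite sum_pair; under eq_bigr do rewrite -mulr_sumr Pn_pmf.2 mulr1.
by rewrite sumr_const card_ord -[X in X = _]mulr_natr mulVf // pnatr_eq0 -lt0n.
Qed.

Let Om' := (X * Y * Z * ('I_n * Om))%type.
Let P' : Om' -> R := source_with pXY pZ q.
Let P'0 o : 0 <= P' o.
Proof.
case: o => [[[x y] z] a] /=; rewrite mulr_ge0 ?q_pmf.1 // mulr_ge0 ?(pZ_st _).1 //.
exact: (pXY_pmf.1 (x, y)).
Qed.
(** The source letter is planted in the copy at the random time. By resampling, the block stays
    i.i.d. and independent of the time, so that single-letter quantities become averages over
    positions. *)
Let full (o : Om') : Om := upd o.2.2 o.2.1 o.1.

Let mix_expect (G : 'I_n -> Om -> R) :
  \sum_o P' o * G o.2.1 (full o) = n%:R^-1 * \sum_i \sum_o Pn o * G i o.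
Proof.
have := source_with_expect pXY pZ q (fun x y z a => G a.1 (upd a.2 a.1 (x, y, z))).
rewrite (eq_bigr (fun o => P' o * G o.2.1 (full o))) => [->|[[[x y] z] [i o]] _ //].
transitivity (\sum_(s : O) p s * \sum_(a : 'I_n * Om) q a * G a.1 (upd a.2 a.1 s)).
  by rewrite !sum_pair.
under eq_bigr do rewrite sum_pair mulr_sumr.
rewrite exchange_big /= mulr_sumr; apply: eq_bigr => i _.
rewrite (iid_resample p_pmf i (G i)) mulr_sumr; apply: eq_bigr => s _.
rewrite mulrCA; congr (_ * _); rewrite mulr_sumr; apply: eq_bigr => o _.
by rewrite mulrA.
Qed.

(** The uniform time contributes [log2 n%:R], and the entropies are averaged given the time. In each
    [cmi] below as many such terms come with a plus as with a minus, so [log2 n%:R] cancels. *)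
Let mix_entropy (T S : finType) (g : 'I_n -> Om -> T) (f : Om' -> S) :
  (forall w w', (w'.2.1, g w'.2.1 (full w')) = (w.2.1, g w.2.1 (full w)) -> f w' = f w) ->
  (forall w w', f w' = f w -> (w'.2.1, g w'.2.1 (full w')) = (w.2.1, g w.2.1 (full w))) ->
  shannon_H P' f = log2 n%:R + n%:R^-1 * \sum_i H (g i).
Proof.
move=> h1 h2; rewrite (shannon_H_eq P'0 h1 h2).
have n0R : 0 < n%:R :> R by rewrite ltr0n.
have law i t : rv_law P' (fun w => (w.2.1, g w.2.1 (full w))) (i, t) =
    n%:R^-1 * rv_law Pn (g i) t.
  apply: (@rv_law_of_expect _ _ _ _ _ (fun it => n%:R^-1 * rv_law Pn (g it.1) it.2)) => F.
  rewrite (mix_expect (fun i o => F (i, g i o))) sum_pair mulr_sumr; apply: eq_bigr => j _.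
  rewrite (rv_law_expect Pn (g j) (fun t => F (j, t))) mulr_sumr.
  by apply: eq_bigr => t' _; rewrite mulrA.
have E i t : n%:R^-1 * rv_law Pn (g i) t * log2 (n%:R^-1 * rv_law Pn (g i) t) =
    - (log2 n%:R * n%:R^-1 * rv_law Pn (g i) t) +
    n%:R^-1 * (rv_law Pn (g i) t * log2 (rv_law Pn (g i) t)).
  have := rv_law_ge0 Pn0 (g i) t; rewrite le_eqVlt => /orP[/eqP <-|].
    by rewrite !(mul0r, mulr0) oppr0 addr0.
  move: (rv_law _ _ _) => L L0.
  have -> : log2 (n%:R^-1 * L) = - log2 n%:R + log2 L.
    by rewrite log2M ?invr_gt0 // -div1r log2_div // log2_1 sub0r.
  ring.
rewrite /shannon_H sum_pair; under eq_bigr do under eq_bigr do rewrite law E.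
under eq_bigr do rewrite big_split /= sumrN -!mulr_sumr rv_law_sum Pn_pmf.2 mulr1.
rewrite big_split /= sumrN sumr_const card_ord -mulr_sumr opprD opprK -mulrN -sumrN.
by rewrite -[_ *+ n]mulr_natr -mulrA mulVf ?gt_eqF // mulr1.
Qed.

Let source_entropy (T : finType) (f : O -> T) : shannon_H P' (fun o => f o.1) = shannon_H p f.
Proof.
apply: eq_shannon_H; apply: eq_rv_law_expect => F.
have := source_with_expect pXY pZ q (fun x y z a => F (f (x, y, z))).
rewrite (eq_bigr (fun o => P' o * F (f o.1))) => [->|[[[x y] z] a] _ //].
rewrite [RHS]sum_pair sum_pair; apply: eq_bigr => x _; apply: eq_bigr => y _; apply: eq_bigr => z _.
by rewrite -mulr_suml q_pmf.2 mul1r.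
Qed.

Lemma converse_code (D Rr R1 : R) : exp_distortion pXY pZ d c <= D ->
  log2 M%:R <= n%:R * Rr -> log2 Md%:R <= n%:R * R1 -> RYXZ pXY pZ d D Rr R1.
Proof.
move=> hD hM hMd.
have n0R : 0 < n%:R :> R by rewrite ltr0n.
have [[x0 y0] _] := pmf_support pXY_pmf; have [z0 _] := pmf_support (pZ_st x0).
(* [x0] and [z0] are fillers at position i: the helper reads only y, and [aux] masks z there and
   stops its prefix before i. In [w] the message does not read z, but it does depend on y through
   the encoder's helper message. *)
pose u y (a : 'I_n * Om) := (a.1, aux a.1 (upd a.2 a.1 (x0, y, z0))).
pose w x y (a : 'I_n * Om) := msg (upd a.2 a.1 (x, y, z0)).
have uE (o : Om') : u o.1.1.2 o.2 = (o.2.1, aux o.2.1 (full o)).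
  case: o => [[[x y] z] [i o]]; rewrite /u /full /=; congr (_, (_, _, _)).
  - by congr (helper_d c _); apply/ffunP => j; rewrite !ffunE; case: eqP.
  - by apply/ffunP => j; rewrite !ffunE; case: eqP.
  - by apply/pastP => j ji; rewrite !upd_other // neq_ltn ji.
have wE (o : Om') : w o.1.1.1 o.1.1.2 o.2 = msg (full o).
  case: o => [[[x y] z] [i o]]; rewrite /w /full /= /msg.
  have -> : xs (upd o i (x, y, z0)) = xs (upd o i (x, y, z)).
    by apply/ffunP => j; rewrite !ffunE; case: eqP.
  by have -> : ys (upd o i (x, y, z0)) = ys (upd o i (x, y, z))
    by apply/ffunP => j; rewrite !ffunE; case: eqP.
have fullE (o : Om') : full o o.2.1 = o.1 by rewrite /full upd_same.
have hist1 (w1 w2 : Om') : (w2.2.1, hist w2.2.1 (full w2)) = (w1.2.1, hist w1.2.1 (full w1)) ->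
    (u w2.1.1.2 w2.2, w2.1.2) = (u w1.1.1.2 w1.2, w1.1.2).
  move=> e; have e1 : w2.2.1 = w1.2.1 := f_equal fst e.
  have e2 : hist w2.2.1 (full w2) = hist w1.2.1 (full w1) := f_equal snd e.
  rewrite !uE -!fullE; move: e2; rewrite e1 => /hist_aux [-> e3]; congr (_, _); exact: e3.
have hist2 (w1 w2 : Om') : (u w2.1.1.2 w2.2, w2.1.2) = (u w1.1.1.2 w1.2, w1.1.2) ->
    (w2.2.1, hist w2.2.1 (full w2)) = (w1.2.1, hist w1.2.1 (full w1)).
  move=> e; have e1 := f_equal fst e; have e2 : w2.1.2 = w1.1.2 := f_equal snd e.
  rewrite !uE in e1; have e3 : w2.2.1 = w1.2.1 := f_equal fst e1.
  have e4 : aux w2.2.1 (full w2) = aux w1.2.1 (full w1) := f_equal snd e1.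
  rewrite -!fullE e3 in e2; rewrite e3 in e4; rewrite e3; congr (_, _).
  by apply/hist_aux; split.
(* The decoder is fed the masked sequence with the actual z restored at position [ia.1]; for values
   produced by [aux] the default of [odflt] is not reached elsewhere. *)
pose xh (ia : 'I_n * ('I_Md * {ffun 'I_n -> option Z} * {ffun 'I_n -> option (X * Y)}))
    (m : 'I_M) (z : Z) : Xh :=
  dec c m ia.2.1.1 [ffun j => if j == ia.1 then z else odflt z (ia.2.1.2 j)] ia.1.
apply: (@RYXZ_of_functions _ _ _ _ _ _ _ d pXY_pmf _ _ _ q u w xh q_pmf).
- rewrite /rv_expect.
  have xhE (o : Om') : d o.1.1.1 (xh (u o.1.1.2 o.2) (w o.1.1.1 o.1.1.2 o.2) o.1.2) =
      d (full o o.2.1).1.1 (dec c (msg (full o)) (hd (full o)) (zs (full o)) o.2.1).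
    rewrite uE wE fullE /xh /=; congr (d _ (dec c _ _ _ _)).
    apply/ffunP => j; rewrite [LHS]ffunE [RHS]ffunE /=.
    by case: (eqVneq j o.2.1) => [->|ji]; [rewrite fullE | rewrite ffunE (negPf ji)].
  under eq_bigr do rewrite xhE.
  rewrite (mix_expect (fun i o => d (o i).1.1 (dec c (msg o) (hd o) (zs o) i))).
  apply: le_trans hD; rewrite le_eqVlt; apply/orP; left; apply/eqP.
  rewrite exchange_big /= mulr_sumr sum_ffun_zip sum_ffun_zip /exp_distortion.
  apply: eq_bigr => x _; apply: eq_bigr => y _; apply: eq_bigr => z _.
  rewrite -mulr_sumr mulrCA; congr (_ * (_ * _)).
    by apply: eq_bigr => i _; rewrite !ffunE.
  apply: eq_bigr => i _; rewrite !ffunE /=; congr (d _ (dec c _ _ _ _)).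
  + rewrite /msg; congr (src_enc c _ (helper_e c _)).
      by apply/ffunP => j; rewrite !ffunE.
    by apply/ffunP => j; rewrite !ffunE.
  + by rewrite /hd; congr helper_d; apply/ffunP => j; rewrite !ffunE.
  + by apply/ffunP => j; rewrite !ffunE.
- have hUZ := @mix_entropy _ _ hist (fun o => (u o.1.1.2 o.2, o.1.2)) hist1 hist2.
  have hUYZ := @mix_entropy _ _ (fun i o => ((o i).1.2, hist i o))
    (fun o => (u o.1.1.2 o.2, o.1.1.2, o.1.2)).
  rewrite /cmi hUZ hUYZ; first last.
  + move=> w1 w2 h; have [h' e3] := pair_inj h; have [e1 e2] := pair_inj h'.
    have [E1 E2] := pair_inj (hist2 w1 w2 (f_equal2 pair e1 e3)).
    by rewrite !fullE e2 E2 E1.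
  + move=> w1 w2 h; have [e1 h'] := pair_inj h; have [e2 e3] := pair_inj h'; rewrite !fullE in e2.
    have [E1 E2] := pair_inj (hist1 w1 w2 (f_equal2 pair e1 e3)).
    by rewrite E1 E2 e2.
  rewrite (source_entropy (fun s : O => (s.1.2, s.2))) (source_entropy snd).
  have -> : log2 n%:R + n%:R^-1 * \sum_(i < n) H (hist i) + shannon_H p (fun s : O => (s.1.2, s.2)) -
     (log2 n%:R + n%:R^-1 * \sum_(i < n) H (fun o => ((o i).1.2, hist i o))) - shannon_H p snd =
     n%:R^-1 * \sum_(i < n) cmi Pn (fun o => (o i).1.2) (hist i) (fun o => (o i).2).
    rewrite [X in _ = _ * X](eq_bigr (fun i : 'I_n => (H (hist i) - H (fun o => ((o i).1.2, hist i o))) +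
      (shannon_H p (fun s : O => (s.1.2, s.2)) - shannon_H p snd))) => [|i _].
      rewrite big_split /= sumrB sumr_const card_ord -[(_ - _) *+ n]mulr_natl.
      rewrite mulrDr mulKf ?gt_eqF // mulrBr; exact: addr_cancel_mix.
    rewrite /cmi -!/(H _) (coord_entropy (fun s : O => (s.1.2, s.2))) (coord_entropy snd).
    rewrite (@Heq _ _ (fun o => (hist i o, (o i).2)) (hist i));
      [| by move=> w1 w2 e; rewrite e; case: e => /zsE ->
       | by move=> w1 w2; rewrite /hist => -[-> -> -> _]].
    rewrite (@Heq _ _ (fun o => ((o i).1.2, hist i o, (o i).2)) (fun o => ((o i).1.2, hist i o)));
      [| by move=> w1 w2 [-> e1 e2 e3]; rewrite /hist e1 e2 e3 (zsE e1)
       | by move=> w1 w2; rewrite /hist => -[-> -> -> -> _]].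
    exact: addr_cancel_cmi.
  by rewrite ler_pdivrMl // (le_trans helper_rate).
- have hUZ := @mix_entropy _ _ hist (fun o => (u o.1.1.2 o.2, o.1.2)) hist1 hist2.
  have hX := @mix_entropy _ _ (fun i o => ((o i).1.1, hist i o))
    (fun o => (o.1.1.1, (u o.1.1.2 o.2, o.1.2))).
  have hW := @mix_entropy _ _ (fun i o => (msg o, hist i o))
    (fun o => (w o.1.1.1 o.1.1.2 o.2, (u o.1.1.2 o.2, o.1.2))).
  have hXW := @mix_entropy _ _ (fun i o => ((o i).1.1, msg o, hist i o))
    (fun o => (o.1.1.1, w o.1.1.1 o.1.1.2 o.2, (u o.1.1.2 o.2, o.1.2))).
  rewrite /cmi hUZ hX; first last.
  + move=> w1 w2 h; have [e1 h'] := pair_inj h; have [E1 E2] := pair_inj (hist2 _ _ h').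
    by rewrite !fullE e1 E2 E1.
  + move=> w1 w2 h; have [e1 h'] := pair_inj h; have [e2 e3] := pair_inj h'; rewrite !fullE in e2.
    have [E1 E2] := pair_inj (hist1 w1 w2 (f_equal2 pair e1 e3)).
    by rewrite E1 E2 e2.
  rewrite hW; first last.
  + move=> w1 w2 h; have [e1 h'] := pair_inj h; have [E1 E2] := pair_inj (hist2 _ _ h'); rewrite !wE in e1.
    by rewrite e1 E2 E1.
  + move=> w1 w2 h; have [e1 h'] := pair_inj h; have [e2 e3] := pair_inj h'.
    have [E1 E2] := pair_inj (hist1 w1 w2 (f_equal2 pair e1 e3)).
    by rewrite E1 E2 !wE e2.
  rewrite hXW; first last.
  + move=> w1 w2 h; have [h1 h'] := pair_inj h; have [e0 e1] := pair_inj h1;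
    have [E1 E2] := pair_inj (hist2 _ _ h'); rewrite !wE in e1.
    by rewrite !fullE e0 e1 E2 E1.
  + move=> w1 w2 h; have [e1 h'] := pair_inj h; have [h1 e3] := pair_inj h';
    have [e0 e2] := pair_inj h1; rewrite !fullE in e0.
    have [E1 E2] := pair_inj (hist1 w1 w2 (f_equal2 pair e1 e3)).
    by rewrite E1 E2 !wE e2 e0.
  apply: (@le_trans _ _ (n%:R^-1 * \sum_(i < n) cmi Pn (fun o => (o i).1.1) msg (hist i))).
    rewrite /cmi -!/(H _) sumrB sumrB big_split /= mulrBr mulrBr mulrDr le_eqVlt; apply/orP; left; apply/eqP.
    exact: addr_cancel_avg.
  by rewrite ler_pdivrMl // (le_trans msg_rate).
Qed.

End Converse.

(** * Cardinality bounds *)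

Section Caratheodory.
Variable R : realType.

Lemma linear_dependency (J T : finType) (s : J -> T -> R) (S : {set J}) :
  (#|T| < #|S|)%N -> exists beta : J -> R,
  [/\ forall j, j \notin S -> beta j = 0, exists j, 0 < beta j &
      forall t, \sum_j beta j * s j t = 0].
Proof.
move=> ltTS.
pose A : 'M[R]_(#|S|, #|T|) := \matrix_(i, k) s (enum_val i) (enum_val k).
have : kermx A != 0.
  rewrite kermx_eq0 /row_free; apply/negP => /eqP rk.
  by have := rank_leq_col A; rewrite rk leqNgt ltTS.
move=> /rowV0Pn [v /sub_kermxP vA v0].
have [i0 vi0] : exists i, v ord0 i != 0.
  apply/existsP; apply: contraR v0; rewrite negb_exists => /forallP h.
  by apply/eqP/rowP => i; rewrite !mxE; apply/eqP; have := h i; rewrite negbK.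
(* The sign makes some coefficient positive, so that the descent along the dependency must hit
   zero. *)
pose sgn : R := if 0 < v ord0 i0 then 1 else -1.
pose beta j := sgn * \sum_i v ord0 i * (enum_val i == j)%:R.
exists beta; split.
- move=> j jS; rewrite /beta big1 ?mulr0 // => i _.
  case: eqP => [e|_]; last by rewrite mulr0.
  by move: jS; rewrite -e enum_valP.
- exists (enum_val i0); rewrite /beta (bigD1 i0) //= eqxx mulr1 big1 ?addr0 => [|i ii0].
    rewrite /sgn; case: (boolP (0 < v ord0 i0)) => h; first by rewrite mul1r.
    by rewrite mulN1r oppr_gt0 lt_neqAle vi0 leNgt.
  by rewrite (inj_eq enum_val_inj) (negPf ii0) mulr0.
- move=> t; under eq_bigr do rewrite /beta -mulrA mulr_suml.
  rewrite -mulr_sumr exchange_big /=.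
  have /rowP /(_ (enum_rank t)) := vA; rewrite !mxE => e.
  rewrite (eq_bigr (fun i => v ord0 i * A i (enum_rank t))) ?e ?mulr0 // => i _.
  rewrite mxE enum_rankK.
  under eq_bigr do rewrite -mulrA [(_ == _)%:R * _]mulrC.
  rewrite -mulr_sumr; congr (_ * _).
  by under eq_bigr do rewrite eq_sym; rewrite sum_indicr.
Qed.

(** The conic form: the weights move along a linear dependency until one of them vanishes, and the
    minimal ratio keeps the others nonnegative. Normalisation is carried by coordinates of [s] in
    the applications. *)
Lemma caratheodory_support (J T : finType) (s : J -> T -> R) (k : nat) (lam : J -> R) :
  (forall j, 0 <= lam j) -> (#|[set j | lam j != 0%R]| <= k)%N ->
  exists lam' : J -> R, [/\ forall j, 0 <= lam' j, (#|[set j | lam' j != 0%R]| <= #|T|)%N &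
    forall t, \sum_j lam' j * s j t = \sum_j lam j * s j t].
Proof.
elim: k lam => [|k IH] lam lam0 hk.
  by exists lam; split => //; apply: leq_trans hk _.
have [|ltTS] := leqP #|[set j | lam j != 0]| #|T|; first by exists lam.
have [beta [bS [j1 bj1] b0]] := linear_dependency s ltTS.
case: (@arg_minP _ _ _ j1 (fun j => 0 < beta j) (fun j => lam j / beta j) bj1) => j2 bj2 jmin.
pose r := lam j2 / beta j2.
have r0 : 0 <= r by rewrite divr_ge0 // ltW.
pose lam' j := lam j - r * beta j.
have lam'0 j : 0 <= lam' j.
  rewrite subr_ge0; have [bj|bj] := ltP 0 (beta j).
    by rewrite -ler_pdivlMr //; apply: jmin.
  by rewrite (le_trans _ (lam0 j)) // mulr_ge0_le0.
have zero j : lam j = 0 -> lam' j = 0.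
  by move=> l0; rewrite /lam' bS ?mulr0 ?subr0 // inE l0 eqxx.
have zero2 : lam' j2 = 0 by rewrite /lam' divfK ?subrr // gt_eqF.
have lj2 : lam j2 != 0.
  apply/negP => /eqP l0; move: bj2; rewrite bS ?ltxx //.
  by rewrite inE l0 eqxx.
have [|lam'' [h1 h2 h3]] := IH lam' lam'0.
  rewrite -ltnS; apply: leq_trans hk; apply: proper_card; apply/properP; split.
    by apply/fintype.subsetP => j; rewrite !inE; apply: contraNneq => /zero ->.
  by exists j2; rewrite inE // zero2 eqxx.
exists lam''; split => // t; rewrite h3.
under eq_bigr do rewrite mulrBl -mulrA.
by rewrite sumrB -mulr_sumr b0 mulr0 subr0.
Qed.

(** Zero weights pad the support to exactly [#|T|] entries, so that the reduced alphabet is one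
    fixed type. *)
Lemma caratheodory (J T : finType) (s : J -> T -> R) (j0 : J) :
  exists (sigma : 'I_#|T| -> J) (theta : 'I_#|T| -> R),
    (forall i, 0 <= theta i) /\
    forall t, \sum_i theta i * s (sigma i) t = \sum_j s j t.
Proof.
have [lam [l0 lS lE]] := @caratheodory_support J T s #|J| (fun=> 1) (fun=> ler01) (max_card _).
set S := [set j | lam j != 0] in lS.
exists (fun i => nth j0 (enum S) i),
  (fun i => if (i < #|S|)%N then lam (nth j0 (enum S) i) else 0).
split=> [i|t]; first by case: ifP.
transitivity (\sum_(j in S) lam j * s j t).
  rewrite -[RHS]big_enum /= [RHS](big_nth j0) -cardE [RHS]big_mkord.
  rewrite (big_ord_widen #|T| (fun i => lam (nth j0 (enum S) i) * s (nth j0 (enum S) i) t)) //.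
  rewrite [RHS]big_mkcond /=; apply: eq_bigr => i _.
  by case: ifP => // _; rewrite mul0r.
under [RHS]eq_bigr do rewrite -[s _ _]mul1r.
rewrite -lE big_mkcond /=; apply: eq_bigr => j _; rewrite inE.
by case: eqP => [->|//]; rewrite mul0r.
Qed.

End Caratheodory.

(** * Homogeneous entropy functionals *)

Section EntropyFunctional.
Variable R : realType.

Definition xlog2 (t : R) : R := t * log2 t.

(* Minus the unnormalised conditional entropy of the row index given the column index;
   it is homogeneous of degree one. *)
Definition ent (I K : finType) (m : I -> K -> R) : R :=
  \sum_i \sum_k xlog2 (m i k) - \sum_k xlog2 (\sum_i m i k).

Lemma eq_ent (I K : finType) (m m' : I -> K -> R) : (forall i k, m i k = m' i k) -> ent m = ent m'.
Proof.
move=> h; rewrite /ent; congr (_ - _).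
  by apply: eq_bigr => i _; apply: eq_bigr => k _; rewrite h.
by apply: eq_bigr => k _; congr xlog2; apply: eq_bigr => i _; rewrite h.
Qed.

Lemma xlog2M (r t : R) : 0 <= r -> 0 <= t -> xlog2 (r * t) = r * xlog2 t + t * xlog2 r.
Proof.
rewrite le_eqVlt => /orP[/eqP <- _|r0]; first by rewrite /xlog2 !(mul0r, mulr0) addr0.
rewrite le_eqVlt => /orP[/eqP <-|t0]; first by rewrite /xlog2 !(mul0r, mulr0) addr0.
rewrite /xlog2 log2M //; ring.
Qed.

(** The terms in [xlog2 r] cancel because the entries and the column sums have the same total. This
    homogeneity makes the information terms linear in the weights of the letters. *)
Lemma ent_scale (I K : finType) (m : I -> K -> R) (r : R) :
  0 <= r -> (forall i k, 0 <= m i k) -> ent (fun i k => r * m i k) = r * ent m.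
Proof.
move=> r0 m0; rewrite /ent.
under eq_bigr do under eq_bigr do rewrite xlog2M //.
under [X in _ - X]eq_bigr do rewrite -mulr_sumr xlog2M ?sumr_ge0 //.
under eq_bigr do rewrite big_split /=.
rewrite !big_split /=.
have -> : \sum_i \sum_k m i k * xlog2 r = \sum_k (\sum_i m i k) * xlog2 r.
  by rewrite exchange_big; apply: eq_bigr => k _; rewrite mulr_suml.
have -> : \sum_i \sum_k r * xlog2 (m i k) = r * \sum_i \sum_k xlog2 (m i k).
  by rewrite mulr_sumr; apply: eq_bigr => i _; rewrite mulr_sumr.
by rewrite -[\sum_k r * _]mulr_sumr; ring.
Qed.

Lemma cmi_of_law (Om A B C : finType) (P : Om -> R) (fA : Om -> A) (fB : Om -> B) (fC : Om -> C)
    (L : A -> B -> C -> R) :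
  (forall a b c, rv_law P (fun w => (fA w, fB w, fC w)) (a, b, c) = L a b c) ->
  cmi P fA fB fC = - (\sum_a \sum_c xlog2 (\sum_b L a b c)) - \sum_b \sum_c xlog2 (\sum_a L a b c)
   + \sum_a \sum_b \sum_c xlog2 (L a b c) + \sum_c xlog2 (\sum_a \sum_b L a b c).
Proof.
move=> h.
have hAC a c : rv_law P (fun w => (fA w, fC w)) (a, c) = \sum_b L a b c.
  rewrite -(rv_law_sumr P (fun w => (fA w, fC w)) fB); apply: eq_bigr => b _.
  by rewrite -h /rv_law; apply: eq_bigl => w; rewrite !xpair_eqE andbAC.
have hBC b c : rv_law P (fun w => (fB w, fC w)) (b, c) = \sum_a L a b c.
  rewrite -(rv_law_suml P fA (fun w => (fB w, fC w))); apply: eq_bigr => a _.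
  by rewrite -h /rv_law; apply: eq_bigl => w; rewrite !xpair_eqE andbA.
have hC c : rv_law P fC c = \sum_a \sum_b L a b c.
  by rewrite -(rv_law_suml P fA fC); apply: eq_bigr => a _; rewrite hAC.
rewrite /cmi /shannon_H !opprK !sum_pair; congr (- _ - _ + _ + _).
- by apply: eq_bigr => a _; apply: eq_bigr => c _; rewrite hAC.
- by apply: eq_bigr => b _; apply: eq_bigr => c _; rewrite hBC.
- by do 3 (apply: eq_bigr => ? _); rewrite h.
- by apply: eq_bigr => c _; rewrite hC.
Qed.

End EntropyFunctional.

(** * Reduction to alphabets of fixed size *)

Section Region.
Variables (R : realType) (X Y Z Xh : finType).
Variables (pXY : X -> Y -> R) (pZ : X -> Z -> R) (d : X -> Xh -> R).
Hypothesis pXY_pmf : is_pmf (fun xy : X * Y => pXY xy.1 xy.2).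
Hypothesis pZ_st : is_stoch pZ.

Let pXY0 x y : 0 <= pXY x y := pXY_pmf.1 (x, y).
Let pZ0 x z : 0 <= pZ x z := (pZ_st x).1 z.

Definition lawYZ y z := \sum_x pXY x y * pZ x z.
(** With [al] the column [qU^~ u], this is the joint mass of X, Z and the letter [u]. *)
Definition lawXZ (al : Y -> R) x z := \sum_y pXY x y * pZ x z * al y.

Let lawYZ0 y z : 0 <= lawYZ y z. Proof. by apply: sumr_ge0 => x _; rewrite mulr_ge0. Qed.
Let lawXZ0 al x z : (forall y, 0 <= al y) -> 0 <= lawXZ al x z.
Proof. by move=> h; apply: sumr_ge0 => y _; rewrite !mulr_ge0. Qed.

Definition cell_cost (al : Y -> R) (ga : X -> R) (xh : Z -> Xh) :=
  \sum_x \sum_z lawXZ al x z * ga x * d x (xh z).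

(** I(U;Y|Z) as H(Y|Z) - H(Y|U,Z), the second entropy split into unnormalised contributions of the
    letters u. [info_XW] is split alike. *)
Definition info_UY (U : finType) (qU : Y -> U -> R) :=
  \sum_u ent (fun y z => lawYZ y z * qU y u) - ent lawYZ.
Definition info_XW (U W : finType) (qU : Y -> U -> R) (qW : X -> U -> W -> R) :=
  \sum_u (\sum_w ent (fun x z => lawXZ (qU^~ u) x z * qW x u w) - ent (lawXZ (qU^~ u))).
Definition info_cost (U W : finType) (qU : Y -> U -> R) (qW : X -> U -> W -> R)
    (xh : U -> W -> Z -> Xh) :=
  \sum_u \sum_w cell_cost (qU^~ u) (fun x => qW x u w) (xh u w).

Section Formulas.
Variables (U W : finType) (qU : Y -> U -> R) (qW : X -> U -> W -> R) (xh : U -> W -> Z -> Xh).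
Hypothesis qU_st : is_stoch qU.
Hypothesis qW_st : is_stoch (fun xu : X * U => qW xu.1 xu.2).

Let P := fun o : X * Y * Z * U * W =>
  let: (x, y, z, u, w) := o in pXY x y * pZ x z * qU y u * qW x u w.
Let qW1 x u : \sum_w qW x u w = 1 := (qW_st (x, u)).2.

Let PE (G : X * Y * Z * U * W -> R) : \sum_o P o * G o =
    \sum_x \sum_y \sum_z pXY x y * pZ x z * \sum_u qU y u *
      \sum_w qW x u w * G (x, y, z, u, w).
Proof.
rewrite !sum_pair; do 3 (apply: eq_bigr => ? _).
rewrite mulr_sumr; apply: eq_bigr => u _.
by rewrite mulrA mulr_sumr; apply: eq_bigr => w _; rewrite mulrA.
Qed.

Let PE_XWUZ (G : X -> W -> U -> Z -> R) : \sum_o P o * G o.1.1.1.1 o.2 o.1.2 o.1.1.2 =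
  \sum_x \sum_w \sum_u \sum_z lawXZ (qU^~ u) x z * qW x u w * G x w u z.
Proof.
rewrite (PE (fun o => G o.1.1.1.1 o.2 o.1.2 o.1.1.2)) /=; apply: eq_bigr => x _.
rewrite [RHS]exchange_big /= [LHS]exchange_big /=.
under [LHS]eq_bigr do under eq_bigr do rewrite mulr_sumr.
under [LHS]eq_bigr do rewrite exchange_big /=.
rewrite exchange_big /=; apply: eq_bigr => u _.
rewrite [RHS]exchange_big /=; apply: eq_bigr => z _.
under [RHS]eq_bigr do rewrite -mulrA.
rewrite -mulr_sumr /lawXZ mulr_suml; apply: eq_bigr => y _.
by rewrite !mulrA.
Qed.

Lemma info_costE : rv_expect P (fun o => let: (x, y, z, u, w) := o in d x (xh u w z)) =
  info_cost qU qW xh.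
Proof.
rewrite /rv_expect (eq_bigr (fun o => P o * d o.1.1.1.1 (xh o.1.2 o.2 o.1.1.2))); last first.
  by move=> [[[[x y] z] u] w] _.
rewrite (PE_XWUZ (fun x w u z => d x (xh u w z))) /info_cost /cell_cost.
under eq_bigr do rewrite exchange_big /=.
rewrite exchange_big /=; apply: eq_bigr => u _.
by rewrite exchange_big.
Qed.

Lemma info_UYE :
  cmi P (fun o => o.1.2) (fun o => o.1.1.1.2) (fun o => o.1.1.2) = info_UY qU.
Proof.
rewrite (@cmi_of_law _ _ _ _ _ _ _ _ _ (fun u y z => lawYZ y z * qU y u)); last first.
  move=> u0 y0 z0; apply: (@rv_law_of_expect _ _ _ _ _
    (fun t : U * Y * Z => lawYZ t.1.2 t.2 * qU t.1.2 t.1.1)) => F.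
  rewrite (PE (fun o => F (o.1.2, o.1.1.1.2, o.1.1.2))) !sum_pair /=.
  rewrite [LHS]exchange_big [RHS]exchange_big /=; apply: eq_bigr => y _.
  rewrite [LHS]exchange_big [RHS]exchange_big /=; apply: eq_bigr => z _.
  rewrite (eq_bigr (fun x => pXY x y * pZ x z * \sum_u qU y u * F (u, y, z))) => [|x _].
    by rewrite -mulr_suml -/(lawYZ y z) mulr_sumr; apply: eq_bigr => u _; rewrite mulrA.
  by congr (_ * _); apply: eq_bigr => u _; rewrite -mulr_suml qW1 mul1r.
have qU1 y : \sum_u qU y u = 1 := (qU_st y).2.
have -> : \sum_y \sum_z xlog2 (\sum_u lawYZ y z * qU y u) = \sum_y \sum_z xlog2 (lawYZ y z).
  by do 2 (apply: eq_bigr => ? _); rewrite -mulr_sumr qU1 mulr1.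
have -> : \sum_z xlog2 (\sum_u \sum_y lawYZ y z * qU y u) = \sum_z xlog2 (\sum_y lawYZ y z).
  apply: eq_bigr => z _; congr xlog2; rewrite exchange_big /=; apply: eq_bigr => y _.
  by rewrite -mulr_sumr qU1 mulr1.
by rewrite /info_UY /ent sumrB; ring.
Qed.

Lemma info_XWE :
  cmi P (fun o => o.1.1.1.1) (fun o => o.2) (fun o => (o.1.2, o.1.1.2)) = info_XW qU qW.
Proof.
rewrite (@cmi_of_law _ _ _ _ _ _ _ _ _ (fun x w uz => lawXZ (qU^~ uz.1) x uz.2 * qW x uz.1 w));
  last first.
  move=> x0 w0 uz0; apply: (@rv_law_of_expect _ _ _ _ _
    (fun t : X * W * (U * Z) => lawXZ (qU^~ t.2.1) t.1.1 t.2.2 * qW t.1.1 t.2.1 t.1.2)) => F.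
  rewrite (PE_XWUZ (fun x w u z => F (x, w, (u, z)))) !sum_pair /=.
  by do 2 (apply: eq_bigr => ? _); rewrite sum_pair.
have -> : \sum_x \sum_uz xlog2 (\sum_w lawXZ (qU^~ uz.1) x uz.2 * qW x uz.1 w) =
    \sum_u \sum_x \sum_z xlog2 (lawXZ (qU^~ u) x z).
  rewrite exchange_big /= sum_pair; apply: eq_bigr => u _; rewrite exchange_big /=.
  by do 2 (apply: eq_bigr => ? _); rewrite -mulr_sumr qW1 mulr1.
have -> : \sum_w \sum_uz xlog2 (\sum_x lawXZ (qU^~ uz.1) x uz.2 * qW x uz.1 w) =
    \sum_u \sum_w \sum_z xlog2 (\sum_x lawXZ (qU^~ u) x z * qW x u w).
  by rewrite exchange_big /= sum_pair; apply: eq_bigr => u _; rewrite exchange_big.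
have -> : \sum_x \sum_w \sum_uz xlog2 (lawXZ (qU^~ uz.1) x uz.2 * qW x uz.1 w) =
    \sum_u \sum_w \sum_x \sum_z xlog2 (lawXZ (qU^~ u) x z * qW x u w).
  rewrite exchange_big /=; under [LHS]eq_bigr do under eq_bigr do rewrite sum_pair /=.
  under [LHS]eq_bigr do rewrite exchange_big /=.
  by rewrite exchange_big.
have -> : \sum_uz xlog2 (\sum_x \sum_w lawXZ (qU^~ uz.1) x uz.2 * qW x uz.1 w) =
    \sum_u \sum_z xlog2 (\sum_x lawXZ (qU^~ u) x z).
  rewrite sum_pair; do 2 (apply: eq_bigr => ? _); congr xlog2; apply: eq_bigr => x _.
  by rewrite -mulr_sumr qW1 mulr1.
rewrite /info_XW /ent -!sumrN -!big_split /=; apply: eq_bigr => u _.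
by rewrite [\sum_w (_ - _)]sumrB /=; ring.
Qed.

End Formulas.

(** The coordinates to be preserved. For W: a kernel entry for each x, one information, the
    distortion; for U: a kernel entry for each y, two informations, the distortion. The kernel
    entries keep the reduced kernels stochastic. *)
Let coordW := option (option X).
Let coordU := option (option (option Y)).

(** The letters of W are reweighted separately for each [u]; the size of the new alphabet does not
    depend on [u]. *)
Lemma reduce_W (U W : finType) (qU : Y -> U -> R) (qW : X -> U -> W -> R)
    (xh : U -> W -> Z -> Xh) :
  is_stoch qU -> is_stoch (fun xu : X * U => qW xu.1 xu.2) ->
  exists (qW' : X -> U -> 'I_#|{: option (option X)}| -> R) xh',
    [/\ is_stoch (fun xu : X * U => qW' xu.1 xu.2), info_XW qU qW' = info_XW qU qW &
        info_cost qU qW' xh' = info_cost qU qW xh].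
Proof.
move=> qU_st qW_st.
have qU0 y u : 0 <= qU y u := (qU_st y).1 u.
have qW0 x u w : 0 <= qW x u w := (qW_st (x, u)).1 w.
have [[x0 y0] _] := pmf_support pXY_pmf.
pose s u w (t : coordW) : R := match t with
  | Some (Some x) => qW x u w
  | Some None => ent (fun x z => lawXZ (qU^~ u) x z * qW x u w)
  | None => cell_cost (qU^~ u) (fun x => qW x u w) (xh u w) end.
have /boolp.choice [f hf] : forall u, exists st : ('I_#|{: coordW}| -> W) * ('I_#|{: coordW}| -> R),
    (forall i, 0 <= st.2 i) /\ forall t, \sum_i st.2 i * s u (st.1 i) t = \sum_w s u w t.
  move=> u; have [w0 _] := pmf_support (qW_st (x0, u)).
  by have [sg [th h]] := caratheodory (s u) w0; exists (sg, th).
exists (fun x u i => (f u).2 i * qW x u ((f u).1 i)), (fun u i => xh u ((f u).1 i)).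
split.
- move=> [x u]; split=> [i|] /=; first by rewrite mulr_ge0 //; case: (hf u).
  by have := (hf u).2 (Some (Some x)) => /= ->; exact: (qW_st (x, u)).2.
- apply: eq_bigr => u _; congr (_ - _).
  have := (hf u).2 (Some None) => /= <-; apply: eq_bigr => i _.
  rewrite -ent_scale; first by apply: eq_ent => x z; rewrite mulrCA.
    by case: (hf u).
  by move=> x z; rewrite mulr_ge0 // lawXZ0.
- apply: eq_bigr => u _.
  have := (hf u).2 None => /= <-; apply: eq_bigr => i _.
  rewrite /cell_cost mulr_sumr; apply: eq_bigr => x _; rewrite mulr_sumr; apply: eq_bigr => z _.
  by rewrite -!mulrA mulrCA.
Qed.

(** Each retained letter keeps its own kernel of W and its reconstruction, so all its contributions
    scale by its weight. The alphabet of W is untouched; reducing W beforehand therefore bounds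
    both. *)
Lemma reduce_U (U W : finType) (qU : Y -> U -> R) (qW : X -> U -> W -> R)
    (xh : U -> W -> Z -> Xh) :
  is_stoch qU -> is_stoch (fun xu : X * U => qW xu.1 xu.2) ->
  exists (qU' : Y -> 'I_#|{: option (option (option Y))}| -> R)
    (qW' : X -> 'I_#|{: option (option (option Y))}| -> W -> R) xh',
    [/\ is_stoch qU', is_stoch (fun xu => qW' xu.1 xu.2), info_UY qU' = info_UY qU,
        info_XW qU' qW' = info_XW qU qW & info_cost qU' qW' xh' = info_cost qU qW xh].
Proof.
move=> qU_st qW_st.
have qU0 y u : 0 <= qU y u := (qU_st y).1 u.
have qW0 x u w : 0 <= qW x u w := (qW_st (x, u)).1 w.
have [[x0 y0] _] := pmf_support pXY_pmf; have [u0 _] := pmf_support (qU_st y0).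
pose s u (t : coordU) : R := match t with
  | Some (Some (Some y)) => qU y u
  | Some (Some None) => ent (fun y z => lawYZ y z * qU y u)
  | Some None => \sum_w ent (fun x z => lawXZ (qU^~ u) x z * qW x u w) - ent (lawXZ (qU^~ u))
  | None => \sum_w cell_cost (qU^~ u) (fun x => qW x u w) (xh u w) end.
have [sg [th [th0 hs]]] := caratheodory s u0.
exists (fun y i => th i * qU y (sg i)), (fun x i w => qW x (sg i) w), (fun i => xh (sg i)).
have lawE i x z : lawXZ (fun y => th i * qU y (sg i)) x z = th i * lawXZ (qU^~ (sg i)) x z.
  by rewrite /lawXZ mulr_sumr; apply: eq_bigr => y _; rewrite mulrCA.
split.
- move=> y; split=> [i|]; first by rewrite mulr_ge0.
  by have := hs (Some (Some (Some y))) => /= ->; exact: (qU_st y).2.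
- by move=> [x i]; exact: (qW_st (x, sg i)).
- congr (_ - _); have := hs (Some (Some None)) => /= <-; apply: eq_bigr => i _.
  rewrite -ent_scale //; first by apply: eq_ent => y z; rewrite mulrCA.
  by move=> y z; rewrite mulr_ge0.
- rewrite /info_XW; have := hs (Some None) => /= <-; apply: eq_bigr => i _.
  rewrite mulrBr mulr_sumr; congr (_ - _).
    apply: eq_bigr => w _; rewrite -ent_scale //.
      by apply: eq_ent => x z; rewrite lawE mulrA.
    by move=> x z; rewrite mulr_ge0 // lawXZ0.
  rewrite -ent_scale //; first by apply: eq_ent => x z; rewrite lawE.
  by move=> x z; rewrite lawXZ0.
- rewrite /info_cost; have := hs None => /= <-; apply: eq_bigr => i _.
  rewrite mulr_sumr; apply: eq_bigr => w _.
  rewrite /cell_cost mulr_sumr; apply: eq_bigr => x _; rewrite mulr_sumr; apply: eq_bigr => z _.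
  by rewrite lawE !mulrA.
Qed.

Definition RYXZ_bounded (D Rr R1 : R) : Prop :=
  exists (qU : Y -> 'I_#|{: option (option (option Y))}| -> R)
    (qW : X -> 'I_#|{: option (option (option Y))}| -> 'I_#|{: option (option X)}| -> R) 
    (xh : 'I_#|{: option (option (option Y))}| -> 'I_#|{: option (option X)}| -> Z -> Xh),
    [/\ is_stoch qU, is_stoch (fun xu => qW xu.1 xu.2), info_cost qU qW xh <= D,
        info_UY qU <= R1 & info_XW qU qW <= Rr].

Lemma RYXZ_to_bounded D Rr R1 : RYXZ pXY pZ d D Rr R1 -> RYXZ_bounded D Rr R1.
Proof.
move=> [U [W [qU [qW [xh [qU_st qW_st hD h1 hr]]]]]].
rewrite info_costE // in hD; rewrite info_UYE // in h1; rewrite info_XWE // in hr.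
have [qW' [xh' [qW'_st e1 e2]]] := reduce_W xh qU_st qW_st.
have [qU2 [qW2 [xh2 [s1 s2 e3 e4 e5]]]] := reduce_U xh' qU_st qW'_st.
exists qU2, qW2, xh2; split => //.
- by rewrite e5 e2.
- by rewrite e3.
- by rewrite e4 e1.
Qed.

Lemma bounded_to_RYXZ D Rr R1 : RYXZ_bounded D Rr R1 -> RYXZ pXY pZ d D Rr R1.
Proof.
move=> [qU [qW [xh [s1 s2 hD h1 hr]]]].
exists _, _, qU, qW, xh; split => //.
- by rewrite info_costE.
- by rewrite info_UYE.
- by rewrite info_XWE.
Qed.

End Region.

(** * Closedness of the region *)

Import numFieldNormedType.Exports.
Section UltraLimits.
Local Open Scope classical_set_scope.
Variables (R : realType) (G : set_system nat).
Hypothesis GU : UltraFilter G.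

Let GP : ProperFilter G. Proof. exact: ultra_proper. Qed.

(** By compactness the image ultrafilter has a cluster point, which for an ultrafilter is a limit.
    One ultrafilter serves all kernel entries at once, with no extraction of subsequences. *)
Lemma ultra_bounded_cvg (a : nat -> R) (b : R) :
  (forall k, 0 <= a k <= b) -> exists l : R, a @ G --> l.
Proof.
move=> ab; have FP : ProperFilter (a @ G) by apply: fmap_proper_filter.
have [|l [_ hl]] := @segment_compact R 0 b (a @ G) FP.
  have h : \forall k \near G, `[0, b]%classic (a k).
    by apply: filterE => k; rewrite /= in_itv /= ab.
  exact: h.
exists l => B lB; have [//|GnB] := @in_ultra_setVsetC _ G (a @^-1` B) GU.
by have [x [hx1 hx2]] := hl (~` B) B GnB lB.
Qed.

(** Applied to the reconstruction functions on fixed alphabets, which are finite in number and can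
    thus be frozen along the limit. *)
Lemma ultra_pigeonhole (S : finType) (f : nat -> S) : exists s, G [set k | f k = s].
Proof.
apply: contrapT => hn.
have h s : G [set k | f k <> s].
  have [gs|//] := @in_ultra_setVsetC _ G [set k | f k = s] GU.
  by case: hn; exists s.
have FG : Filter G by exact: (@filter_filter _ _ GP).
have := @filter_forall _ S (fun s => [set k | f k <> s]) G FG h.
by move=> /filter_ex [k /(_ (f k))].
Qed.

Lemma cvg_fsum (I : finType) (f : I -> nat -> R) (l : I -> R) :
  (forall i, f i @ G --> l i) -> (fun k => \sum_i f i k) @ G --> \sum_i l i.
Proof.
move=> h; elim: (index_enum I) => [|i r IH].
  by rewrite big_nil; under eq_fun do rewrite big_nil; exact: cvg_cst.
by rewrite big_cons; under eq_fun do rewrite big_cons; apply: cvgD.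
Qed.

(** This gives continuity at 0, where the logarithm has none. The constant comes from
    [log2 s <= (s - 1) / ln 2] at the inverse square root of [t]. *)
Lemma xlog2_le_sqrt (t : R) : 0 <= t -> t <= 1 -> `|xlog2 t| <= 2 / ln 2 * Num.sqrt t.
Proof.
rewrite le_eqVlt => /orP[/eqP <- _|t0 t1].
  by rewrite /xlog2 mul0r normr0 sqrtr0 mulr0.
have s0 : 0 < Num.sqrt t by rewrite sqrtr_gt0.
have l2 := ln2_gt0 R.
have sE : t = Num.sqrt t * Num.sqrt t by rewrite -expr2 sqr_sqrtr // ltW.
have ltn : log2 t <= 0 by rewrite -(log2_1 R) le_log2.
rewrite /xlog2 normrM gtr0_norm // ler0_norm //.
have h : - log2 (Num.sqrt t) <= (Num.sqrt t)^-1 / ln 2.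
  have := log2_le_sub1 (x := (Num.sqrt t)^-1).
  rewrite invr_gt0 => /(_ s0).
  rewrite -div1r log2_div // log2_1 sub0r => /le_trans; apply.
  by rewrite ler_pM2r ?invr_gt0 // gerBl.
have -> : log2 t = 2 * log2 (Num.sqrt t) by rewrite {1}sE log2M //; ring.
apply: (@le_trans _ _ (t * (2 * ((Num.sqrt t)^-1 / ln 2)))).
  by rewrite ler_pM2l // -mulrN ler_pM2l.
rewrite {1}sE le_eqVlt; apply/orP; left; apply/eqP; field.
by rewrite !gt_eqF.
Qed.

Lemma cvg_xlog2 (a : nat -> R) (l : R) : (forall k, 0 <= a k) -> a @ G --> l ->
  (fun k => xlog2 (a k)) @ G --> xlog2 l.
Proof.
move=> a0 al.
have l0 : 0 <= l.
  by apply: (cvgr_to_ge al); apply: filterE => k; exact: a0.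
move: l0; rewrite le_eqVlt => /orP[/eqP l0|l0]; last first.
  apply: cvgM => //; rewrite /log2; apply: cvgM; last exact: cvg_cst.
  by apply: cvg_comp al _; exact: continuous_ln.
rewrite -l0 in al *; rewrite /xlog2 mul0r.
have sq : (fun k => 2 / ln 2 * Num.sqrt (a k)) @ G --> (0 : R).
  have -> : (0 : R) = 2 / ln 2 * Num.sqrt 0 by rewrite sqrtr0 mulr0.
  apply: cvgM; first exact: cvg_cst.
  by apply: cvg_comp al _; exact: sqrt_continuous.
have nsq : (fun k => - (2 / ln 2 * Num.sqrt (a k))) @ G --> (0 : R).
  by rewrite -oppr0; apply: cvgN.
apply: (@squeeze_cvgr _ _ _ _ (fun k => - (2 / ln 2 * Num.sqrt (a k)))
   (fun k => 2 / ln 2 * Num.sqrt (a k))) => //.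
have h1 : \forall k \near G, a k <= 1 by apply: (cvgr_le _ al).
near=> k.
have : `|xlog2 (a k)| <= 2 / ln 2 * Num.sqrt (a k).
  by apply: xlog2_le_sqrt => //; near: k.
by rewrite ler_norml.
Unshelve. all: by end_near.
Qed.

Lemma cvg_ent (I K : finType) (m : nat -> I -> K -> R) (l : I -> K -> R) :
  (forall n i k, 0 <= m n i k) -> (forall i k, (fun n => m n i k) @ G --> l i k) ->
  (fun n => ent (m n)) @ G --> ent l.
Proof.
move=> m0 ml; apply: cvgB.
  by do 2 (apply: cvg_fsum => ?); apply: cvg_xlog2.
apply: cvg_fsum => k; apply: cvg_xlog2 => [n|]; first exact: sumr_ge0.
exact: cvg_fsum.
Qed.

End UltraLimits.

(** * Passage to the limit and part (2) *)

Section Closure.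
Local Open Scope classical_set_scope.
Variables (R : realType) (X Y Z Xh : finType).
Variables (pXY : X -> Y -> R) (pZ : X -> Z -> R) (d : X -> Xh -> R).
Hypothesis pXY_pmf : is_pmf (fun xy : X * Y => pXY xy.1 xy.2).
Hypothesis pZ_st : is_stoch pZ.

Lemma cvg_stoch (G : set_system nat) (A B : finType) (q : nat -> A -> B -> R) (l : A -> B -> R) :
  UltraFilter G -> (forall k, is_stoch (q k)) ->
  (forall a b, (fun k => q k a b) @ G --> l a b) -> is_stoch l.
Proof.
move=> GU qst ql a; have GP : ProperFilter G by exact: ultra_proper.
split=> [b|].
  by apply: (cvgr_to_ge (ql a b)); apply: filterE => k; exact: (qst k a).1.
have h1 := cvg_fsum GU (ql a).
have h2 : (fun k => \sum_b q k a b) @ G --> (1 : R).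
  by under eq_fun do rewrite (qst _ a).2; exact: cvg_cst.
exact: (cvg_unique _ h1 h2).
Qed.

Lemma RYXZ_closed (D Rr R1 : R) :
  (forall e, 0 < e -> RYXZ_bounded pXY pZ d (D + e) (Rr + e) (R1 + e)) ->
  RYXZ_bounded pXY pZ d D Rr R1.
Proof.
move=> H.
have pXY0 x y : 0 <= pXY x y := pXY_pmf.1 (x, y).
have pZ0 x z : 0 <= pZ x z := (pZ_st x).1 z.
pose U := 'I_#|{: option (option (option Y))}|; pose W := 'I_#|{: option (option X)}|.
(* The slack is [harmonic k]. The reconstruction is stored as a finite function, so that it ranges
   over a finite type and the pigeonhole applies. *)
have /boolp.choice [f hf] : forall k : nat, exists
    t : (Y -> U -> R) * (X -> U -> W -> R) * {ffun U * W * Z -> Xh},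
    let xh := fun u w z => t.2 (u, w, z) in
    [/\ is_stoch t.1.1, is_stoch (fun xu => t.1.2 xu.1 xu.2),
      info_cost pXY pZ d t.1.1 t.1.2 xh <= D + harmonic k,
      info_UY pXY pZ t.1.1 <= R1 + harmonic k & info_XW pXY pZ t.1.1 t.1.2 <= Rr + harmonic k].
  move=> k; have [qU [qW [xh [h1 h2 h3 h4 h5]]]] := H (harmonic k) (harmonic_gt0 k).
  exists (qU, qW, [ffun t => xh t.1.1 t.1.2 t.2]); split => //=.
  rewrite (_ : (fun u w z => _) = xh) //.
  by apply/funext => u; apply/funext => w; apply/funext => z; rewrite ffunE.
pose qU k := (f k).1.1; pose qW k := (f k).1.2.
have qU_st k : is_stoch (qU k) by case: (hf k).
have qW_st k : is_stoch (fun xu => qW k xu.1 xu.2) by case: (hf k).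
(* Being finer than the eventual filter, [G] retains the convergence of [harmonic] to 0. *)
have [G [GU sG]] := ultraFilterLemma eventually_filter.
have GP : ProperFilter G by exact: ultra_proper.
have [xh0 hxh] := ultra_pigeonhole GU (fun k => (f k).2).
have le1 (A B : finType) (q : A -> B -> R) a b : is_stoch q -> 0 <= q a b <= 1.
  move=> qst; rewrite (qst a).1 /= -(qst a).2 (bigD1 b) //= lerDl sumr_ge0 // => b' _.
  exact: (qst a).1.
have /boolp.choice [lU hU] : forall yu : Y * U, exists l : R, (fun k => qU k yu.1 yu.2) @ G --> l.
  by move=> yu; apply: (ultra_bounded_cvg GU (b := 1)) => k; exact: le1.
have /boolp.choice [lW hW] : forall xuw : X * U * W, exists l : R,
    (fun k => qW k xuw.1.1 xuw.1.2 xuw.2) @ G --> l.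
  move=> [[x u] w]; apply: (ultra_bounded_cvg GU (b := 1)) => k.
  exact: (@le1 _ _ (fun xu => qW k xu.1 xu.2) (x, u) w (qW_st k)).
pose qU' y u := lU (y, u); pose qW' x u w := lW (x, u, w).
have cU y u : (fun k => qU k y u) @ G --> qU' y u by exact: (hU (y, u)).
have cW x u w : (fun k => qW k x u w) @ G --> qW' x u w by exact: (hW (x, u, w)).
have U0 k y u : 0 <= qU k y u := (qU_st k y).1 u.
have W0 k x u w : 0 <= qW k x u w := (qW_st k (x, u)).1 w.
have lawXZ0 k u x z : 0 <= lawXZ pXY pZ (qU k ^~ u) x z.
  by apply: sumr_ge0 => y _; rewrite !mulr_ge0.
have clawXZ u x z : (fun k => lawXZ pXY pZ (qU k ^~ u) x z) @ G --> lawXZ pXY pZ (qU' ^~ u) x z.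
  by apply: (cvg_fsum GU) => y; apply: cvgM; [exact: cvg_cst|exact: cU].
have lawYZ0 y z : 0 <= lawYZ pXY pZ y z by apply: sumr_ge0 => x _; rewrite mulr_ge0.
have harm c : (fun k => c + harmonic k) @ G --> (c : R).
  rewrite -[X in _ --> X]addr0; apply: cvgD; first exact: cvg_cst.
  by move=> A hA; apply: sG; exact: (cvg_harmonic hA).
exists qU', qW', (fun u w z => xh0 (u, w, z)); split.
- exact: (cvg_stoch GU qU_st).
- apply: (@cvg_stoch G _ _ (fun k xu => qW k xu.1 xu.2)) => // -[x u] w; exact: cW.
- apply: (@ler_cvg_to _ _ GP _ (fun k => info_cost pXY pZ d (qU k) (qW k) (fun u w z => xh0 (u, w, z)))
    (fun k => D + harmonic k)) => //.
    rewrite /info_cost /cell_cost; do 4 (apply: (cvg_fsum GU) => ?); apply: cvgM; last exact: cvg_cst.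
    by apply: cvgM; [exact: clawXZ|exact: cW].
  apply: filterS hxh => k e; case: (hf k) => _ _ h _ _.
  by rewrite /= e in h.
- apply: (@ler_cvg_to _ _ GP _ (fun k => info_UY pXY pZ (qU k)) (fun k => R1 + harmonic k)) => //.
    apply: cvgB; last exact: cvg_cst.
    apply: (cvg_fsum GU) => u; apply: (cvg_ent GU) => [k y z|y z]; first by rewrite mulr_ge0.
    by apply: cvgM; [exact: cvg_cst|exact: cU].
  by apply: filterE => k; case: (hf k).
- apply: (@ler_cvg_to _ _ GP _ (fun k => info_XW pXY pZ (qU k) (qW k)) (fun k => Rr + harmonic k)) => //.
    apply: (cvg_fsum GU) => u; apply: cvgB.
      apply: (cvg_fsum GU) => w; apply: (cvg_ent GU) => [k x z|x z]; first by rewrite mulr_ge0.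
      by apply: cvgM; [exact: clawXZ|exact: cW].
    by apply: (cvg_ent GU).
  by apply: filterE => k; case: (hf k).
Qed.

Lemma part_two (D Rr Re R1 : R) : RgO pXY pZ d D Rr Re R1 -> RYXZ pXY pZ d D Rr R1.
Proof.
move=> H; apply: bounded_to_RYXZ; apply: RYXZ_closed => e e0.
apply: RYXZ_to_bounded => //.
(* One half of [e] pays for the approximation of the rates in the closure, the other for the slack
   of achievability. *)
have e2 : 0 < e / 2 by rewrite divr_gt0.
have [Rr' [Re' [Rd' [ach [h1 _ h3]]]]] := H _ e2.
have [N hN] := ach _ e2.
(* One blocklength is enough; the maximum with 1 makes it positive, as the time average of the
   converse demands. *)
have [M [Me [Md [c [hM _ hMd hD]]]]] := hN (maxn N 1) (leq_maxl _ _).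
set n := maxn N 1 in c hM hMd hD.
have n0 : (0 < n)%N by rewrite /n leq_max orbT.
have [[x0 y0] _] := pmf_support pXY_pmf.
have M0 : (0 < M)%N.
  by apply: leq_ltn_trans (ltn_ord (src_enc c [ffun=> x0] (helper_e c [ffun=> y0]))).
have Md0 : (0 < Md)%N by apply: leq_ltn_trans (ltn_ord (helper_d c [ffun=> y0])).
have rate (m : nat) (r r' : R) : (0 < m)%N -> m%:R <= pow2 (n%:R * (r' + e / 2)) ->
    `|r - r'| < e / 2 -> log2 m%:R <= n%:R * (r + e).
  move=> m0 hm; rewrite ltr_norml => /andP[hr _].
  have := le_log2 (_ : 0 < m%:R) hm; rewrite ltr0n pow2K => /(_ m0) /le_trans; apply.
  by rewrite ler_wpM2l //; lra.
apply: (converse_code pXY_pmf pZ_st (c := c) n0).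
- by apply: (le_trans hD); rewrite lerD2l; lra.
- exact: rate M0 hM h1.
- exact: rate Md0 hMd h3.
Qed.

End Closure.

Theorem theorem6 (R : realType) (X Y Z Xh : finType)
    (pXY : X -> Y -> R) (pZ : X -> Z -> R) (d : X -> Xh -> R) :
  is_pmf (fun xy : X * Y => pXY xy.1 xy.2) -> is_stoch pZ ->
  (forall x xh, 0 <= d x xh) ->
  (* part (1) *)
  (forall (D : R) (U V : finType) (qV : Y -> V -> R) (qU : X -> V -> U -> R)
          (xh : U -> V -> Z -> Xh),
     is_stoch qV -> is_stoch (fun xv : X * V => qU xv.1 xv.2) ->
     let P := fun o : X * Y * Z * V * U =>
       let: (x, y, z, v, u) := o in pXY x y * pZ x z * qV y v * qU x v u in
     let rX := fun o : X * Y * Z * V * U => o.1.1.1.1 in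
     let rY := fun o : X * Y * Z * V * U => o.1.1.1.2 in
     let rZ := fun o : X * Y * Z * V * U => o.1.1.2 in
     let rV := fun o : X * Y * Z * V * U => o.1.2 in
     let rU := fun o : X * Y * Z * V * U => o.2 in
     rv_expect P (fun o => d (rX o) (xh (rU o) (rV o) (rZ o))) <= D ->
     forall Re : R, cmi P rV rY rZ - cmi P rV rX rZ <= Re ->
     RgO pXY pZ d D (cmi P rX rU (fun o => (rV o, rZ o))) Re (cmi P rY rV rZ))
  /\
  (* part (2) *)
  (forall D Rr R' : R, ~ RYXZ pXY pZ d D Rr R' ->
     forall Re : R, ~ RgO pXY pZ d D Rr Re R').
Proof.
move=> pXY_pmf pZ_st d0; split.
  move=> D U V qV qU xh qV_st qU_st P rX rY rZ rV rU hD Re hRe.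
  exact: (part_one pXY_pmf pZ_st qV_st qU_st d0 hD hRe).
by move=> D Rr R1 notin Re /(part_two pXY_pmf pZ_st).
Qed.
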